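(* For all even $n\ge36$ there exist pairs of compact flat $n$-manifolds $B_1,B_2$ such that if $B_1$ and $B_2$ both appear as cusp cross-sections of a hyperbolic $(n+1)$-manifold $M$, then $M$ is not a quasi-arithmetic manifold.
   Context: For $q$ a rational quadratic form (non-degenerate quadratic form over $\mathbb{Q}$) of signature $(n+1,1)$, $\mathbb{H}_q^{n+1}$ denotes one of the two sheets of $\{x\in\mathbb{R}^{n+2}\mid q(x)=-1\}$ with the metric induced by $q$ (a model of hyperbolic $(n+1)$-space), $O^+(q;\mathbb{R})$ is the index-two subgroup of the real orthogonal group of $q$ preserving it, and $O^+(q;\mathbb{Q})=O^+(q;\mathbb{R})\cap GL_{n+2}(\mathbb{Q})$. A quasi-arithmetic hyperbolic manifold associated to $q$ is a finite-volume hyperbolic manifold of the form $\mathbb{H}_q^{n+1}/\Gamma$, where $\Gamma\le O^+(q;\mathbb{R})$ is discrete, torsion-free and commensurable to a subgroup of $O^+(q;\mathbb{Q})$ (two groups are commensurable if their intersection has finite index in both). A hyperbolic $(n+1)$-manifold is quasi-arithmetic if it is (isometric to) a quasi-arithmetic hyperbolic manifold associated to some rational quadratic form $q$ of signature $(n+1,1)$. A compact flat $n$-manifold $B$ appears as a cusp cross-section of a hyperbolic manifold $M$ if $M$ has a cusp diffeomorphic to $B\times\mathbb{R}_{\ge0}$. *)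

(* Defs.v *)
From HB Require Import structures.
From mathcomp Require Import all_boot all_order all_algebra.
From mathcomp Require Import all_classical all_reals all_analysis.

Set Implicit Arguments.
Unset Strict Implicit.
Unset Printing Implicit Defensive.

Import Order.TTheory GRing.Theory Num.Theory.
Import numFieldNormedType.Exports.

Local Open Scope classical_set_scope.
Local Open Scope ring_scope.

(** * Groups of real matrices, possibly infinite *)

Definition group_of_matrices (R : realType) (m : nat) (G : set 'M[R]_m) : Prop :=
  [/\ G 1%:M,
      forall g, G g -> g \in unitmx,
      forall g h, G g -> G h -> G (g *m h)
    & forall g, G g -> G (invmx g)].

Definition discrete (R : realType) (m : nat) (G : set 'M[R]_m) : Prop :=
  G `<=` isolated G.

Definition torsion_free (R : realType) (m : nat) (G : set 'M[R]_m) : Prop :=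
  forall (g : 'M[R]_m) (k : nat), G g -> (0 < k)%N -> g ^+ k = 1%:M -> g = 1%:M.

Definition finite_index (R : realType) (m : nat) (K G : set 'M[R]_m) : Prop :=
  K `<=` G /\ finite_set [set [set g *m k | k in K] | g in G].

Definition commensurable (R : realType) (m : nat) (G D : set 'M[R]_m) : Prop :=
  finite_index (G `&` D) G /\ finite_index (G `&` D) D.

(** * Orbit spaces and their smooth maps *)

Definition orbit (S V : Type) (act : S -> V -> V) (G : set S) (x : V) : set V :=
  [set act g x | g in G].

Fixpoint class_C (R : realType) (a b k : nat) (U : set 'cV[R]_a)
    (F : 'cV[R]_a -> 'cV[R]_b) : Prop :=
  match k with
  | 0%N => forall x, U x -> {for x, continuous F}
  | k'.+1 => (forall x, U x -> differentiable F x) /\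
             forall v, class_C k' U (fun x => 'D_v F x)
  end.

Definition smooth_on (R : realType) (a b : nat) (U : set 'cV[R]_a)
    (F : 'cV[R]_a -> 'cV[R]_b) : Prop :=
  forall k, class_C k U F.

(* A subset X of R^a and a map pX sending each point to its class (for us, its
   orbit) present the quotient [set pX x | x in X].  A map f between such
   quotients is lifted on U by F when F is C^oo on the open subset U of the
   ambient space, maps U `&` X to Y, and induces f.  Letting U be open in the
   ambient space is the usual meaning of smoothness on submanifolds of R^a,
   with or without boundary. *)
Definition lifts (R : realType) (a b : nat)
    (X : set 'cV[R]_a) (pX : 'cV[R]_a -> set 'cV[R]_a)
    (Y : set 'cV[R]_b) (pY : 'cV[R]_b -> set 'cV[R]_b)
    (f : set 'cV[R]_a -> set 'cV[R]_b)
    (U : set 'cV[R]_a) (F : 'cV[R]_a -> 'cV[R]_b) : Prop :=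
  [/\ open U, smooth_on U F &
      forall u, U u -> X u -> Y (F u) /\ f (pX u) = pY (F u)].

Definition smooth_map (R : realType) (a b : nat)
    (X : set 'cV[R]_a) (pX : 'cV[R]_a -> set 'cV[R]_a)
    (Y : set 'cV[R]_b) (pY : 'cV[R]_b -> set 'cV[R]_b)
    (f : set 'cV[R]_a -> set 'cV[R]_b) : Prop :=
  forall x, X x -> exists U F, U x /\ lifts X pX Y pY f U F.

Definition diffeomorphism (R : realType) (a b : nat)
    (X : set 'cV[R]_a) (pX : 'cV[R]_a -> set 'cV[R]_a)
    (Y : set 'cV[R]_b) (pY : 'cV[R]_b -> set 'cV[R]_b)
    (f : set 'cV[R]_a -> set 'cV[R]_b) : Prop :=
  smooth_map X pX Y pY f /\
  exists g, [/\ smooth_map Y pY X pX g,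
                forall x, X x -> g (f (pX x)) = pX x
              & forall y, Y y -> f (g (pY y)) = pY y].

Definition diffeomorphic (R : realType) (a b : nat)
    (X : set 'cV[R]_a) (pX : 'cV[R]_a -> set 'cV[R]_a)
    (Y : set 'cV[R]_b) (pY : 'cV[R]_b -> set 'cV[R]_b) : Prop :=
  exists f, diffeomorphism X pX Y pY f.

(** * Compact flat manifolds *)

(* The isometry x |-> A x + t of Euclidean n-space is the matrix
   [[A, t], [0, 1]], so that composition is matrix multiplication. *)
Definition euclidean_isometry (R : realType) (n : nat) : set 'M[R]_(n + 1) :=
  [set g | exists A : 'M[R]_n, exists t : 'cV[R]_n,
     A^T *m A = 1%:M /\ g = block_mx A t 0 1%:M].

Definition euclidean_act (R : realType) (n : nat) (g : 'M[R]_(n + 1))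
    (x : 'cV[R]_n) : 'cV[R]_n :=
  ulsubmx g *m x + ursubmx g.

(* By Killing-Hopf and Bieberbach, the compact flat n-manifolds are, up to
   isometry, the quotients of Euclidean n-space by these groups. *)
Record flat_manifold (R : realType) (n : nat) := FlatManifold {
  flat_group : set 'M[R]_(n + 1);
  _ : flat_group `<=` @euclidean_isometry R n;
  _ : group_of_matrices flat_group;
  _ : discrete flat_group;
  _ : torsion_free flat_group;
  _ : exists K : set 'cV[R]_n, compact K /\
        forall x, exists2 g, flat_group g & K (euclidean_act g x) }.

(* R^n x R_{>=0}, on which isometries of R^n act through the first factor *)
Definition half_space (R : realType) (n : nat) : set 'cV[R]_(n + 1) :=
  [set y | 0 <= dsubmx y 0 0].

Definition cylinder_act (R : realType) (n : nat) (g : 'M[R]_(n + 1))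
    (y : 'cV[R]_(n + 1)) : 'cV[R]_(n + 1) :=
  col_mx (euclidean_act g (usubmx y)) (dsubmx y).

(** * Quadratic forms and hyperbolic manifolds *)

(* A symmetric matrix Q stands for the quadratic form x |-> x^T Q x. *)
Definition bilin (R : realType) (m : nat) (Q : 'M[R]_m) (x y : 'cV[R]_m) : R :=
  (x^T *m Q *m y) 0 0.

Definition quad (R : realType) (m : nat) (Q : 'M[R]_m) (x : 'cV[R]_m) : R :=
  bilin Q x x.

Definition has_signature (R : realType) (m : nat) (Q : 'M[R]_m) (r s : nat) :
    Prop :=
  Q^T = Q /\
  exists P : 'M[R]_m, exists d : 'rV[R]_m,
    [/\ P \in unitmx, P^T *m Q *m P = diag_mx d,
        #|[pred i | 0 < d 0 i]| = r & #|[pred i | d 0 i < 0]| = s].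

Definition is_sheet (R : realType) (m : nat) (Q : 'M[R]_m) (H : set 'cV[R]_m) :
    Prop :=
  exists2 x, quad Q x = -1 & H = connected_component [set y | quad Q y = -1] x.

(* O^+(q;R), for q given by Q and the chosen sheet H *)
Definition Oplus (R : realType) (m : nat) (Q : 'M[R]_m) (H : set 'cV[R]_m) :
    set 'M[R]_m :=
  [set g | g^T *m Q *m g = Q /\ [set g *m x | x in H] = H].

Definition Oplus_rat (R : realType) (m : nat) (Q : 'M[R]_m) (H : set 'cV[R]_m) :
    set 'M[R]_m :=
  Oplus Q H `&` [set map_mx ratr g | g in [set g : 'M[rat]_m | g \in unitmx]].

(* Complete hyperbolic d-manifolds, as quotients of a sheet of the hyperboloid
   of some real form of signature (d,1). *)
Record hyperbolic_manifold (R : realType) (d : nat) := HyperbolicManifold {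
  hyp_form : 'M[R]_d.+1;
  hyp_sheet : set 'cV[R]_d.+1;
  hyp_group : set 'M[R]_d.+1;
  _ : has_signature hyp_form d 1;
  _ : is_sheet hyp_form hyp_sheet;
  _ : hyp_group `<=` Oplus hyp_form hyp_sheet;
  _ : group_of_matrices hyp_group;
  _ : discrete hyp_group;
  _ : torsion_free hyp_group }.

Definition hyp_orbit (R : realType) (d : nat) (M : hyperbolic_manifold R d) :
    'cV[R]_d.+1 -> set 'cV[R]_d.+1 :=
  orbit (fun g x => g *m x) (hyp_group M).

(* Riemannian isometry.  The tangent space of the hyperboloid at u is the
   orthogonal complement of u, and its metric is the restriction of the form. *)
Definition isometric (R : realType) (d : nat) (M N : hyperbolic_manifold R d) :
    Prop :=
  exists2 f,
    diffeomorphism (hyp_sheet M) (@hyp_orbit R d M)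
                   (hyp_sheet N) (@hyp_orbit R d N) f &
    forall U F,
      lifts (hyp_sheet M) (@hyp_orbit R d M)
            (hyp_sheet N) (@hyp_orbit R d N) f U F ->
      forall u v, U u -> hyp_sheet M u -> bilin (hyp_form M) u v = 0 ->
        quad (hyp_form N) ('D_v F u) = quad (hyp_form M) v.

(** * Volume *)

Definition lebesgue_outer (R : realType) (m : nat) (A : set 'cV[R]_m) : \bar R :=
  ereal_inf [set v | exists lo hi : nat -> 'cV[R]_m,
    [/\ forall k i, lo k i 0 <= hi k i 0,
        A `<=` \bigcup_k [set x | forall i, lo k i 0 <= x i 0 <= hi k i 0]
      & v = (\sum_(0 <= k <oo) (\prod_i (hi k i 0 - lo k i 0))%:E)%E]].

Definition truncated_cone (R : realType) (m : nat) (D : set 'cV[R]_m) :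
    set 'cV[R]_m :=
  [set x | exists t y, [/\ 0 < t <= 1, D y & x = t *: y]].

(* In polar coordinates x = t y, with t > 0 and q(y) = -1, Lebesgue measure on
   R^m is |det Q|^(-1/2) t^(m-1) dt dvol(y), where vol is the Riemannian volume
   of the hyperboloid.  Hence vol(D) is m |det Q|^(1/2) times the Lebesgue
   measure of the truncated cone over D. *)
Definition hyperboloid_volume (R : realType) (m : nat) (Q : 'M[R]_m)
    (D : set 'cV[R]_m) : \bar R :=
  ((m%:R * Num.sqrt `|\det Q|)%:E *
   lebesgue_outer (truncated_cone D))%E.

(* The infimum is attained at a fundamental domain. *)
Definition volume (R : realType) (d : nat) (M : hyperbolic_manifold R d) :
    \bar R :=
  ereal_inf [set hyperboloid_volume (hyp_form M) D | D in
    [set D | D `<=` hyp_sheet M /\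
       forall x, hyp_sheet M x -> exists2 g, hyp_group M g & D (g *m x)]].

(** * Quasi-arithmetic manifolds *)

Definition quasi_arithmetic_for (R : realType) (d : nat) (q : 'M[rat]_d.+1)
    (M : hyperbolic_manifold R d) : Prop :=
  [/\ hyp_form M = map_mx ratr q,
      (volume M < +oo)%E
    & exists D : set 'M[R]_d.+1,
        [/\ group_of_matrices D, D `<=` Oplus_rat (hyp_form M) (hyp_sheet M)
          & commensurable (hyp_group M) D]].

Definition quasi_arithmetic (R : realType) (d : nat)
    (M : hyperbolic_manifold R d) : Prop :=
  exists (q : 'M[rat]_d.+1) (N : hyperbolic_manifold R d),
    quasi_arithmetic_for q N /\ isometric M N.

(** * Cusps *)

(* A nonzero isotropic v spans the ray of a point at infinity, up to sign, and
   the closed horoballs there are obtained by rescaling v. *)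
Definition horoball (R : realType) (d : nat) (M : hyperbolic_manifold R d)
    (v : 'cV[R]_d.+1) : set 'cV[R]_d.+1 :=
  [set x | hyp_sheet M x /\ `|bilin (hyp_form M) x v| <= 1].

(* A cusp is the image in M of a horoball whose translates under the group of M
   are equal to it or disjoint from it.  That the cusp has full rank follows
   from being diffeomorphic to B x R_{>=0} with B compact. *)
Definition cusp_cross_section (R : realType) (n : nat) (B : flat_manifold R n)
    (M : hyperbolic_manifold R n.+1) : Prop :=
  exists v : 'cV[R]_n.+2,
    [/\ v != 0, quad (hyp_form M) v = 0,
        forall g, hyp_group M g ->
          [set g *m x | x in horoball M v] = horoball M v \/
          [set g *m x | x in horoball M v] `&` horoball M v = set0
      & diffeomorphic (horoball M v) (@hyp_orbit R n.+1 M)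
          (@half_space R n) (orbit (@cylinder_act R n) (flat_group B))].

(* Main.v *)
From HB Require Import structures.
From mathcomp Require Import all_boot all_order all_algebra.
From mathcomp Require Import all_classical all_reals all_analysis.
From mathcomp Require Import perm ring lra zify.
Require Import Defs.

(** Let B be the cusp cross-section of a quasi-arithmetic manifold of rational
    form q. The translations of B make up a lattice Z^n, and the holonomy group
    of B acts on it by integral matrices. The idea is that q puts on this
    lattice a rational form that is invariant under holonomy and has determinant
    -det q up to squares of rationals, whereas the holonomy representation can be
    so rigid that all invariant forms have one and the same determinant up to
    squares. Two flat manifolds with different such determinants then cannot be
    cross-sections of the same quasi-arithmetic manifold.

    To find the form, the cusp is compared with B on the level of fundamental
    groups. A diffeomorphism of quotients lifts to the contractible total spaces
    (lift_exists), and conjugating by the lift embeds the group of B in the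
    group of the hyperbolic manifold (diffeomorphic_hom, cusp_hom). So Z^n acts
    on the hyperboloid as a discrete group of isometries, and a multiple of it
    by rational matrices, by commensurability (finite_index_power). Such a
    group fixes an isotropic line (common_isotropic), scales it by signs at most
    (isotropic_eigenvalue), and is unipotent because its rank n is the dimension
    of the horospheres (psi_unipotent). Hence the isotropic line is rational,
    and for a rational vector y off its orthogonal complement the displacements
    u |-> psi u y - y are additive modulo the line. Their Gram matrix is the
    rational form; splitting off the hyperbolic plane spanned by the line and y
    computes its determinant (unipotent_form, lattice_form).

    The rigid examples are built from root lattices A_2 and A_4, on which Z^2
    acts through the characters of (Z/3)^2 and (Z/5)^2 by cyclic rotations.
    Every line of characters occurs, so that each nontrivial element of the
    holonomy group acts without rotation on some component; there it is made to
    act by a nontrivial translation, which makes the group torsion-free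
    (component_manifold). The group ring contains an element that is
    anti-self-adjoint for every invariant form; it can be chosen nonsingular,
    as no character of the holonomy representation is real. Since skew-symmetric
    determinants are squares, invariant forms have determinants in a single
    class modulo squares (invariant_form_det), that of the product of the
    determinants 3 of A_2 and 5 of A_4.

    For n even and at least 36, let B1 have n/2 components A_2, and B2 seven
    components A_4 and (n-28)/2 components A_2, at least four of them to
    accommodate all lines of characters. Were both to occur with the same q, the
    product 3^(n/2) 3^((n-28)/2) 5^7 would be a square, and so would 5. *)

Set Implicit Arguments.
Unset Strict Implicit.
Unset Printing Implicit Defensive.

Import Order.TTheory GRing.Theory Num.Theory.
Import numFieldNormedType.Exports.

Local Open Scope classical_set_scope.
Local Open Scope ring_scope.

(** * Uniqueness of lifts to a covering *)

(** The supremum of the points up to which P holds is within d of one of them,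
    from which P passes beyond the supremum, unless this is s. *)
Lemma real_propagation (R : realType) (P : R -> Prop) (s : R) :
  0 <= s -> P 0 ->
  (forall t, 0 <= t <= s -> exists2 d, 0 < d & forall a b, 0 <= a -> a <= b ->
     b <= s -> `|a - t| < d -> `|b - t| < d -> P a -> P b) ->
  P s.
Proof.
move=> s0 P0 step; pose S := [set t | 0 <= t <= s /\ P t].
have S0 : S 0 by split; rewrite // lexx s0.
have supS : has_sup S by split; [exists 0 | exists s => t [/andP[]]].
have sup0 : 0 <= sup S by apply: ub_le_sup => //; case: supS.
have sups : sup S <= s by apply: ge_sup; [exists 0 | move=> t [/andP[]]].
have [|d d0 Pd] := step (sup S); first by rewrite sup0.
have [a [/andP[a0 as_] Pa] aS] := sup_adherent d0 supS.
have aS' : a <= sup S by apply: ub_le_sup => //; [case: supS | split; rewrite ?a0].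
have [bs|bs] := leP s (sup S + d / 2).
  apply: (Pd a) => //.
  - by rewrite ltr_norml; lra.
  - by rewrite ltr_norml; lra.
have Pb : P (sup S + d / 2).
  apply: (Pd a) => //; first lra.
  - by rewrite ltW.
  - by rewrite ltr_norml; lra.
  - by rewrite ltr_norml; lra.
have : sup S + d / 2 <= sup S.
  by apply: ub_le_sup; [case: supS | split => //; rewrite ltW //; lra].
lra.
Qed.

Definition cont_within (V W : topologicalType) (A : set V) (F : V -> W) :=
  forall x, A x -> F @ within A (nbhs x) --> F x.

(** The maps act on the whole ambient space W. By the last condition the part of
    H that acts on Y does so freely and properly discontinuously, so that Y
    covers its space of orbits. *)
Definition covering_group (W : topologicalType) (Y : set W) (H : set (W -> W)) :=
  [/\ H id, forall h k, H h -> H k -> H (h \o k),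
      forall h, H h -> exists2 k, H k & cancel h k /\ cancel k h,
      forall h, H h -> continuous h
    & forall y, Y y -> exists2 U, nbhs y U &
        forall h z, H h -> Y z -> U z -> U (h z) -> h =1 id].

Section Paths.
Variables (R : realType) (W : topologicalType) (Y : set W) (H : set (W -> W)).
Hypothesis covH : covering_group Y H.

(** Writing g = k f near the limit, both f and h^-1 k f are close to y, and h^-1
    k is the identity as soon as they lie in a set that it must move off itself. *)
Lemma local_unique (T : Type) (F : set_system T) {FF : Filter F} (f g : T -> W)
    (y : W) (h : W -> W) :
  Y y -> H h -> f @ F --> y -> g @ F --> h y ->
  (\forall x \near F, Y (f x) /\ exists2 k, H k & g x = k (f x)) ->
  \forall x \near F, g x = h (f x).
Proof.
have [Hid Hc Hi Hcont HPD] := covH => Yy Hh fy gy near_orb.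
have [U Uy PD] := HPD _ Yy.
have [k Hk [hk kh]] := Hi _ Hh.
have fU : \forall x \near F, U (f x) by exact: fy.
have gU : \forall x \near F, U (k (g x)).
  have : (k \o g) @ F --> k (h y) by apply: cvg_comp; [exact: gy | exact: Hcont].
  by rewrite hk => /(_ U Uy).
near=> x.
have [Yfx [l Hl gl]] : Y (f x) /\ exists2 k, H k & g x = k (f x) by near: x.
have : (k \o l) =1 id.
  apply: (PD _ (f x)) => //; first exact: Hc.
    by near: x.
  by rewrite /= -gl; near: x.
by move=> /(_ (f x)) /= kl; rewrite gl -{1}(kh (l (f x))) kl.
Unshelve. all: by end_near. Qed.

Lemma covering_free h y : H h -> Y y -> h y = y -> h =1 id.
Proof.
have [_ _ _ _ HPD] := covH => Hh Yy hy; have [U Uy PD] := HPD _ Yy.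
by apply: (PD _ y) => //; rewrite ?hy; exact: nbhs_singleton.
Qed.

(** Near a time t the two lifts differ by one element of H. Where they agree
    this element is the identity, since the action is free. *)
Lemma path_unique (f g : R -> W) (s : R) :
  0 <= s -> cont_within (`[0, s]%classic) f -> cont_within (`[0, s]%classic) g ->
  (forall t, (`[0, s]%classic) t -> Y (f t) /\ exists2 h, H h & g t = h (f t)) ->
  f 0 = g 0 -> f s = g s.
Proof.
move=> s0 cf cg orb fg0.
apply: (@real_propagation _ (fun t => f t = g t) s) => // t tI.
have tI' : (`[0, s]%classic) t by rewrite /= in_itv.
have [Yt [h Hh gt]] := orb t tI'.
have near_h : \forall x \near within (`[0, s]%classic) (nbhs t), g x = h (f x).
  apply: (@local_unique _ _ _ f g (f t) h) => //.
  - exact: cf.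
  - by rewrite -gt; exact: cg.
  - by rewrite near_withinE; near=> x => /orb.
have [d d0 dh] : exists2 d, 0 < d & forall x, `|t - x| < d -> (`[0, s]%classic) x -> g x = h (f x).
  by move: near_h; rewrite near_withinE => /nbhs_ballP[d d0 bd]; exists d.
exists d => // a b a0 ab bs ad bd fga.
have Ia : (`[0, s]%classic) a by rewrite /= in_itv /= a0 (le_trans ab).
have Ib : (`[0, s]%classic) b by rewrite /= in_itv /= bs (le_trans a0).
have hid : h =1 id.
  apply: (@covering_free h (f a)) => //; first by case: (orb a Ia).
  by rewrite -dh // distrC.
by rewrite (dh b) ?hid // distrC.
Unshelve. all: by end_near. Qed.

End Paths.

(** * Lifting along contractions *)

(** The last condition is the joint continuity of c at the points of X x [0, 1],
    which need not be interior. *)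
Definition contraction (R : realType) (V : pseudoMetricNormedZmodType R)
    (X : set V) (x0 : V) (c : V -> R -> V) :=
  [/\ X x0, forall x, X x -> c x 0 = x0, forall x, X x -> c x 1 = x,
      forall x t, X x -> 0 <= t <= 1 -> X (c x t)
    & forall x t, X x -> 0 <= t <= 1 -> forall A, nbhs (c x t) A ->
        exists2 d, 0 < d & forall x' t', X x' -> 0 <= t' <= 1 ->
          ball x d x' -> `|t' - t| < d -> A (c x' t')].

Lemma cvg_withinI (V W : topologicalType) (A : set V) (F : V -> W) (x : V) (l : W) :
  (forall B : set W, nbhs l B -> \forall u \near x, A u -> B (F u)) ->
  F @ within A (nbhs x) --> l.
Proof. by move=> FB B /FB. Qed.

Lemma cvg_within_comp (U V W : topologicalType) (A : set U) (B : set V)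
    (f : U -> V) (g : V -> W) (x : U) :
  f @ within A (nbhs x) --> f x -> (forall u, A u -> B (f u)) ->
  g @ within B (nbhs (f x)) --> g (f x) ->
  (g \o f) @ within A (nbhs x) --> g (f x).
Proof.
move=> cf AB cg; apply: cvg_withinI => C /cg /cf.
by apply: (@filterS _ (nbhs x)) => u Cu Au; apply: Cu => //; exact: AB.
Qed.

Lemma cvg_within_sub (U V : topologicalType) (A B : set U) (f : U -> V) (x : U)
    (l : V) : A `<=` B -> f @ within B (nbhs x) --> l -> f @ within A (nbhs x) --> l.
Proof.
move=> AB cf; apply: cvg_withinI => C /cf.
by apply: (@filterS _ (nbhs x)) => u Cu /AB /Cu.
Qed.

Section Lift.
Variables (R : realType) (V W : pseudoMetricNormedZmodType R).
Variables (X : set V) (x0 : V) (c : V -> R -> V).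
Hypothesis contrX : contraction X x0 c.
Variables (Y : set W) (H : set (W -> W)).
Hypothesis covH : covering_group Y H.
Hypothesis stabH : forall h y, H h -> Y y -> Y (h y) -> forall z, Y z -> Y (h z).

Lemma contraction_path_cont x : X x ->
  cont_within (`[0, 1]%classic : set R) (c x).
Proof.
have [_ _ _ _ cc] := contrX => Xx t /=; rewrite in_itv /= => tI.
apply: cvg_withinI => A /(cc x t Xx tI)[d d0 dA]; apply/nbhs_ballP; exists d => //= u; rewrite /ball/= => tu.
by rewrite in_itv /= => uI; apply: dA => //; [exact: ballxx | rewrite distrC].
Qed.

Lemma lift_unique (f g : V -> W) :
  cont_within X f -> cont_within X g ->
  (forall x, X x -> Y (f x) /\ exists2 h, H h & g x = h (f x)) ->
  f x0 = g x0 -> forall x, X x -> f x = g x.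
Proof.
have [X0 c0 c1 cX _] := contrX => cf cg orb fg0 x Xx.
have tr f' : cont_within X f' -> cont_within (`[0, 1]%classic : set R) (f' \o c x).
  move=> cf' t tI; have tI' := tI; move: tI'; rewrite /= in_itv /= => tI'.
  apply: cvg_within_comp (cf' _ (cX _ _ Xx tI')); first exact: contraction_path_cont.
  by move=> u; rewrite /= in_itv /=; exact: cX.
rewrite -(c1 _ Xx); apply: (path_unique covH (f := f \o c x) (g := g \o c x)) => //=.
- exact: tr.
- exact: tr.
- by move=> t; rewrite in_itv /= => tI; apply: orb; exact: cX.
- by rewrite c0.
Qed.

(* Rel x y says that y represents the image of x under the map to Y / H that is
   to be lifted. *)
Variables (Rel : V -> W -> Prop) (y0 : W).
Hypothesis Rel_orbit : forall x y z, X x -> Y y -> Y z -> Rel x y -> Rel x z ->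
  exists2 h, H h & z = h y.
Hypothesis Rel_act : forall x y h, X x -> Rel x y -> H h -> Rel x (h y).
Hypothesis Rel_local : forall x, X x -> exists2 U, nbhs x U & exists2 F : V -> W,
  (forall u, U u -> X u -> F @ within X (nbhs u) --> F u) &
  forall u, U u -> X u -> Y (F u) /\ Rel u (F u).
Hypotheses (Y0 : Y y0) (Rel0 : Rel x0 y0).

Let path_lift x s y := exists g : R -> W, [/\ g 0 = y0, g s = y,
  cont_within (`[0, s]%classic : set R) g
  & forall t, 0 <= t <= s -> Y (g t) /\ Rel (c x t) (g t)].

Let path_lift_unique x s y z : X x -> 0 <= s <= 1 ->
  path_lift x s y -> path_lift x s z -> y = z.
Proof.
have [_ _ _ cX _] := contrX.
move=> Xx /andP[s0 s1] [f [f0 <- cf fY]] [g [g0 <- cg gY]].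
apply: (path_unique covH) => //; last by rewrite f0.
move=> t; rewrite /= in_itv /= => tI.
have [Yf Rf] := fY _ tI; have [Yg Rg] := gY _ tI; split => //.
apply: Rel_orbit Yf Yg Rf Rg; apply: cX => //.
by move: tI => /andP[-> /le_trans ->].
Qed.

(** The form of the homotopy lifting property that propagates along [0, 1]: the
    ends at time s of the lifted paths exist near x and are continuous at x. *)
Let tube x s := exists2 l : V -> W,
  (\forall x' \near within X (nbhs x), path_lift x' s (l x')) &
  l @ within X (nbhs x) --> l x.

(** Beyond t the lifts are continued by h o F, where F is a local lift near c x
    t and h in H brings F to the lift already constructed. *)
Let tube_all x : X x -> tube x 1.
Proof.
have [X0 c0 c1 cX cc] := contrX; have [Hid Hc Hi Hcont HPD] := covH.
move=> Xx; apply: (@real_propagation _ (tube x) 1) => //.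
  exists (fun=> y0); last exact: cvg_cst.
  rewrite near_withinE; near=> x' => Xx'; exists (fun=> y0); split => //.
  - by move=> t _; exact: cvg_cst.
  - move=> t t0; have -> : t = 0 by apply/eqP; rewrite eq_le andbC.
    by rewrite c0.
move=> t tI; have [U Ux [F Fc FY]] := Rel_local (cX x t Xx tI).
have [d d0 dU] := cc x t Xx tI U Ux.
exists d => // a b a0 ab b1 ad bd [l l_lift lc].
have aI : 0 <= a <= 1 by rewrite a0 (le_trans ab).
have bI : 0 <= b <= 1 by rewrite b1 (le_trans a0).
have lx : path_lift x a (l x).
  move: l_lift; rewrite near_withinE => /nbhs_singleton; exact.
have xd : ball x d x by exact: ballxx.
have [Ya Ra] := FY _ (dU _ _ Xx aI xd ad) (cX _ _ Xx aI).
have [Yl Rl] : Y (l x) /\ Rel (c x a) (l x).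
  by have [g [_ <- _]] := lx; apply; rewrite a0 lexx.
have [h Hh lxh] := Rel_orbit (cX _ _ Xx aI) Ya Yl Ra Rl.
have hY z : Y z -> Y (h z) by apply: (stabH Hh Ya); rewrite -lxh.
have Fcont t' x' : X x' -> 0 <= t' <= 1 -> `|t' - t| < d -> ball x d x' ->
    (fun u => F (c u t')) @ within X (nbhs x') --> F (c x' t').
  move=> Xx' tI' td xd'.
  have Uct : U (c x' t') by exact: dU.
  apply: (@cvg_within_comp _ _ _ _ X (fun u => c u t') F) (Fc _ Uct (cX _ _ Xx' tI')).
    apply: cvg_withinI => A /(cc _ _ Xx' tI')[e e0 eA].
    apply/nbhs_ballP; exists e => //= u xu Xu; apply: eA => //.
    by rewrite subrr normr0.
  by move=> u Xu; exact: cX.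
have near_l : \forall x' \near within X (nbhs x), l x' = h (F (c x' a)).
  apply: (@local_unique _ Y H covH _ _ _ (fun u => F (c u a)) l (F (c x a))) => //.
  - exact: Fcont.
  - by rewrite -lxh.
  - move: l_lift; rewrite !near_withinE; near_simpl => l_lift.
    near=> x' => Xx'.
    have xd' : ball x d x' by near: x'; exact: nbhsx_ballx.
    have [Ya' Ra'] := FY _ (dU _ _ Xx' aI xd' ad) (cX _ _ Xx' aI).
    split => //; apply: (Rel_orbit (cX _ _ Xx' aI)) => //.
    + have [g [_ <- _]] : path_lift x' a (l x') by apply: (near l_lift x').
      by move=> /(_ a); rewrite a0 lexx => /(_ isT) [].
    + have [g [_ <- _]] : path_lift x' a (l x') by apply: (near l_lift x').
      by move=> /(_ a); rewrite a0 lexx => /(_ isT) [].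
exists (fun u => h (F (c u b))); last first.
  have := Fcont b x Xx bI bd xd.
  by move=> /(cvg_comp _ _) ; apply; exact: Hcont.
move: l_lift near_l; rewrite !near_withinE => l_lift near_l.
near=> x' => Xx'.
have xd' : ball x d x' by near: x'; exact: nbhsx_ballx.
have la : l x' = h (F (c x' a)) by apply: (near near_l x').
have [g [g0 ga gc gY]] : path_lift x' a (l x') by apply: (near l_lift x').
pose g2 u := h (F (c x' u)).
have mid u : a <= u <= b -> [/\ 0 <= u <= 1, `|u - t| < d & U (c x' u)].
  move=> /andP[au ub].
  have uI : 0 <= u <= 1 by rewrite (le_trans a0 au) (le_trans ub b1).
  have ud : `|u - t| < d.
    by move: ad bd; rewrite !ltr_norml => /andP[? ?] /andP[? ?]; apply/andP; split; lra.
  by split => //; exact: dU.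
have g2c : cont_within (`[a, b]%classic : set R) g2.
  move=> u; rewrite /= in_itv /= => uI; have [uI1 ud Uu] := mid _ uI.
  apply: (@cvg_comp _ _ _ (F \o c x') h _ (nbhs (F (c x' u)))); last exact: Hcont.
  apply: (@cvg_within_comp _ _ _ _ X (c x') F) (Fc _ Uu (cX _ _ Xx' uI1)).
    apply: (@cvg_within_sub R _ _ (`[0, 1]%classic : set R)).
      by move=> w /=; rewrite !in_itv /= => /mid[].
    by apply: contraction_path_cont => //; rewrite /= in_itv.
  by move=> w; rewrite /= in_itv /= => wI; have [? _ _] := mid _ wI; apply: cX.
pose gg u := if u <= a then g u else g2 u.
exists gg; split.
- by rewrite /gg a0.
- rewrite /gg; have [ba|] := leP b a => //.
  have ab' : a = b by apply/eqP; rewrite eq_le ab.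
  by rewrite -ab' ga la.
- have -> : `[0, b]%classic = `[0, a]%classic `|` `[a, b]%classic :> set R.
    apply/seteqP; split => u /=; rewrite !in_itv /=.
      by have [ua|ua] := leP u a => /andP[u0 ub]; [left; rewrite u0 | right; rewrite ltW].
    by move=> [/andP[-> /le_trans ->] //|/andP[/(le_trans a0) -> ->]].
  have : {within `[0, a]%classic `|` `[a, b]%classic, continuous gg}.
    apply: withinU_continuous; [exact: interval_closed|exact: interval_closed| |].
    + have : {within `[0, a]%classic, continuous g} by apply/subspace_continuousP.
      apply: subspace_eq_continuous => u; rewrite inE /= in_itv /= => /andP[_ ua].
      by change (g u = gg u); rewrite /gg ifT.
    + have : {within `[a, b]%classic, continuous g2} by apply/subspace_continuousP.
      apply: subspace_eq_continuous => u; rewrite inE /= in_itv /= => /andP[au _].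
      change (g2 u = gg u); rewrite /gg; case: ifP => // ua.
      have -> : u = a by apply/eqP; rewrite eq_le ua.
      by rewrite ga la.
  by move/subspace_continuousP.
- move=> u /andP[u0 ub]; rewrite /gg; have [ua|ua] := leP u a.
    by apply: gY; rewrite u0.
  have [uI ud Uu] : [/\ 0 <= u <= 1, `|u - t| < d & U (c x' u)] by apply: mid; rewrite ltW.
  have [YF RF] := FY _ Uu (cX _ _ Xx' uI).
  by split; [exact: hY | apply: Rel_act => //; exact: cX].
Unshelve. all: by end_near. Qed.

Theorem lift_exists : exists F : V -> W,
  cont_within X F /\ forall x, X x -> Y (F x) /\ Rel x (F x).
Proof.
have [X0 c0 c1 cX cc] := contrX.
have one01 : (0 : R) <= (1 : R) <= (1 : R) by rewrite ler01 lexx.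
have tubeW x : X x -> exists y, path_lift x 1 y.
  move=> /[dup] Xx /tube_all[l + _]; rewrite near_withinE => /nbhs_singleton lx.
  by exists (l x); exact: lx.
pose F x := xget y0 [set y | path_lift x 1 y].
have FP x : X x -> path_lift x 1 (F x).
  by move=> /tubeW[y xy]; rewrite /F; case: xgetP => [z _ //|/(_ y)].
exists F; split.
- move=> x Xx; have [l + lc] := tube_all Xx; rewrite near_withinE => l_lift.
  have lF x' : X x' -> path_lift x' 1 (l x') -> F x' = l x'.
    by move=> Xx' ll; exact: path_lift_unique Xx' one01 (FP _ Xx') ll.
  have Fx : F x = l x by apply: lF => //; exact: (nbhs_singleton l_lift).
  rewrite Fx; apply: cvg_trans lc; apply: near_eq_cvg.
  rewrite near_withinE; near=> x' => Xx'; apply/esym/lF => //.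
  by apply: (near l_lift x').
- move=> x Xx; have [g [_ <- _]] := FP _ Xx; move=> /(_ 1 one01).
  by rewrite c1.
Unshelve. all: by end_near. Qed.
End Lift.

(** * Diffeomorphisms of quotients and homomorphisms of groups *)

(** A quotient whose projection is a covering with contractible total space, for
    a group of matrices G. Elements of G may move X off itself, as happens for a
    horoball in a hyperbolic manifold; gq_stab says that the others preserve X. *)
Record good_quotient (R : realType) (a k : nat) (X : set 'cV[R]_a)
    (act : 'M[R]_k -> 'cV[R]_a -> 'cV[R]_a) (G : set 'M[R]_k) : Prop :=
  GoodQuotient {
  gq_group : group_of_matrices G;
  gq_actM : forall g h x, G g -> G h -> act (g *m h) x = act g (act h x);
  gq_act1 : forall x, act 1%:M x = x;
  gq_cont : forall g, G g -> continuous (act g);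
  gq_stab : forall g x z, G g -> X x -> X (act g x) -> X z -> X (act g z);
  gq_disc : forall x, X x -> exists2 U, nbhs x U &
    forall g z, G g -> X z -> U z -> U (act g z) -> g = 1%:M;
  gq_contr : exists x0 c, contraction X x0 c }.

Section GoodQuotient.
Variables (R : realType) (a k : nat) (X : set 'cV[R]_a).
Variables (act : 'M[R]_k -> 'cV[R]_a -> 'cV[R]_a) (G : set 'M[R]_k).
Hypothesis gq : good_quotient X act G.
Let H := [set act g | g in G].

Lemma gq_covering : covering_group X H.
Proof.
have [G1 Gu GM GV] := gq_group gq; split.
- by exists 1%:M => //; apply/funext => x; rewrite (gq_act1 gq).
- move=> _ _ [g Gg <-] [h Gh <-]; exists (g *m h); first exact: GM.
  by apply/funext => x; rewrite (gq_actM gq).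
- move=> _ [g Gg <-]; exists (act (invmx g)); first by exists (invmx g) => //; exact: GV.
  split=> x; rewrite -(gq_actM gq) //; try exact: GV.
  + by rewrite mulVmx ?(gq_act1 gq) //; exact: Gu.
  + by rewrite mulmxV ?(gq_act1 gq) //; exact: Gu.
- by move=> _ [g Gg <-]; exact: gq_cont gq _ Gg.
- move=> x /(gq_disc gq)[U Ux PD]; exists U => // _ z [g Gg <-] Xz Uz Ugz y.
  by rewrite (PD g z) // (gq_act1 gq).
Qed.

Lemma gq_stabH h y : H h -> X y -> X (h y) -> forall z, X z -> X (h z).
Proof. by move=> [g Gg <-] Xy Xgy z Xz; exact: (gq_stab gq) Xy Xgy Xz. Qed.

Lemma gq_free g g' x : G g -> G g' -> X x -> act g x = act g' x -> g = g'.
Proof.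
have [G1 Gu GM GV] := gq_group gq => Gg Gg' Xx gx.
have [U Ux PD] := gq_disc gq Xx.
have Ugx := nbhs_singleton Ux.
have : invmx g *m g' = 1%:M.
  apply: (PD _ x) => //; first by apply: GM => //; exact: GV.
  rewrite (gq_actM gq) //; last exact: GV.
  rewrite -gx -(gq_actM gq) //; last exact: GV.
  by rewrite mulVmx ?(gq_act1 gq) //; exact: Gu.
move/(congr1 (mulmx g)); rewrite mulmxA mulmxV ?mul1mx ?mulmx1 //; exact: Gu.
Qed.

Lemma gq_orbitP x y : orbit act G x = orbit act G y <-> exists2 h, H h & y = h x.
Proof.
have [G1 Gu GM GV] := gq_group gq; split.
  move=> xy; have : orbit act G x y by rewrite xy; exists 1%:M => //; exact: (gq_act1 gq).
  by move=> [g Gg <-]; exists (act g) => //; exists g.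
move=> [_ [g Gg <-] ->]; apply/seteqP; split=> _ [h Gh <-].
  exists (h *m invmx g); first by apply: GM => //; exact: GV.
  rewrite -(gq_actM gq) //; last by apply: GM => //; exact: GV.
  by rewrite mulmxKV //; exact: Gu.
by exists (h *m g); [exact: GM | rewrite (gq_actM gq)].
Qed.

End GoodQuotient.

(** Smooth maps of quotients have continuous local lifts by definition, and
    contractibility of X glues them. *)
Lemma smooth_map_lift (R : realType) (a k b l : nat) (X : set 'cV[R]_a)
    (actX : 'M[R]_k -> 'cV[R]_a -> 'cV[R]_a) (G : set 'M[R]_k)
    (Y : set 'cV[R]_b) (actY : 'M[R]_l -> 'cV[R]_b -> 'cV[R]_b) (H : set 'M[R]_l)
    (f : set 'cV[R]_a -> set 'cV[R]_b) :
  good_quotient X actX G -> good_quotient Y actY H ->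
  smooth_map X (orbit actX G) Y (orbit actY H) f ->
  exists F : 'cV[R]_a -> 'cV[R]_b, cont_within X F /\
    forall x, X x -> Y (F x) /\ f (orbit actX G x) = orbit actY H (F x).
Proof.
move=> gqX gqY sf; have [x0 [c contrX]] := gq_contr gqX.
have X0 : X x0 by case: contrX.
have loc x : X x -> exists2 U, nbhs x U & exists2 F : 'cV[R]_a -> 'cV[R]_b,
    (forall u, U u -> X u -> F @ within X (nbhs u) --> F u) &
    forall u, U u -> X u -> Y (F u) /\ f (orbit actX G u) = orbit actY H (F u).
  move=> /sf[U [F [Ux [oU sF FP]]]]; exists U; first by apply: open_nbhs_nbhs.
  exists F => // u Uu _; apply: cvg_within_filter.
  by have := sF 0%N u Uu.
have [U0 /nbhs_singleton U0x [F0 _ F0P]] := loc _ X0.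
have [Y0 R0] := F0P _ U0x X0.
apply: (lift_exists contrX (gq_covering gqY) (gq_stabH gqY)
  (Rel := fun x y => f (orbit actX G x) = orbit actY H y) (y0 := F0 x0)) => //.
- by move=> x y z _ Yy Yz -> /(gq_orbitP gqY).
- by move=> x y h Xx -> Hh; apply/(gq_orbitP gqY); exists h.
Qed.

Lemma diffeomorphic_sym (R : realType) (a b : nat) (X : set 'cV[R]_a) pX
    (Y : set 'cV[R]_b) pY : diffeomorphic X pX Y pY -> diffeomorphic Y pY X pX.
Proof. by move=> [f [sf [g [sg fg gf]]]]; exists g; split => //; exists f. Qed.

(** Groups are sets of matrices here, so phi is constrained on G only. *)
Definition injective_hom (R : realType) (k l : nat) (G : set 'M[R]_k) (H : set 'M[R]_l)
    (phi : 'M[R]_k -> 'M[R]_l) :=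
  [/\ forall g, G g -> H (phi g),
      forall g h, G g -> G h -> phi (g *m h) = phi g *m phi h
    & forall g h, G g -> G h -> phi g = phi h -> g = h].

(** The lift F of the diffeomorphism carries the action of g to that of some phi
    g by uniqueness of lifts. Following F by a lift of the inverse gives an
    element of G, so F is injective and phi is too. There is no surjectivity, as
    elements of H may move Y off itself. *)
Theorem diffeomorphic_hom (R : realType) (a k b l : nat) (X : set 'cV[R]_a)
    (actX : 'M[R]_k -> 'cV[R]_a -> 'cV[R]_a) (G : set 'M[R]_k)
    (Y : set 'cV[R]_b) (actY : 'M[R]_l -> 'cV[R]_b -> 'cV[R]_b) (H : set 'M[R]_l) :
  good_quotient X actX G -> good_quotient Y actY H ->
  (forall g x, G g -> X x -> X (actX g x)) ->
  diffeomorphic X (orbit actX G) Y (orbit actY H) ->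
  exists phi, injective_hom G H phi.
Proof.
move=> gqX gqY GX [f [sf [f' [sf' f'f ff']]]].
have [G1 Gu GM GV] := gq_group gqX; have [H1 Hu HM HV] := gq_group gqY.
have [x0 [c contrX]] := gq_contr gqX.
have X0 : X x0 by case: contrX.
have [F [Fc FP]] := smooth_map_lift gqX gqY sf.
have [F' [F'c F'P]] := smooth_map_lift gqY gqX sf'.
have orbX g x : G g -> orbit actX G (actX g x) = orbit actX G x.
  by move=> Gg; apply/esym/(gq_orbitP gqX); exists (actX g) => //; exists g.
(* F' \o F is a deck transformation *)
have [g0 Gg0 F'F] : exists2 g0, G g0 & forall x, X x -> actX g0 x = F' (F x).
  have F'Forb x : X x -> exists2 g, G g & F' (F x) = actX g x.
    move=> Xx; have [YF RF] := FP _ Xx; have [XF' RF'] := F'P _ YF.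
    have : orbit actX G x = orbit actX G (F' (F x)) by rewrite -RF' -RF f'f.
    by move=> /(gq_orbitP gqX)[_ [g Gg <-] ->]; exists g.
  have [g0 Gg0 g00] := F'Forb _ X0; exists g0 => //.
  apply: (lift_unique contrX (gq_covering gqX) (f := actX g0) (g := F' \o F)).
  - by move=> x Xx; apply: cvg_within_filter; exact: (gq_cont gqX Gg0).
  - move=> x Xx; have [YF _] := FP _ Xx.
    apply: (@cvg_within_comp _ _ _ X Y F F'); [exact: Fc | | exact: F'c].
    by move=> u /FP[].
  - move=> x Xx; split; first exact: GX.
    have [g Gg /= ->] := F'Forb _ Xx; apply/(gq_orbitP gqX); by rewrite !orbX.
  - by rewrite /= g00.
pose phi g := xget 1%:M [set h | H h /\ F (actX g x0) = actY h (F x0)].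
have orbF x y : X x -> X y -> orbit actX G x = orbit actX G y ->
    exists2 h, [set actY g | g in H] h & F y = h (F x).
  move=> Xx Xy xy; apply/(gq_orbitP gqY).
  by have [_ <-] := FP _ Xx; have [_ <-] := FP _ Xy; rewrite xy.
have phiP g : G g -> H (phi g) /\ F (actX g x0) = actY (phi g) (F x0).
  move=> Gg; have [_ [h Hh <-] hF] := orbF _ _ X0 (GX _ _ Gg X0) (esym (orbX _ _ Gg)).
  by rewrite /phi; case: xgetP => [z _ //|/(_ h)]; case; split.
have phiF g x : G g -> X x -> actY (phi g) (F x) = F (actX g x).
  move=> Gg; have [Hg gF] := phiP _ Gg.
  have Yphi y : X y -> Y (actY (phi g) (F y)).
    move=> Xy; apply: (gq_stab gqY Hg (x := F x0)).
    - by case: (FP _ X0).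
    - by rewrite -gF; case: (FP _ (GX _ _ Gg X0)).
    - by case: (FP _ Xy).
  move: x; apply: (lift_unique contrX (gq_covering gqY)
    (f := fun x => actY (phi g) (F x)) (g := fun x => F (actX g x))).
  - move=> x Xx; apply: (@cvg_comp _ _ _ F (actY (phi g)) _ (nbhs (F x))); first exact: Fc.
    exact: (gq_cont gqY).
  - move=> x Xx; apply: (@cvg_within_comp _ _ _ X X (actX g) F).
    + by apply: cvg_within_filter; exact: (gq_cont gqX Gg).
    + by move=> u; exact: GX.
    + by apply: Fc; exact: GX.
  - move=> x Xx; split; first exact: Yphi.
    apply/(gq_orbitP gqY).
    have [h Hh ->] := orbF _ _ Xx (GX _ _ Gg Xx) (esym (orbX _ _ Gg)).
    transitivity (orbit actY H (F x)); last by apply/(gq_orbitP gqY); exists h.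
    by apply/esym/(gq_orbitP gqY); exists (actY (phi g)) => //; exists (phi g).
  - by [].
exists phi; split.
- by move=> g /phiP[].
- move=> g h Gg Gh; have [Hg _] := phiP _ Gg; have [Hh hF] := phiP _ Gh.
  have [Hgh ghF] := phiP _ (GM _ _ Gg Gh).
  apply: (gq_free gqY (x := F x0)) => //; [exact: HM | by case: (FP _ X0) |].
  by rewrite -ghF (gq_actM gqY) // -hF phiF ?(gq_actM gqX) //; exact: GX.
- move=> g h Gg Gh gh; have [Hg gF] := phiP _ Gg; have [Hh hF] := phiP _ Gh.
  have : F (actX g x0) = F (actX h x0) by rewrite gF hF gh.
  move=> /(congr1 F'); rewrite -!F'F; try exact: GX.
  rewrite -!(gq_actM gqX) // => /(gq_free gqX) => /(_ (GM _ _ Gg0 Gg) (GM _ _ Gg0 Gh) X0).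
  by move=> /(congr1 (mulmx (invmx g0))); rewrite !mulKmx //; exact: Gu.
Qed.

(** * Norms of matrices and discrete groups *)

Lemma mx_norm_entry (R : realType) m n (A : 'M[R]_(m, n)) i j : `|A i j| <= `|A|.
Proof. by rewrite [leRHS]/Num.Def.normr /= mx_normrE; exact: (le_bigmax _ _ (i, j)). Qed.

Lemma mx_norm_le (R : realType) m n (A : 'M[R]_(m, n)) C :
  0 <= C -> (forall i j, `|A i j| <= C) -> `|A| <= C.
Proof.
by move=> C0 AC; rewrite [leLHS]/Num.Def.normr /= mx_normrE; apply: bigmax_le => // -[i j] _ /=.
Qed.

Lemma mx_norm_mul (R : realType) m n p (A : 'M[R]_(m, n)) (B : 'M[R]_(n, p)) :
  `|A *m B| <= n%:R * `|A| * `|B|.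
Proof.
apply: mx_norm_le => [|i j]; first by rewrite !mulr_ge0.
rewrite mxE; apply: le_trans (ler_norm_sum _ _ _) _.
have -> : n%:R * `|A| * `|B| = \sum_(k < n) `|A| * `|B|.
  by rewrite sumr_const card_ord -[RHS]mulr_natl mulrA.
by apply: ler_sum => k _; rewrite normrM ler_pM // mx_norm_entry.
Qed.

Lemma mx_norm_tr (R : realType) m n (A : 'M[R]_(m, n)) : `|A^T| = `|A|.
Proof.
apply/eqP; rewrite eq_le; apply/andP; split; apply: mx_norm_le => // i j.
  by rewrite mxE mx_norm_entry.
by have := mx_norm_entry A^T j i; rewrite mxE.
Qed.

Lemma mx_norm_sub (R : realType) m n p q (A : 'M[R]_(m, n)) (B : 'M[R]_(p, q)) :
  (forall i j, exists k l, B i j = A k l) -> `|B| <= `|A|.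
Proof.
by move=> AB; apply: mx_norm_le => // i j; have [k [l ->]] := AB i j; exact: mx_norm_entry.
Qed.

(** Pigeonhole principle for the integral parts of the entries divided by d. *)
Lemma separated_bounded_finite (R : realType) m n (S : set 'M[R]_(m, n)) C d :
  0 < d -> (forall x, S x -> `|x| <= C) ->
  (forall x y, S x -> S y -> `|x - y| < d -> x = y) -> finite_set S.
Proof.
move=> d0 SC Sd; pose N := Num.truncn (2 * C / d).
pose k (x : 'M[R]_(m, n)) : {ffun 'I_m * 'I_n -> 'I_N.+1} :=
  [ffun p => inord (Num.truncn ((x p.1 p.2 + C) / d))].
rewrite -(eq_finite_set (inj_card_eq (f := k) _)); first exact: finite_finset.
move=> x y; rewrite !inE => Sx Sy kxy; apply: Sd => //.
have entry z i j : S z -> 0 <= (z i j + C) / d <= 2 * C / d.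
  move=> /SC zC; have := mx_norm_entry z i j => /le_trans /(_ zC).
  rewrite ler_norml => /andP[? ?]; apply/andP; split.
    by apply: divr_ge0; [lra | exact: ltW].
  by rewrite ler_pM2r ?invr_gt0 //; lra.
have trunc z i j : S z -> (Num.truncn ((z i j + C) / d) < N.+1)%N.
  by move=> Sz; have /andP[? ?] := entry z i j Sz; rewrite ltnS le_truncn.
have [m0|m0] := eqVneq (x - y) 0; first by rewrite m0 normr0.
have xyd i j : `|(x - y) i j| < d.
  have := congr1 (fun f : {ffun 'I_m * 'I_n -> 'I_N.+1} => nat_of_ord (f (i, j))) kxy; rewrite !ffunE /= !inordK ?trunc //.
  move=> txy; have /andP[x0 _] := entry x i j Sx; have /andP[y0 _] := entry y i j Sy.
  have /andP[] := truncn_itv x0; have /andP[] := truncn_itv y0; rewrite -txy.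
  rewrite !ler_pdivlMr // !ltr_pdivrMr // !mxE -natr1 => ? ? ? ?.
  rewrite ltr_norml; apply/andP; split; lra.
rewrite [ltLHS]/Num.Def.normr /= mx_normrE; apply/bigmax_ltP; split => // -[i j] _ /=; exact: xyd.
Qed.

(** If g and h are close and g^-1 is bounded then g^-1 h is close to 1, and
    equal to 1 by discreteness. *)
Lemma discrete_bounded_finite (R : realType) m (G : set 'M[R]_m) :
  group_of_matrices G -> discrete G ->
  (forall C, exists C', forall g, G g -> `|g| <= C -> `|invmx g| <= C') ->
  forall C, finite_set [set g | G g /\ `|g| <= C].
Proof.
move=> [G1 Gu GM GV] /(_ _ G1)[_ [V /nbhs_ballP[e /= e0 eV] VG]] Ginv C.
have [C' GC'] := Ginv C.
pose D := m%:R * `|C'| + 1.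
have D0 : 0 < D by rewrite ltr_pwDr // mulr_ge0.
apply: (@separated_bounded_finite _ _ _ _ C (e / D)); first by rewrite divr_gt0.
  by move=> g [].
move=> g h [Gg gC] [Gh hC] gh.
have := mx_norm_mul (invmx g) (g - h).
move=> /le_lt_trans lt_.
have Ve : V (invmx g *m h).
  apply: eV; rewrite mx_norm_ball /ball_ /=.
  have -> : 1%:M - invmx g *m h = invmx g *m (g - h) by rewrite mulmxBr mulVmx //; exact: Gu.
  apply: lt_; apply: (@le_lt_trans _ _ (m%:R * `|C'| * `|g - h|)).
    rewrite ler_wpM2r // ler_wpM2l //; apply: le_trans (GC' _ Gg gC) (ler_norm _).
  apply: (@le_lt_trans _ _ (D * `|g - h|)).
    by rewrite ler_wpM2r // /D lerDl.
  by rewrite mulrC -ltr_pdivlMr.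
have : (V `&` G) (invmx g *m h) by split => //; apply: GM => //; exact: GV.
rewrite VG => /= /(congr1 (mulmx g)).
by rewrite mulKVmx ?mulmx1 //; exact: Gu.
Qed.

(** * Lorentzian quadratic forms *)

Section Bilin.
Variables (R : realType) (m : nat) (Q : 'M[R]_m).

Lemma bilinDl x y z : bilin Q (x + y) z = bilin Q x z + bilin Q y z.
Proof. by rewrite /bilin linearD /= !mulmxDl mxE. Qed.

Lemma bilinDr x y z : bilin Q x (y + z) = bilin Q x y + bilin Q x z.
Proof. by rewrite /bilin !mulmxDr mxE. Qed.

Lemma bilinZl c x y : bilin Q (c *: x) y = c * bilin Q x y.
Proof. by rewrite /bilin linearZ /= -!scalemxAl mxE. Qed.

Lemma bilinZr c x y : bilin Q x (c *: y) = c * bilin Q x y.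
Proof. by rewrite /bilin -scalemxAr mxE. Qed.

Lemma bilinNl x y : bilin Q (- x) y = - bilin Q x y.
Proof. by rewrite -scaleN1r bilinZl mulN1r. Qed.

Lemma bilinNr x y : bilin Q x (- y) = - bilin Q x y.
Proof. by rewrite -scaleN1r bilinZr mulN1r. Qed.

Lemma bilinBl x y z : bilin Q (x - y) z = bilin Q x z - bilin Q y z.
Proof. by rewrite bilinDl bilinNl. Qed.

Lemma bilinBr x y z : bilin Q x (y - z) = bilin Q x y - bilin Q x z.
Proof. by rewrite bilinDr bilinNr. Qed.

Lemma bilin0l x : bilin Q 0 x = 0.
Proof. by rewrite -(scale0r 0) bilinZl mul0r. Qed.

Lemma bilinC x y : Q^T = Q -> bilin Q x y = bilin Q y x.
Proof.
move=> QT; rewrite /bilin.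
have -> : x^T *m Q *m y = (y^T *m Q *m x)^T by rewrite !trmx_mul trmxK QT mulmxA.
by rewrite mxE.
Qed.

Lemma bilinM g x y : g^T *m Q *m g = Q -> bilin Q (g *m x) (g *m y) = bilin Q x y.
Proof. by move=> gQ; rewrite /bilin trmx_mul -[in RHS]gQ !mulmxA. Qed.

Lemma bilin_delta x i : bilin Q x (delta_mx i 0) = (x^T *m Q) 0 i.
Proof. by rewrite /bilin -colE mxE. Qed.

End Bilin.

Definition bilinE := (bilinDl, bilinDr, bilinZl, bilinZr, bilinNl, bilinNr).

Section LorentzFrame.
Variables (R : realType) (m : nat) (Q P : 'M[R]_m) (i0 : 'I_m).

(** The columns of P form an orthonormal basis, of which the i0-th is the
    negative vector. *)
Record lorentz_frame : Prop := LorentzFrame {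
  frame_sym : Q^T = Q;
  frame_unit : P \in unitmx;
  frame_diag : P^T *m Q *m P = diag_mx (\row_i (if i == i0 then -1 else 1)) }.

Definition coord (x : 'cV[R]_m) (i : 'I_m) : R := (invmx P *m x) i 0.
Definition time (x : 'cV[R]_m) : R := coord x i0.

Lemma coordD x y i : coord (x + y) i = coord x i + coord y i.
Proof. by rewrite /coord mulmxDr mxE. Qed.

Lemma coordZ c x i : coord (c *: x) i = c * coord x i.
Proof. by rewrite /coord -scalemxAr mxE. Qed.

Lemma coordN x i : coord (- x) i = - coord x i.
Proof. by rewrite -scaleN1r coordZ mulN1r. Qed.

Hypothesis F : lorentz_frame.
Let Punit := frame_unit F.
Let QT := frame_sym F.

Lemma bilin_coord x y : bilin Q x y =
  \sum_i (if i == i0 then -1 else 1) * (coord x i * coord y i).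
Proof.
pose D := diag_mx (\row_i (if i == i0 then -1 else 1) : 'rV[R]_m).
have -> : bilin Q x y = bilin D (invmx P *m x) (invmx P *m y).
  rewrite /bilin /D -(frame_diag F) !mulmxA -trmx_mul mulKVmx //.
  by rewrite -!mulmxA mulKVmx.
rewrite /bilin mxE; apply: eq_bigr => i _.
by rewrite mul_mx_diag 2!mxE [(\row_i _) _ _]mxE mulrAC mulrC.
Qed.

Lemma bilin_time x y : bilin Q x y =
  \sum_(i | i != i0) coord x i * coord y i - time x * time y.
Proof.
rewrite bilin_coord (bigD1 i0) //= eqxx mulN1r addrC; congr (_ + _).
by apply: eq_bigr => i /negPf ->; rewrite mul1r.
Qed.

Lemma coord_inj x y : (forall i, coord x i = coord y i) -> x = y.
Proof.
move=> xy; rewrite -[x](mulKVmx Punit) -[y](mulKVmx Punit); congr (_ *m _).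
by apply/colP => i; exact: xy.
Qed.

Lemma quad_space x : time x = 0 -> quad Q x = \sum_i (coord x i) ^+ 2.
Proof.
move=> x0; rewrite /quad bilin_time x0 mul0r subr0 [RHS](bigD1 i0) //=.
by rewrite -/(time x) x0 expr0n add0r; apply: eq_bigr => i _; rewrite expr2.
Qed.

Lemma quad_space_ge0 x : time x = 0 -> 0 <= quad Q x.
Proof. by move=> /quad_space ->; apply: sumr_ge0 => i _; exact: sqr_ge0. Qed.

Lemma coord_le_quad x i : time x = 0 -> (coord x i) ^+ 2 <= quad Q x.
Proof.
move=> /quad_space ->; rewrite (bigD1 i) //= lerDl.
by apply: sumr_ge0 => j _; exact: sqr_ge0.
Qed.

Lemma quad_space_eq0 x : time x = 0 -> quad Q x = 0 -> x = 0.
Proof.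
move=> x0 qx; apply: coord_inj => i.
have := coord_le_quad i x0; rewrite qx => xi.
have /eqP : coord x i ^+ 2 = 0 by apply/eqP; rewrite eq_le xi sqr_ge0.
by rewrite sqrf_eq0 => /eqP ->; rewrite /coord mulmx0 mxE.
Qed.

Lemma isotropic_time v : quad Q v = 0 -> v != 0 -> time v != 0.
Proof. by move=> qv; apply: contraNneq => /quad_space_eq0 ->. Qed.

(** Along v the form does not change on the orthogonal complement of v, whose
    vectors can thus be moved to the positive definite hyperplane of time 0. *)
Lemma perp_space v x : quad Q v = 0 -> v != 0 -> bilin Q x v = 0 ->
  let z := x - (time x / time v) *: v in time z = 0 /\ quad Q z = quad Q x.
Proof.
move=> qv v0 xv z; have tv := isotropic_time qv v0; split.
  by rewrite /time coordD coordN coordZ -!/(time _) divfK // subrr.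
rewrite /quad /z !bilinE (bilinC v x QT) xv -/(quad Q v) qv; ring.
Qed.

Lemma perp_isotropic_ge0 v x : quad Q v = 0 -> v != 0 -> bilin Q x v = 0 ->
  0 <= quad Q x.
Proof.
by move=> qv v0 /(perp_space qv v0)[tz <-]; exact: quad_space_ge0.
Qed.

Lemma perp_isotropic_eq0 v x : quad Q v = 0 -> v != 0 -> bilin Q x v = 0 ->
  quad Q x = 0 -> exists c, x = c *: v.
Proof.
move=> qv v0 /(perp_space qv v0)[tz qz] qx; exists (time x / time v).
by apply/eqP; rewrite -subr_eq0 (quad_space_eq0 tz) ?qz.
Qed.

Lemma timelike_time x : quad Q x = -1 -> 1 <= (time x) ^+ 2.
Proof.
rewrite /quad bilin_time => qx.
have : 0 <= \sum_(i | i != i0) coord x i * coord x i.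
  by apply: sumr_ge0 => i _; rewrite -expr2 sqr_ge0.
rewrite expr2; lra.
Qed.

Lemma timelike_time_neq0 x : quad Q x = -1 -> time x != 0.
Proof.
by move=> /timelike_time; apply: contraTneq => ->; rewrite expr0n /= ler10.
Qed.

(** The vector time x y - time y x is spacelike. *)
Lemma reverse_cauchy x y : quad Q x = -1 -> quad Q y = -1 ->
  2 * (time x * time y) * bilin Q x y <= - (time x ^+ 2 + time y ^+ 2).
Proof.
move=> qx qy; have tx := timelike_time_neq0 qx.
pose z := time x *: y - time y *: x.
have tz : time z = 0 by rewrite /time /z coordD coordN !coordZ -!/(time _); ring.
have := quad_space_ge0 tz; rewrite /quad /z !bilinE (bilinC y x QT) -!/(quad Q _) qx qy.
lra.
Qed.

(** The bilinear form is the hyperbolic cosine of the distance, up to sign, so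
    that this bounds the time coordinate of x in terms of y and the distance to
    y. *)
Lemma time_le_bilin x y : quad Q x = -1 -> quad Q y = -1 ->
  `|time x| <= 2 * `|time y| * `|bilin Q x y|.
Proof.
move=> qx qy; have := reverse_cauchy qx qy.
have tx : 0 < `|time x| by rewrite normr_gt0 timelike_time_neq0.
move=> h; rewrite -(ler_pM2l tx) -[leLHS]expr2 real_normK ?num_real //.
have : `|2 * (time x * time y) * bilin Q x y| =
   `|time x| * (2 * `|time y| * `|bilin Q x y|) by rewrite !normrM normr_nat; ring.
move=> <-; rewrite ler_normr; apply/orP; right.
have := sqr_ge0 (time y); lra.
Qed.

Let J := diag_mx (\row_i (if i == i0 then -1 else 1) : 'rV[R]_m).

Let JJ : J *m J = 1%:M.
Proof.
rewrite /J mul_diag_mx; apply/matrixP => i j; rewrite !mxE.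
by have [->|ij] := eqVneq i j; case: ifP => _; rewrite ?mulr1n ?mulr0n; ring.
Qed.

Lemma frame_form_unit : Q \in unitmx.
Proof.
have [Ju _] := mulmx1_unit JJ.
have : P^T *m Q *m P \in unitmx by rewrite (frame_diag F).
by rewrite !unitmx_mul => /andP[/andP[]].
Qed.

Lemma isometry_unit g : g^T *m Q *m g = Q -> g \in unitmx.
Proof.
move=> gQ; have Qu := frame_form_unit.
have : (invmx Q *m g^T *m Q) *m g = 1%:M by rewrite -!mulmxA (mulmxA g^T) gQ mulVmx.
by move=> /mulmx1_unit[].
Qed.

Lemma isometry_inv g : g^T *m Q *m g = Q -> invmx g = invmx Q *m g^T *m Q.
Proof.
move=> gQ; have gu := isometry_unit gQ.
have : (invmx Q *m g^T *m Q) *m g = 1%:M.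
  by rewrite -!mulmxA (mulmxA g^T) gQ mulVmx // frame_form_unit.
by move=> /(congr1 (mulmx^~ (invmx g))); rewrite mulmxK // mul1mx.
Qed.

Lemma isometry_invP g : g^T *m Q *m g = Q -> (invmx g)^T *m Q *m invmx g = Q.
Proof.
move=> gQ; have gu := isometry_unit gQ.
rewrite -{1}gQ !mulmxA -trmx_mul mulmxV // trmx1 mul1mx.
by rewrite mulmxK.
Qed.

Lemma bilin_frame_neg x : bilin Q x (P *m delta_mx i0 0) = - time x.
Proof.
rewrite bilin_time big1 => [|i ii0].
  by rewrite /time {2}/coord mulKmx // mxE !eqxx mulr1 add0r.
by rewrite {2}/coord mulKmx // mxE (negPf ii0) mulr0.
Qed.

Lemma quad_frame_neg : quad Q (P *m delta_mx i0 0) = -1.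
Proof. by rewrite /quad bilin_frame_neg /time /coord mulKmx // mxE !eqxx. Qed.

(** The displacement of one point of the hyperboloid bounds the time-time entry
    of an isometry, and by the orthonormality of rows and columns all others. *)
Lemma isometry_bounded C : exists C', forall g y, g^T *m Q *m g = Q ->
  quad Q y = -1 -> `|time y| <= C -> `|time (g *m y)| <= C -> `|g| <= C'.
Proof.
pose E := 2 * C * C.
exists (m%:R * (m%:R * `|P| * Num.sqrt (1 + E ^+ 2)) * `|invmx P|) => g y gQ qy yC gyC.
have C0 : 0 <= C by exact: le_trans yC.
have gu := isometry_unit gQ.
(* the matrix of g in the orthonormal frame *)
pose g' := invmx P *m g *m P.
have gE : g = P *m g' *m invmx P by rewrite /g' !mulmxA mulmxV // mul1mx mulmxK.
have Pg' : P *m g' = g *m P by rewrite /g' !mulmxA mulmxV // mul1mx.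
have g00E : g' i0 i0 = time (g *m (P *m delta_mx i0 0)).
  by rewrite /time /coord /g' !mulmxA -colE [RHS]mxE.
clearbody g'.
have g'J : g'^T *m J *m g' = J.
  rewrite /J -(frame_diag F) !mulmxA -trmx_mul -!mulmxA Pg' trmx_mul.
  by rewrite -[in RHS]gQ !mulmxA.
have Jg' : g' *m J *m g'^T = J.
  have : (J *m g'^T *m J) *m g' = 1%:M by rewrite -!mulmxA (mulmxA g'^T) g'J JJ.
  move=> /mulmx1C; rewrite !mulmxA => /(congr1 (mulmx^~ J)).
  by rewrite /= -(mulmxA _ J J) JJ mulmx1 mul1mx.
have Jentry A B i j : (A *m J *m B) i j = \sum_k (if k == i0 then -1 else 1) * (A i k * B k j).
  by rewrite mxE; apply: eq_bigr => k _; rewrite mul_mx_diag mxE [(\row_i _) _ _]mxE; rewrite [A i k * _]mulrC mulrA.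
have col j : \sum_(i | i != i0) g' i j ^+ 2 = g' i0 j ^+ 2 + (if j == i0 then -1 else 1).
  have := congr1 (fun A : 'M[R]_m => A j j) g'J; rewrite Jentry !mxE eqxx mulr1n (bigD1 i0) //= eqxx.
  rewrite mxE => <-; rewrite mulN1r addrA expr2 subrr add0r.
  by apply: eq_bigr => i /negPf ->; rewrite mxE mul1r expr2.
have row : \sum_(j | j != i0) g' i0 j ^+ 2 = g' i0 i0 ^+ 2 - 1.
  have := congr1 (fun A : 'M[R]_m => A i0 i0) Jg'; rewrite Jentry !mxE eqxx mulr1n (bigD1 i0) //= eqxx.
  rewrite mxE => <-; rewrite mulN1r addrA expr2 subrr add0r.
  by apply: eq_bigr => i /negPf ->; rewrite mxE mul1r expr2.
have g00 : `|g' i0 i0| <= E.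
  pose e0 : 'cV[R]_m := P *m delta_mx i0 0.
  have -> : g' i0 i0 = time (invmx g *m e0).
    apply: oppr_inj; rewrite -bilin_frame_neg -(bilinM _ _ gQ) mulKVmx //.
    by rewrite bilinC // bilin_frame_neg g00E.
  have qa : quad Q (invmx g *m e0) = -1.
    by rewrite /quad bilinM ?isometry_invP // -/(quad Q _) quad_frame_neg.
  have := time_le_bilin qa qy.
  rewrite -(bilinM _ _ gQ) mulKVmx // bilinC // bilin_frame_neg normrN => /le_trans; apply.
  by rewrite /E ler_pM // ?ler_pM2l // mulr_ge0.
have row0 j : g' i0 j ^+ 2 <= E ^+ 2.
  have E0 : g' i0 i0 ^+ 2 <= E ^+ 2.
    by rewrite -(real_normK (num_real (g' i0 i0))) ler_sqr ?nnegrE // (le_trans _ g00).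
  have [->//|ji0] := eqVneq j i0; apply: le_trans E0.
  move: row; rewrite (bigD1 j) //= => row.
  have : 0 <= \sum_(i | (i != i0) && (i != j)) g' i0 i ^+ 2.
    by apply: sumr_ge0 => i _; exact: sqr_ge0.
  lra.
have entry i j : g' i j ^+ 2 <= 1 + E ^+ 2.
  have [->|ii0] := eqVneq i i0; first by apply: le_trans (row0 j) _; rewrite lerDr.
  move: (col j); rewrite (bigD1 i) //= => colj.
  have : 0 <= \sum_(k | (k != i0) && (k != i)) g' k j ^+ 2.
    by apply: sumr_ge0 => k _; exact: sqr_ge0.
  have := row0 j; case: ifP colj => _; lra.
have g'E : `|g'| <= Num.sqrt (1 + E ^+ 2).
  apply: mx_norm_le => [|i j]; first exact: sqrtr_ge0.
  by rewrite -sqrtr_sqr ler_wsqrtr.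
rewrite gE; apply: le_trans (mx_norm_mul _ _) _.
rewrite ler_wpM2r // ler_wpM2l //; apply: le_trans (mx_norm_mul _ _) _.
by rewrite ler_wpM2l // mulr_ge0.
Qed.

End LorentzFrame.

Lemma signature_frame (R : realType) (d : nat) (Q : 'M[R]_d.+1) :
  has_signature Q d 1 -> exists P i0, lorentz_frame Q P i0.
Proof.
move=> [QT [P [e [Pu PQP pos neg]]]].
have [i0 i0P] : exists i0, [pred i | e 0 i < 0] =i pred1 i0.
  by apply/card1P; rewrite neg.
have e_pos : [pred i | 0 < e 0 i] =i predC1 i0.
  apply/subset_cardP; first by rewrite pos cardC1 card_ord.
  apply/fintype.subsetP => i; rewrite !inE => ei.
  by have := i0P i; rewrite !inE lt_gtF // => <-.
have e0 i : e 0 i != 0.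
  have := e_pos i; have := i0P i; rewrite !inE; have [->|_] := eqVneq i i0 => /=.
    by move=> /lt_eqF ->.
  by move=> _ /gt_eqF ->.
pose D := diag_mx (\row_i (Num.sqrt `|e 0 i|)^-1 : 'rV[R]_d.+1).
exists (P *m D), i0; split => //.
  rewrite unitmx_mul Pu unitmxE det_diag unitfE.
  by apply/prodf_neq0 => i _; rewrite mxE invr_eq0 sqrtr_eq0 -ltNge normr_gt0.
rewrite trmx_mul tr_diag_mx -!mulmxA (mulmxA P^T) (mulmxA _ P) PQP.
rewrite mulmxA !mulmx_diag; congr diag_mx; apply/rowP => i; rewrite !mxE.
have s0 : Num.sqrt `|e 0 i| != 0 by rewrite sqrtr_eq0 -ltNge normr_gt0.
have ss : Num.sqrt `|e 0 i| ^+ 2 = `|e 0 i| by rewrite sqr_sqrtr.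
have -> : (Num.sqrt `|e 0 i|)^-1 * e 0 i * (Num.sqrt `|e 0 i|)^-1 = e 0 i / `|e 0 i|.
  by rewrite -[X in _ = _ / X]ss expr2 invfM mulrA [_^-1 * e 0 i]mulrC.
have := e_pos i; have := i0P i; rewrite !inE; have [_|_] := eqVneq i i0 => /=.
  by move=> ei _; rewrite ltr0_norm // invrN mulrN divff.
by move=> _ ei; rewrite gtr0_norm // divff.
Qed.

(** * Limits, compactness and proper discontinuity *)

Lemma cvg_mx (R : realType) (T : Type) (FF : set_system T) {FFF : Filter FF}
    m n (F : T -> 'M[R]_(m, n)) (L : 'M[R]_(m, n)) :
  (forall i j, F x i j @[x --> FF] --> L i j) -> F @ FF --> L.
Proof.
move=> FL; apply/cvgrPdist_lt => e e0.
have : \forall x \near FF, forall p : 'I_m * 'I_n, `|L p.1 p.2 - F x p.1 p.2| < e.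
  apply: filter_forall => -[i j] /=.
  by have /cvgrPdist_lt := FL i j; apply.
apply: filterS => x Fx; rewrite [ltLHS]/Num.Def.normr /= mx_normrE.
by apply/bigmax_ltP; split => // p _; have := Fx p; rewrite !mxE.
Qed.

Lemma cvg_mx_entry (R : realType) (T : Type) (FF : set_system T) {FFF : Filter FF}
    m n (F : T -> 'M[R]_(m, n)) (L : 'M[R]_(m, n)) i j :
  F @ FF --> L -> F x i j @[x --> FF] --> L i j.
Proof.
move=> FL; apply: (@cvg_comp _ _ _ F (fun A : 'M[R]_(m, n) => A i j) _ (nbhs L)) => //.
exact: coord_continuous.
Qed.

Lemma cvg_big_sum (R : realType) (T : Type) (FF : set_system T) {FFF : Filter FF}
    (I : Type) (r : seq I) (f : I -> T -> R) (l : I -> R) :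
  (forall i, f i @ FF --> l i) ->
  \sum_(i <- r) f i x @[x --> FF] --> \sum_(i <- r) l i.
Proof.
move=> fl; elim: r => [|i r IH].
  rewrite big_nil; under eq_fun do rewrite big_nil; exact: cvg_cst.
rewrite big_cons; under eq_fun do rewrite big_cons.
exact: cvgD.
Qed.

Lemma cvg_mulmx (R : realType) (T : Type) (FF : set_system T) {FFF : Filter FF}
    m n p (F : T -> 'M[R]_(m, n)) (G : T -> 'M[R]_(n, p)) (A : 'M[R]_(m, n)) (B : 'M[R]_(n, p)) :
  F @ FF --> A -> G @ FF --> B -> F x *m G x @[x --> FF] --> A *m B.
Proof.
move=> FA GB; apply: cvg_mx => i j.
rewrite mxE; under eq_fun do rewrite mxE.
by apply: cvg_big_sum => k; apply: cvgM; apply: cvg_mx_entry.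
Qed.

Lemma cvg_trmx (R : realType) (T : Type) (FF : set_system T) {FFF : Filter FF}
    m n (F : T -> 'M[R]_(m, n)) (A : 'M[R]_(m, n)) : F @ FF --> A -> (F x)^T @[x --> FF] --> A^T.
Proof.
move=> FA; apply: cvg_mx => i j.
rewrite mxE; under eq_fun do rewrite mxE; exact: cvg_mx_entry.
Qed.

Lemma cvg_bilin (R : realType) (T : Type) (FF : set_system T) {FFF : Filter FF}
    m (Q : 'M[R]_m) (f g : T -> 'cV[R]_m) (x y : 'cV[R]_m) :
  f @ FF --> x -> g @ FF --> y -> bilin Q (f t) (g t) @[t --> FF] --> bilin Q x y.
Proof.
move=> fx gy; apply: (@cvg_mx_entry _ _ _ _ _ _ (fun t => (f t)^T *m Q *m g t)).
apply: cvg_mulmx => //.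
by apply: cvg_mulmx; [exact: cvg_trmx | exact: cvg_cst].
Qed.

Lemma mulmx_continuous (R : realType) m n (A : 'M[R]_(m, n)) p :
  continuous (mulmx A : 'M[R]_(n, p) -> 'M[R]_(m, p)).
Proof.
by move=> x; apply: (@cvg_mulmx _ _ (nbhs x) _ _ _ _ (fun=> A) id); [exact: cvg_cst | exact: cvg_id].
Qed.

(** Transported from row vectors, where bounded closed sets are compact. *)
Lemma mx_ball_compact (R : realType) m n C : compact [set A : 'M[R]_(m, n) | `|A| <= C].
Proof.
have vecn (v : 'rV[R]_(m * n)) : `|vec_mx v : 'M[R]_(m, n)| = `|v|.
  apply/eqP; rewrite eq_le; apply/andP; split; apply: mx_norm_sub => i j.
    by exists 0, (mxvec_index i j); rewrite mxE.
  by rewrite ord1; case/mxvec_indexP: j => k l; exists k, l; rewrite mxE.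
have -> : [set A : 'M[R]_(m, n) | `|A| <= C] =
    [set vec_mx v | v in [set v : 'rV[R]_(m * n) | `|v| <= C]].
  apply/seteqP; split=> [A AC|_ [v vC <-]]; last by rewrite /= vecn.
  by exists (mxvec A); rewrite ?mxvecK //= -vecn mxvecK.
apply: continuous_compact.
  apply: continuous_subspaceT => v; apply: (@cvg_mx _ _ (nbhs v)) => i j.
  by rewrite mxE; under eq_fun do rewrite mxE; exact: coord_continuous.
apply: bounded_closed_compact.
  by exists C; split; [exact: num_real | move=> M CM v vC; exact: le_trans vC (ltW CM)].
rewrite (_ : [set v | _] = (fun v : 'rV[R]_(m * n) => `|v|) @^-1` [set x | x <= C]) //.
apply: preimage_closed; last exact: closed_le.
by move=> v _; exact: norm_continuous.
Qed.

Lemma mx_sphere_compact (R : realType) m n : compact [set A : 'M[R]_(m, n) | `|A| = 1].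
Proof.
apply: subclosed_compact (@mx_ball_compact R m n 1) _; last by move=> A /= ->.
rewrite (_ : [set A | _] = (fun A : 'M[R]_(m, n) => `|A|) @^-1` [set 1]) //.
apply: preimage_closed; last exact: closed_eq.
by move=> A _; exact: norm_continuous.
Qed.

Lemma contraction_joint (R : realType) (V : pseudoMetricNormedZmodType R) (X : set V) x0
    (c : V -> R -> V) :
  X x0 -> (forall x, X x -> c x 0 = x0) -> (forall x, X x -> c x 1 = x) ->
  (forall x t, X x -> 0 <= t <= 1 -> X (c x t)) ->
  (forall x t, X x -> 0 <= t <= 1 ->
    {for (x, t), continuous (fun p : V * R => c p.1 p.2)}) ->
  contraction X x0 c.
Proof.
move=> X0 c0 c1 cX cc; split => // x t Xx tI A cA.
have /nbhs_ballP[d d0 dA] := cc x t Xx tI A cA.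
exists d => // x' t' _ _ xx' tt'; apply: (dA (x', t')); split => //=.
by rewrite /ball /= distrC.
Qed.

Lemma mx_pow_unit (R : realType) m (g : 'M[R]_m) i : g \in unitmx -> g ^+ i \in unitmx.
Proof.
by move=> gu; elim: i => [|i IH]; rewrite ?expr0 ?unitmx1 // exprS unitmx_mul gu.
Qed.

(** An element fixing x has all its powers in the finite set, so it is trivial
    by torsion-freeness. The finitely many other elements of this set move a
    smaller neighbourhood of x off itself. *)
Lemma disc_of_finite (R : realType) a k (X : set 'cV[R]_a)
    (act : 'M[R]_k -> 'cV[R]_a -> 'cV[R]_a) (G : set 'M[R]_k) :
  group_of_matrices G -> torsion_free G ->
  (forall g h x, G g -> G h -> act (g *m h) x = act g (act h x)) ->
  (forall x, act 1%:M x = x) -> (forall g, G g -> continuous (act g)) ->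
  (forall x, X x -> exists2 U, nbhs x U &
     finite_set [set g | G g /\ exists2 z, X z & U z /\ U (act g z)]) ->
  forall x, X x -> exists2 U, nbhs x U &
    forall g z, G g -> X z -> U z -> U (act g z) -> g = 1%:M.
Proof.
move=> [G1 Gu GM GV] tf actM act1 actc fin x Xx.
have [U Ux /[dup] finU /finite_seqP[s sE]] := fin x Xx.
have Upt := nbhs_singleton Ux.
have Gpow g i : G g -> G (g ^+ i).
  by move=> Gg; elim: i => [|i IH]; rewrite ?expr0 // exprS; exact: GM.
have free g : G g -> act g x = x -> g = 1%:M.
  move=> Gg gx.
  have gix i : act (g ^+ i) x = x.
    elim: i => [|i IH]; first by rewrite expr0 act1.
    by rewrite exprS actM ?IH //; exact: Gpow.
  have [i [j [ij gij]]] : exists i j, (i < j)%N /\ g ^+ i = g ^+ j.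
    apply: contrapT => noij.
    have inj : {in (fun i => g ^+ i) @^-1` [set g | G g /\ exists2 z, X z & U z /\ U (act g z)] &,
        injective (fun i => g ^+ i)}.
      move=> i j _ _ gij; apply: contrapT => /eqP; rewrite neq_ltn => /orP[ij|ij]; apply: noij.
        by exists i, j.
      by exists j, i.
    have := finite_preimage inj finU; apply: (@sub_infinite_set _ setT); last exact: infinite_nat.
    by move=> i _ /=; split; [exact: Gpow | exists x => //; rewrite gix].
  apply: (tf g (j - i)%N) => //; first by rewrite subn_gt0.
  have gu := mx_pow_unit i (Gu _ Gg).
  have : g ^+ i *m g ^+ (j - i) = g ^+ i *m 1%:M by rewrite mulmx1 [RHS]gij -{2}(subnKC (ltnW ij)) exprD.
  by move=> /(congr1 (mulmx (invmx (g ^+ i)))); rewrite !mulKmx.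
have sep g : G g -> g <> 1%:M -> exists2 V, nbhs x V & forall z, V z -> ~ V (act g z).
  move=> Gg g1; have gx : act g x != x by apply/eqP => /(free _ Gg).
  have := @norm_hausdorff R 'cV[R]_a; rewrite open_hausdorff => /(_ _ _ gx).
  move=> [[A B] /= [Ag Bx] [oA oB AB]].
  exists (B `&` act g @^-1` A).
    apply: filterI; first by apply: open_nbhs_nbhs; split => //; rewrite -inE.
    by apply: (actc g Gg); apply: open_nbhs_nbhs; split => //; rewrite -inE.
  move=> z [Bz Az] [Bgz _]; have : (A `&` B) (act g z) by [].
  by rewrite (eqP AB).
have sepall (l : seq 'M[R]_k) : exists2 V, nbhs x V & forall g z, g \in l -> G g -> g <> 1%:M ->
    V z -> ~ V (act g z).
  elim: l => [|h l [V Vx VP]]; first by exists setT => //; exact: filterT.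
  have [[Gh h1]|nh] := pselect (G h /\ h <> 1%:M).
    have [V' V'x V'P] := sep _ Gh h1.
    exists (V `&` V'); first exact: filterI.
    move=> g z; rewrite inE => /orP[/eqP -> _ _ [_ /V'P V'z] [_ /V'z]//|gl Gg g1].
    by move=> [Vz _] [Vgz _]; exact: (VP g z).
  exists V => // g z; rewrite inE => /orP[/eqP -> Gg g1|]; last exact: VP.
  by case: nh.
have [V Vx VP] := sepall s.
exists (U `&` V); first exact: filterI.
move=> g z Gg Xz [Uz Vz] [Ugz Vgz]; apply: contrapT => g1.
have : [set` s] g by rewrite -sE; split => //; exists z.
by move=> /= gs; exact: (VP g z).
Qed.

(** * Sheets of the hyperboloid *)

Section Sheet.
Variables (R : realType) (m : nat) (Q P : 'M[R]_m) (i0 : 'I_m) (H : set 'cV[R]_m).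
Hypotheses (F : lorentz_frame Q P i0) (sheetH : is_sheet Q H).
Let QT := frame_sym F.

Lemma sheet_quad x : H x -> quad Q x = -1.
Proof. by case: sheetH => x1 _ -> /connected_component_sub. Qed.

Lemma sheet_max (B : set 'cV[R]_m) x : H x -> B x -> connected B ->
  (forall y, B y -> quad Q y = -1) -> B `<=` H.
Proof.
case: sheetH => x1 q1 HE Hx Bx cB qB; rewrite HE in Hx *.
rewrite (same_connected_component Hx).
by apply: connected_component_max.
Qed.

Lemma time_continuous : continuous (time P i0).
Proof.
move=> x; apply: (@cvg_mx_entry _ _ (nbhs x) _ _ _ (fun x : 'cV[R]_m => invmx P *m x)).
exact: mulmx_continuous.
Qed.

(** The time coordinate does not vanish on the hyperboloid, hence has constant
    sign on a connected part of it. *)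
Lemma sheet_sign x y : H x -> H y -> 0 < time P i0 x * time P i0 y.
Proof.
move=> Hx Hy; have cH : connected H by case: sheetH => z _ ->; exact: component_connected.
have : connected [set time P i0 z | z in H].
  apply: connected_continuous_connected => //.
  by apply: continuous_subspaceT; exact: time_continuous.
move=> /connected_intervalP itv; rewrite ltNge; apply/negP => xy.
have [z Hz z0] : [set time P i0 z | z in H] 0.
  have [x0|x0] := leP (time P i0 x) 0.
    have [y0|y0] := leP (time P i0 y) 0.
      have : time P i0 x * time P i0 y == 0 by rewrite eq_le xy mulr_le0.
      by rewrite mulf_eq0 => /orP[/eqP ?|/eqP ?]; [exists x | exists y].
    by apply: (itv (time P i0 x) (time P i0 y)); [exists x | exists y | rewrite x0 ltW].
  apply: (itv (time P i0 y) (time P i0 x)); [by exists y | by exists x |].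
  by rewrite (ltW x0) -(pmulr_rle0 _ x0) xy.
by move: (timelike_time_neq0 F (sheet_quad Hz)); rewrite z0 eqxx.
Qed.

Lemma sheet_bilin x y : H x -> H y -> bilin Q x y <= -1.
Proof.
move=> Hx Hy; have := reverse_cauchy F (sheet_quad Hx) (sheet_quad Hy).
have := sheet_sign Hx Hy; set a := time _ _ _; set b := time _ _ _ => ab.
have := sqr_ge0 (a - b) => h1 h2.
rewrite -(ler_pM2l ab); nra.
Qed.

Definition normalize (z : 'cV[R]_m) := (Num.sqrt (- quad Q z))^-1 *: z.
(** The geodesic from x0 to x, up to its parametrization: the radial projection
    of the chord. *)
Definition hyp_segment (x0 x : 'cV[R]_m) (t : R) := normalize ((1 - t) *: x0 + t *: x).

Lemma quad_segment x0 x t : H x0 -> H x -> 0 <= t <= 1 ->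
  quad Q ((1 - t) *: x0 + t *: x) <= -1.
Proof.
move=> H0 Hx /andP[t0 t1]; have b := sheet_bilin H0 Hx.
rewrite /quad !bilinE (bilinC x x0 QT) -!/(quad Q _) !sheet_quad //.
have : 0 <= t * (1 - t) by rewrite mulr_ge0 // subr_ge0.
move: (bilin Q x0 x) b => B b h; nra.
Qed.

Lemma quad_normalize z : quad Q z < 0 -> quad Q (normalize z) = -1.
Proof.
move=> qz; rewrite /quad /normalize !bilinE -/(quad Q z).
have s : Num.sqrt (- quad Q z) ^+ 2 = - quad Q z by rewrite sqr_sqrtr // oppr_ge0 ltW.
have s0 : Num.sqrt (- quad Q z) != 0 by rewrite sqrtr_eq0 -ltNge oppr_gt0.
by rewrite mulrA -invfM -expr2 s invrN mulNr mulVf // lt_eqF.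
Qed.

Lemma hyp_segment_cont x0 x t : H x0 -> H x -> 0 <= t <= 1 ->
  {for (x, t), continuous (fun p : 'cV[R]_m * R => hyp_segment x0 p.1 p.2)}.
Proof.
move=> H0 Hx tI; have q1 := quad_segment H0 Hx tI.
have c1 : (fun p : 'cV[R]_m * R => (1 - p.2) *: x0 + p.2 *: p.1) @ nbhs (x, t) -->
    (1 - t) *: x0 + t *: x.
  apply: cvgD.
    by apply: cvgZ; [apply: cvgB; [exact: cvg_cst | exact: cvg_snd] | exact: cvg_cst].
  by apply: cvgZ; [exact: cvg_snd | exact: cvg_fst].
apply: cvgZ => //; apply: cvgV.
  rewrite sqrtr_eq0 -ltNge oppr_gt0 /=; apply: le_lt_trans q1 _; lra.
have c2 : (fun p : 'cV[R]_m * R => - quad Q ((1 - p.2) *: x0 + p.2 *: p.1)) @ nbhs (x, t) -->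
    - quad Q ((1 - t) *: x0 + t *: x).
  by apply: cvgN; apply: (@cvg_bilin _ _ (nbhs (x, t)) _ _ Q _ _ _ _ c1 c1).
exact: (cvg_comp _ _ c2 (@sqrt_continuous R _)).
Qed.

Lemma hyp_segment_sheet x0 x t : H x0 -> H x -> 0 <= t <= 1 -> H (hyp_segment x0 x t).
Proof.
move=> H0 Hx tI.
have seg0 : hyp_segment x0 x 0 = x0.
  by rewrite /hyp_segment /normalize scale0r subr0 scale1r addr0 sheet_quad // opprK sqrtr1 invr1 scale1r.
apply: (@sheet_max [set hyp_segment x0 x t | t in `[0, 1]%classic] x0) => //.
- by exists 0; rewrite //= in_itv /= lexx ler01.
- apply: connected_continuous_connected; first exact: segment_connected.
  apply/subspace_continuousP => u; rewrite /= in_itv /= => uI.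
  apply: cvg_within_filter.
  have c2 : (fun u : R => (x, u)) @ nbhs u --> (x, u).
    by move=> A [[B C] /= [Bx Cu] BCA]; apply: filterS Cu => v Cv; apply: (BCA (x, v)); split => /=; first exact: (nbhs_singleton Bx).
  exact: (cvg_comp _ _ c2 (hyp_segment_cont H0 Hx uI)).
- move=> _ [u uI <-]; move: uI; rewrite /= in_itv /= => uI; apply: quad_normalize.
  by apply: le_lt_trans (quad_segment H0 Hx uI) _; lra.
- by exists t => //; rewrite /= in_itv.
Qed.

Lemma sheet_contraction (X : set 'cV[R]_m) x0 : X x0 -> X `<=` H ->
  (forall x t, X x -> 0 <= t <= 1 -> X (hyp_segment x0 x t)) ->
  contraction X x0 (hyp_segment x0).
Proof.
move=> X0 XH Xseg; apply: contraction_joint.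
- exact: X0.
- move=> x Xx; rewrite /hyp_segment /normalize scale0r subr0 scale1r addr0.
  by rewrite (sheet_quad (XH _ X0)) opprK sqrtr1 invr1 scale1r.
- move=> x Xx; rewrite /hyp_segment /normalize subrr scale0r scale1r add0r.
  by rewrite (sheet_quad (XH _ Xx)) opprK sqrtr1 invr1 scale1r.
- exact: Xseg.
- move=> x t /XH Hx tI; exact: (hyp_segment_cont (XH _ X0) Hx tI).
Qed.

Variable G : set 'M[R]_m.
Hypotheses (GO : G `<=` Oplus Q H) (Ggroup : group_of_matrices G).
Hypotheses (Gdisc : discrete G) (Gtf : torsion_free G).

Lemma isometry_group_finite C : finite_set [set g | G g /\ `|g| <= C].
Proof.
apply: discrete_bounded_finite => // D.
exists (m%:R * (m%:R * `|invmx Q| * `|D|) * `|Q|) => g Gg gD; have [gQ _] := GO Gg.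
rewrite (isometry_inv F gQ); apply: le_trans (mx_norm_mul _ _) _.
rewrite ler_wpM2r // ler_wpM2l //; apply: le_trans (mx_norm_mul _ _) _.
by rewrite ler_wpM2l ?mulr_ge0 // mx_norm_tr (le_trans gD) // ler_norm.
Qed.

(** Proper discontinuity, with balls around the point of the frame measured by
    the time coordinate. *)
Lemma displacement_finite C : finite_set
  [set g | G g /\ exists2 y, quad Q y = -1 & `|time P i0 y| <= C /\ `|time P i0 (g *m y)| <= C].
Proof.
have [C' CC'] := isometry_bounded F C.
apply: sub_finite_set (isometry_group_finite C') => g [Gg [y qy [yC gyC]]]; split => //.
by have [gQ _] := GO Gg; exact: (CC' g y).
Qed.

(** X may be the whole sheet or a horoball, contracted along geodesics. *)
Lemma sheet_good (X : set 'cV[R]_m) x0 : X x0 -> X `<=` H ->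
  (forall x t, X x -> 0 <= t <= 1 -> X (hyp_segment x0 x t)) ->
  (forall g x z, G g -> X x -> X (g *m x) -> X z -> X (g *m z)) ->
  good_quotient X (fun g x => g *m x) G.
Proof.
move=> X0 XH Xseg stab; split => //.
- by move=> g h x _ _; rewrite mulmxA.
- by move=> x; rewrite mul1mx.
- by move=> g _; exact: mulmx_continuous.
- apply: disc_of_finite => //.
  + by move=> g h x _ _; rewrite mulmxA.
  + by move=> x; rewrite mul1mx.
  + by move=> g _; exact: mulmx_continuous.
  move=> x Xx; exists [set y | `|time P i0 y| < `|time P i0 x| + 1].
    have : (fun y => `|time P i0 y|) @ nbhs x --> `|time P i0 x|.
      by apply: cvg_norm; exact: time_continuous.
    by move=> /cvgr_lt; apply; rewrite ltrDl.
  apply: sub_finite_set (displacement_finite (`|time P i0 x| + 1)).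
  move=> g [Gg [z Xz [zC gzC]]]; split => //; exists z; first by apply: sheet_quad; exact: XH.
  by rewrite !ltW.
- by exists x0, (hyp_segment x0); exact: sheet_contraction.
Qed.

End Sheet.

(** * The half-space over a flat manifold *)

Section Cylinder.
Variables (R : realType) (n : nat) (B : flat_manifold R n).

Lemma flat_act_block (A : 'M[R]_n) (t x : 'cV[R]_n) :
  euclidean_act (block_mx A t 0 1%:M) x = A *m x + t.
Proof. by rewrite /euclidean_act block_mxKul block_mxKur. Qed.

Lemma euclidean_isometry_unit (A : 'M[R]_n) (t : 'cV[R]_n) : A^T *m A = 1%:M ->
  invmx (block_mx A t 0 1%:M) = block_mx A^T (- (A^T *m t)) 0 (1%:M : 'M[R]_1).
Proof.
move=> AA; have : block_mx A^T (- (A^T *m t)) 0 1%:M *m block_mx A t 0 (1%:M : 'M[R]_1) = 1%:M.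
  rewrite mulmx_block AA !mulmx0 !mul0mx !mulmx1 !addr0 add0r.
  by rewrite subrr -scalar_mx_block.
move=> E; have [_ u] := mulmx1_unit E.
by move/(congr1 (mulmx^~ (invmx (block_mx A t 0 1%:M)))): E; rewrite mulmxK // mul1mx.
Qed.

Lemma orthogonal_norm (A : 'M[R]_n) : A^T *m A = 1%:M -> `|A| <= 1.
Proof.
move=> AA; apply: mx_norm_le => // i j.
have := congr1 (fun M : 'M[R]_n => M j j) AA; rewrite !mxE eqxx (bigD1 i) //= mxE.
move=> E; have : A i j ^+ 2 <= 1.
  rewrite -[leRHS]E expr2 lerDl; apply: sumr_ge0 => k _; rewrite mxE -expr2; exact: sqr_ge0.
by rewrite -real_normK ?num_real // expr_le1.
Qed.

Lemma block_norm (A : 'M[R]_n) (t : 'cV[R]_n) C : 1 <= C -> A^T *m A = 1%:M -> `|t| <= C ->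
  `|block_mx A t 0 (1%:M : 'M[R]_1)| <= C.
Proof.
move=> C1 AA tC; apply: mx_norm_le => [|i j]; first by apply: le_trans C1.
rewrite /block_mx mxE; case: (fintype.split i) => k; rewrite mxE; case: (fintype.split j) => l.
- by apply: le_trans (mx_norm_entry _ _ _) _; apply: le_trans (orthogonal_norm AA) _.
- exact: le_trans (mx_norm_entry _ _ _) _.
- by rewrite mxE normr0 (le_trans ler01).
- by rewrite mxE !ord1 eqxx normr1.
Qed.

(** The half-space is contracted by scaling. An isometry that moves some bounded
    point to a bounded one has bounded translation part, the linear part being
    orthogonal. *)
Lemma cylinder_good : good_quotient (@half_space R n) (@cylinder_act R n) (flat_group B).
Proof.
case: B => G GE Ggr Gd Gtf Gc /=; have [G1 Gu GM GV] := Ggr.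
have actM g h x : G g -> G h -> cylinder_act (g *m h) x = cylinder_act g (cylinder_act h x).
  move=> /GE[A [t [AA ->]]] /GE[A' [t' [AA' ->]]].
  rewrite /cylinder_act col_mxKu col_mxKd !flat_act_block mulmx_block.
  rewrite !mulmx0 !mul0mx !mulmx1 !addr0 add0r flat_act_block.
  by rewrite mulmxDr mulmxA addrA.
have act1 x : cylinder_act (1%:M : 'M[R]_(n + 1)) x = x.
  by rewrite /cylinder_act scalar_mx_block flat_act_block mul1mx addr0 vsubmxK.
have actc g : G g -> continuous (@cylinder_act R n g).
  move=> _ x.
  have -> : @cylinder_act R n g = (fun y => block_mx (ulsubmx g) 0 0 1%:M *m y + col_mx (ursubmx g) 0).
    apply/funext => y; rewrite -{2}(vsubmxK y) mul_block_col !mul0mx addr0 add0r mul1mx.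
    by rewrite add_col_mx addr0.
  apply: (@cvgD _ _ _ (nbhs x) _ (mulmx (block_mx (ulsubmx g) 0 0 1%:M)) (fun=> col_mx (ursubmx g) 0)).
    exact: mulmx_continuous.
  exact: cvg_cst.
have half_act g x : @half_space R n x -> half_space (cylinder_act g x).
  by rewrite /half_space /= /cylinder_act col_mxKd.
have half_disc : forall x, @half_space R n x -> exists2 U, nbhs x U &
    forall g z, G g -> half_space z -> U z -> U (cylinder_act g z) -> g = 1%:M.
  apply: (disc_of_finite Ggr Gtf actM act1 actc) => x Xx.
  exists (ball x 1); first exact: nbhsx_ballx.
  pose C := `|x| + 1.
  have bC y : ball x 1 y -> `|y| <= C.
    rewrite mx_norm_ball /ball_ /= => xy; rewrite -(subrK x y) addrC (le_trans (ler_normD _ _)) //.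
    by rewrite /C lerD2l distrC ltW.
  apply: sub_finite_set (discrete_bounded_finite Ggr Gd _ (1 + C + n%:R * C)).
    move=> g [Gg [z Xz [/bC zC /bC gzC]]]; split => //.
    have [A [t [AA gE]]] := GE _ Gg.
    have C0 : 0 <= C by rewrite addr_ge0.
    rewrite gE; apply: block_norm => //.
      by rewrite -addrA lerDl addr_ge0 // mulr_ge0.
    have uC (y : 'cV[R]_(n + 1)) : `|y| <= C -> `|usubmx y| <= C.
      move=> yC; apply: le_trans yC; apply: mx_norm_sub => i j.
      by exists (lshift 1 i), j; rewrite mxE.
    have -> : t = usubmx (cylinder_act g z) - A *m usubmx z.
      by rewrite /cylinder_act col_mxKu gE flat_act_block addrC addKr.
    rewrite (le_trans (ler_normB _ _)) //; apply: lerD.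
      by rewrite (le_trans (uC _ gzC)) // lerDr.
    apply: le_trans (mx_norm_mul _ _) _.
    rewrite -mulrA ler_wpM2l // -[leRHS]mul1r ler_pM //; first exact: orthogonal_norm.
    exact: uC.
  move=> D; exists (1 + `|D| + n%:R * `|D|) => g Gg gD.
  have [A [t [AA gE]]] := GE _ Gg.
  have tD : `|t| <= `|D|.
    apply: le_trans (ler_norm D); apply: le_trans gD; rewrite gE.
    by apply: mx_norm_sub => i j; exists (lshift 1 i), (rshift n j); rewrite block_mxEur.
  rewrite gE euclidean_isometry_unit //; apply: block_norm.
  + by rewrite -addrA lerDl addr_ge0 // mulr_ge0.
  + by rewrite trmxK; exact: mulmx1C.
  rewrite normrN (le_trans (mx_norm_mul _ _)) // (@le_trans _ _ (n%:R * `|D|)) ?lerDr ?addr_ge0 //.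
  rewrite -mulrA ler_wpM2l // -[leRHS]mul1r ler_pM // mx_norm_tr; exact: orthogonal_norm.
split; [exact: Ggr|exact: actM|exact: act1|exact: actc| |exact: half_disc|].
  by move=> g x z _ _ _; exact: half_act.
exists 0, (fun x t => t *: x); apply: contraction_joint.
- by rewrite /half_space /= linear0 mxE.
- by move=> x _; rewrite scale0r.
- by move=> x _; rewrite scale1r.
- move=> x t; rewrite /half_space /= => x0 /andP[t0 _].
  by rewrite linearZ /= mxE mulr_ge0.
- by move=> x t _ _; apply: cvgZ; [exact: cvg_snd | exact: cvg_fst].
Qed.

End Cylinder.

(** * Homomorphisms induced by cusps and isometries *)

Lemma sheet_nonempty (R : realType) m (Q : 'M[R]_m) H : is_sheet Q H -> exists x, H x.
Proof. by move=> [x qx ->]; exists x; apply: connected_component_refl. Qed.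

Lemma manifold_good (R : realType) d (M : hyperbolic_manifold R d) :
  good_quotient (hyp_sheet M) (fun g x => g *m x) (hyp_group M).
Proof.
case: M => Q H G sQ sH GO Gg Gd Gt /=.
have [P [i0 F]] := signature_frame sQ; have [x0 H0] := sheet_nonempty sH.
apply: (sheet_good F sH GO Gg Gd Gt H0).
- by [].
- by move=> x t Hx tI; exact: (hyp_segment_sheet F sH H0 Hx tI).
- by move=> g x z /GO[_ gH] _ _ Hz; rewrite -gH; exists z.
Qed.

Lemma isometric_hom (R : realType) d (M N : hyperbolic_manifold R d) :
  isometric M N -> exists phi, injective_hom (hyp_group M) (hyp_group N) phi.
Proof.
move=> [f df _]; apply: (diffeomorphic_hom (manifold_good M) (manifold_good N)); last by exists f.
case: M {f df} => Q H G sQ sH GO Gg Gd Gt /= g x /GO[_ gH] Hx.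
by rewrite -gH; exists x.
Qed.

(** A horoball is convex: the condition defining it holds along chords, and
    projecting a chord radially onto the hyperboloid decreases the bilinear form
    with v, as chords lie where the form is at most -1. *)
Lemma cusp_hom (R : realType) n (B : flat_manifold R n) (M : hyperbolic_manifold R n.+1) :
  cusp_cross_section B M -> exists phi, injective_hom (flat_group B) (hyp_group M) phi.
Proof.
move=> [v [v0 qv dich /diffeomorphic_sym diff]].
have [x0 X0] : exists x0, horoball M v x0.
  have [f [sf _]] := diff.
  have H0 : @half_space R n 0 by rewrite /half_space /= linear0 mxE.
  have [U [F [U0 [_ _ FP]]]] := sf _ H0.
  by exists (F 0); case: (FP _ U0 H0).
apply: (diffeomorphic_hom (cylinder_good B) _ _ diff); last first.
  by move=> g x _; rewrite /half_space /= /cylinder_act col_mxKd.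
move: X0 dich {v0 qv diff}; rewrite /horoball; case: M => Q H G sQ sH GO Gg Gd Gt /= X0 dich.
have [P [i0 F]] := signature_frame sQ.
apply: (sheet_good F sH GO Gg Gd Gt X0).
- by move=> x [].
- move=> x t [Hx xv] tI; have [H0 x0v] := X0.
  split; first exact: (hyp_segment_sheet F sH H0 Hx tI).
  have q1 := quad_segment F sH H0 Hx tI.
  rewrite /hyp_segment /normalize bilinZl normrM.
  have s1 : 1 <= Num.sqrt (- quad Q ((1 - t) *: x0 + t *: x)).
    by rewrite -[leLHS]sqrtr1 ler_wsqrtr // lerNr.
  have s0 := lt_le_trans ltr01 s1.
  rewrite normrV ?unitfE ?gt_eqF // (gtr0_norm s0) mulrC ler_pdivrMr // mul1r.
  apply: le_trans s1; rewrite !bilinE (le_trans (ler_normD _ _)) // !normrM.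
  move: tI => /andP[t0 t1].
  rewrite (ger0_norm t0) (ger0_norm (_ : 0 <= 1 - t)) ?subr_ge0 //.
  rewrite [leRHS](_ : 1 = (1 - t) * 1 + t * 1); last by ring.
  by apply: lerD; apply: ler_wpM2l; rewrite // subr_ge0.
- move=> g x z Gg' Xx Xgx Xz.
  have [<-|E] := dich g Gg'; first by exists z.
  have : ([set g *m x | x in [set x | H x /\ `|bilin Q x v| <= 1]] `&`
     [set x | H x /\ `|bilin Q x v| <= 1]) (g *m x) by split => //; exists x.
  by rewrite E.
Qed.

(** * Additive maps on the integral lattice *)

Lemma additive_matrix (R : realType) n k (f : 'cV[int]_n -> 'cV[R]_k) :
  (forall u v, f (u + v) = f u + f v) ->
  exists M : 'M[R]_(k, n), forall u, f u = M *m map_mx intr u.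
Proof.
move=> fD.
have f0 : f 0 = 0 by apply: (addrI (f 0)); rewrite -fD !addr0.
have fN u : f (- u) = - f u by apply: (addrI (f u)); rewrite -fD !subrr.
have fMn u m : f (u *+ m) = f u *+ m.
  by elim: m => [|m IH]; rewrite ?mulr0n // !mulrS fD IH.
have fZ u z : f (z *: u) = z%:~R *: f u.
  rewrite -{1}(intz z) !scaler_int.
  by case: z => m; rewrite ?NegzE ?mulrNz ?fN -!pmulrn fMn.
have fsum (I : finType) (g : I -> 'cV[int]_n) : f (\sum_i g i) = \sum_i f (g i).
  by elim/big_rec2: _ => // i x y _ <-; rewrite fD.
exists (\matrix_(i, j) f (delta_mx j 0) i 0) => u.
have {1}-> : u = \sum_j (u j 0 *: delta_mx j 0).
  apply/colP => i; rewrite summxE (bigD1 i) //= big1 => [|j ji].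
    by rewrite !mxE !eqxx mulr1 addr0.
  by rewrite !mxE eq_sym (negPf ji) mulr0.
rewrite fsum; apply/colP => i; rewrite summxE mxE; apply: eq_bigr => j _.
by rewrite fZ !mxE mulrC.
Qed.

(** Dirichlet's argument: the linear extension of f has a nonzero kernel, and
    the integral parts of the multiples of a kernel vector have bounded images. *)
Lemma additive_bounded_infinite (R : realType) n k (f : 'cV[int]_n -> 'cV[R]_k) :
  (k < n)%N -> (forall u v, f (u + v) = f u + f v) ->
  exists C, infinite_set [set u | `|f u| <= C].
Proof.
move=> kn /additive_matrix[M fM].
have [c c0 Mc] : exists2 c : 'cV[R]_n, c != 0 & M *m c = 0.
  have : kermx M^T != 0.
    by rewrite -mxrank_eq0 mxrank_ker -lt0n subn_gt0 (leq_ltn_trans _ kn) // rank_leq_col.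
  move=> /rowV0Pn[v /sub_kermxP vM v0]; exists v^T; first by rewrite trmx_eq0.
  by apply: trmx_inj; rewrite trmx_mul trmxK vM trmx0.
have [i ci] : exists i, c i 0 != 0.
  apply: contrapT => ni; case/eqP: c0; apply/colP => i; rewrite mxE.
  by apply: contrapT => /eqP ci; apply: ni; exists i.
have [K Kc] : exists K : nat, 2 <= K%:R * `|c i 0|.
  have ci0 : 0 < `|c i 0| by rewrite normr_gt0.
  exists (Num.truncn (2 / `|c i 0|)).+1; rewrite -ler_pdivrMr //.
  by have /andP[_ /ltW] := @truncn_itv R (2 / `|c i 0|) (divr_ge0 (ler0n _ 2) (ltW ci0)).
pose u (j : nat) : 'cV[int]_n := \col_l Num.floor (j%:R * K%:R * c l 0).
exists (n%:R * `|M|).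
have inj : injective u.
  move=> a b /(congr1 (fun w : 'cV[int]_n => w i 0)); rewrite !mxE => fab.
  have h (x : R) : (Num.floor x)%:~R <= x < (Num.floor x)%:~R + 1.
    by have := floor_itv x; rewrite intrD.
  apply: contrapT => ab.
  have : `|a%:R - b%:R| * (K%:R * `|c i 0|) < 1.
    rewrite -[K%:R]ger0_norm // -!normrM !mulrBl mulrA mulrA ltr_norml.
    have := h (a%:R * K%:R * c i 0); have := h (b%:R * K%:R * c i 0); rewrite fab => /andP[? ?] /andP[? ?].
    by apply/andP; split; lra.
  have : 1 <= `|a%:R - b%:R : R|.
    have -> : a%:R - b%:R = (a%:Z - b%:Z)%:~R :> R by rewrite intrB.
    rewrite -intr_norm -[1]/(1%:~R) ler_int; lia.
  move=> h1; have := ler_pM ler01 _ h1 Kc; rewrite mul1r ler0n => /(_ isT); lra.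
apply: (@sub_infinite_set _ (range u)); last first.
  by move=> /(@finite_preimage _ _ _ u) ; rewrite preimage_range => /(_ (in2W inj)); exact: infinite_nat.
move=> _ [j _ <-] /=; rewrite fM.
pose e : 'cV[R]_n := \col_l (j%:R * K%:R * c l 0 - (Num.floor (j%:R * K%:R * c l 0))%:~R).
have -> : map_mx intr (u j) = (j%:R * K%:R) *: c - e by apply/colP => l; rewrite !mxE; ring.
rewrite mulmxBr -scalemxAr Mc scaler0 sub0r normrN.
apply: le_trans (mx_norm_mul _ _) _; rewrite -[leRHS]mulr1 ler_wpM2l // ?mulr_ge0 //.
apply: mx_norm_le => // a b; rewrite !mxE ltW // ger0_norm ?subr_ge0 ?floor_le //.
by rewrite ltrBlDl; have /andP[_] := floor_itv (j%:R * K%:R * c a 0); rewrite intrD.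
Qed.

(** * Isotropic lines of discrete abelian groups *)

Section AbelianIsometries.
Variables (R : realType) (m n : nat) (Q P : 'M[R]_m) (i0 : 'I_m).
Hypothesis F : lorentz_frame Q P i0.
Variable psi : 'cV[int]_n -> 'M[R]_m.
Hypotheses (psiD : forall u v, psi (u + v) = psi u *m psi v)
  (psiQ : forall u, (psi u)^T *m Q *m psi u = Q)
  (psi_proper : forall C, finite_set [set u | `|psi u| <= C]).

Let QT := frame_sym F.

Lemma psi0 : psi 0 = 1%:M.
Proof.
have u := isometry_unit F (psiQ 0).
by rewrite -[LHS](mulKmx u) -psiD addr0 mulVmx.
Qed.

Lemma psiC u v : psi u *m psi v = psi v *m psi u.
Proof. by rewrite -!psiD addrC. Qed.

Lemma psiNK u : psi u *m psi (- u) = 1%:M.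
Proof. by rewrite -psiD subrr psi0. Qed.

Lemma psi_displacement y C : quad Q y = -1 ->
  finite_set [set u | `|time P i0 (psi u *m y)| <= C].
Proof.
move=> qy; have [C' CC'] := isometry_bounded F (Num.max C `|time P i0 y|).
apply: sub_finite_set (psi_proper C') => u /= uC.
by apply: (CC' _ y) => //; rewrite le_max ?uC ?lexx ?orbT.
Qed.

Hypothesis n_gt0 : (0 < n)%N.

Let Zn_infinite : infinite_set [set: 'cV[int]_n].
Proof.
have inj : injective (fun k : nat => const_mx (k : int) : 'cV[int]_n).
  by move=> a b /(congr1 (fun A : 'cV[int]_n => A (Ordinal n_gt0) 0)); rewrite !mxE => -[].
move=> /(@finite_preimage _ _ _ (fun k : nat => const_mx (k : int) : 'cV[int]_n)).
by rewrite preimage_setT => /(_ (in2W inj)); exact: infinite_nat.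
Qed.

(** A cluster point T of the normalized matrices psi u / |psi u| commutes with
    all psi u, and T^T Q T = 0 as the limit of Q / |psi u|^2. So the image of T
    is an invariant totally isotropic subspace, that is, a line. *)
Lemma common_isotropic : exists v, [/\ v != 0, quad Q v = 0 &
  forall u, exists c, psi u *m v = c *: v].
Proof.
pose S (k : nat) : set 'M[R]_m := [set `|psi u|^-1 *: psi u | u in [set u | k%:R < `|psi u|]].
have S0 k : S k !=set0.
  apply: contrapT => nS; apply: Zn_infinite.
  apply: sub_finite_set (psi_proper k%:R) => u _ /=; rewrite leNgt; apply/negP => ku.
  by apply: nS; exists (`|psi u|^-1 *: psi u); exists u.
have Smono k l : (k <= l)%N -> S l `<=` S k.
  move=> kl _ [u /= lu <-]; exists u => //=; apply: le_lt_trans lu; by rewrite ler_nat.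
have SF : ProperFilter (filter_from setT S).
  apply: filter_from_proper => //; apply: filter_from_filter; first by exists 0%N.
  by move=> k l _ _; exists (maxn k l) => // A SA; split; apply: Smono SA;
    rewrite ?leq_maxl ?leq_maxr.
have [T [T1 Tc]] : [set A : 'M[R]_m | `|A| = 1] `&` cluster (filter_from setT S) !=set0.
  apply: mx_sphere_compact; exists 0%N => // _ [u /= u0 <-].
  by rewrite normrZ normfV normr_id mulVf // gt_eqF.
have lim0 (f : 'M[R]_m -> 'M[R]_m) : {for T, continuous f} ->
    (forall d, 0 < d -> exists k, forall A, S k A -> `|f A| <= d) -> f T = 0.
  move=> cf fS; apply/eqP; rewrite -normr_le0; apply/ler_addgt0Pr => e e0.
  rewrite add0r; have e2 : 0 < e / 2 by rewrite divr_gt0.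
  have [k kS] := fS _ e2.
  have near_T : nbhs T (f @^-1` ball (f T) (e / 2)) by apply: cf; exact: nbhsx_ballx.
  have [|A [SA TA]] := Tc (S k) _ _ near_T; first by exists k.
  have := kS _ SA; move: TA; rewrite /= mx_norm_ball /ball_ /= => TA fA.
  rewrite -(subrK (f A) (f T)) (le_trans (ler_normD _ _)) //.
  have -> : e = e / 2 + e / 2 by field.
  by apply: lerD => //; exact: ltW.
have Tpsi u : psi u *m T = T *m psi u.
  apply/eqP; rewrite -subr_eq0; apply/eqP.
  apply: (lim0 (fun A => psi u *m A - A *m psi u)).
    apply: (@cvgB _ _ _ (nbhs T) _ (mulmx (psi u)) (mulmx^~ (psi u))).
      exact: mulmx_continuous.
    by apply: (@cvg_mulmx _ _ (nbhs T) _ _ _ _ id (fun=> psi u)); [exact: cvg_id | exact: cvg_cst].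
  move=> d d0; exists 0%N => _ [w _ <-].
  by rewrite -scalemxAr -scalemxAl psiC subrr normr0 ltW.
have TQT : T^T *m Q *m T = 0.
  apply: (lim0 (fun A => A^T *m Q *m A)).
    apply: (@cvg_mulmx _ _ (nbhs T) _ _ _ _ (fun A : 'M[R]_m => A^T *m Q) id); last exact: cvg_id.
    apply: (@cvg_mulmx _ _ (nbhs T) _ _ _ _ trmx (fun=> Q)); last exact: cvg_cst.
    by apply: cvg_trmx; exact: cvg_id.
  move=> d d0; exists (Num.truncn (`|Q| / d)).+1 => _ [u /= ku <-].
  have /andP[_ Qk] := @truncn_itv R (`|Q| / d) (divr_ge0 (normr_ge0 _) (ltW d0)).
  have Qd := lt_trans Qk ku.
  have u1 : 1 < `|psi u| by apply: le_lt_trans ku; rewrite ler1n.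
  have u0 := lt_trans ltr01 u1.
  rewrite [(_ *: _)^T]linearZ /= -scalemxAr -!scalemxAl scalerA psiQ normrZ normrM normfV normr_id.
  rewrite -invfM mulrC ler_pdivrMr ?mulr_gt0 //.
  move: Qd; rewrite ltr_pdivrMr // => Qd; apply: le_trans (ltW Qd) _.
  rewrite [leLHS]mulrC; apply: ler_wpM2l; first exact: ltW.
  by rewrite -[leLHS]mul1r; apply: ler_wpM2r => //; exact: ltW.
have [j Tj] : exists j, T *m delta_mx j (0 : 'I_1) != 0.
  apply: contrapT => nT; have : `|T| = 0; last by move: T1 => /= ->; move/eqP; rewrite oner_eq0.
  apply/eqP; rewrite normr_eq0; apply/eqP/matrixP => i j; rewrite mxE.
  have : T *m delta_mx j (0 : 'I_1) = 0 by apply: contrapT => /eqP ?; apply: nT; exists j.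
  by rewrite -colE => /colP/(_ i); rewrite !mxE.
have iso x y : bilin Q (T *m x) (T *m y) = 0.
  rewrite /bilin trmx_mul !mulmxA -(mulmxA _ T^T) -(mulmxA _ _ T).
  by rewrite TQT mulmx0 mul0mx mxE.
exists (T *m delta_mx j 0); split => //; first exact: iso.
move=> u; rewrite mulmxA Tpsi -mulmxA.
by apply: (perp_isotropic_eq0 F (iso _ _) Tj); exact: iso.
Qed.

(** If some psi u scales the isotropic line by other than 1 or -1, it has a
    second isotropic eigenline, which all psi b preserve by commutation. The
    scaling factors then determine the psi b up to a compact group, so that the
    rank of the lattice is at most one. *)
Lemma isotropic_eigenvalue v : (1 < n)%N -> v != 0 -> quad Q v = 0 ->
  (forall u, exists c, psi u *m v = c *: v) ->
  forall u, psi (u + u) *m v = v.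
Proof.
move=> n1 v0 qv eig.
have tv := isotropic_time F qv v0.
pose chi u := time P i0 (psi u *m v) / time P i0 v.
have chiP u : psi u *m v = chi u *: v.
  by have [c E] := eig u; rewrite /chi E /time coordZ -/(time P i0 v) mulfK.
have chiD u w : chi (u + w) = chi u * chi w.
  rewrite [LHS]/chi psiD -mulmxA (chiP w) -scalemxAr chiP scalerA /time coordZ -/(time P i0 v).
  by rewrite mulfK // mulrC.
have chi0 u : chi u != 0.
  apply/eqP => c0; have := psiC u (- u); rewrite psiNK => /(congr1 (mulmx^~ v)).
  by rewrite mul1mx -mulmxA chiP c0 scale0r mulmx0 => /eqP; rewrite (negPf v0).
suff chi1 u : chi u ^+ 2 = 1 by move=> u; rewrite chiP chiD -expr2 chi1 scale1r.
apply: contrapT => chia.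
have chiN w : chi w * chi (- w) = 1.
  by apply: (mulIf tv); rewrite -chiD subrr /chi psi0 mul1mx divff // mul1r.
have [w w0 aw] : exists2 w : 'cV[R]_m, w != 0 & psi u *m w = chi (- u) *: w.
  have Qu := frame_form_unit F.
  have vQ : v^T *m Q != 0.
    apply: contraNneq v0 => /(congr1 (mulmx^~ (invmx Q))) /=.
    by rewrite mulmxK // mul0mx => /eqP; rewrite trmx_eq0.
  have : \det (psi u - (chi (- u))%:M)^T == 0.
    rewrite det_tr; apply/det0P; exists (v^T *m Q) => //.
    have vQu : v^T *m Q *m psi u = chi (- u) *: (v^T *m Q).
      rewrite -[in LHS](psiQ (- u)) -!mulmxA (psiC (- u) u) psiNK mulmx1.
      by rewrite mulmxA -trmx_mul chiP [(_ *: _)^T]linearZ /= scalemxAl.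
    by rewrite mulmxBr mul_mx_scalar vQu subrr.
  move=> /det0P[z z0 zu]; exists z^T; first by rewrite trmx_eq0.
  apply: trmx_inj; rewrite trmx_mul trmxK linearZ /= trmxK.
  move: zu; rewrite linearB /= tr_scalar_mx mulmxBr mul_mx_scalar => /eqP.
  by rewrite subr_eq0 => /eqP.
have chi2 : chi (- u) ^+ 2 != 1.
  apply/eqP => E; apply: chia; have := congr1 (fun x => x ^+ 2) (chiN u).
  by rewrite exprMn E mulr1 expr1n.
have fix0 x : x = chi (- u) ^+ 2 * x -> x = 0.
  move=> E; apply/eqP; have /eqP : (chi (- u) ^+ 2 - 1) * x = 0 by rewrite mulrBl mul1r -E subrr.
  by rewrite mulf_eq0 subr_eq0 (negPf chi2).
have qw : quad Q w = 0.
  by apply: fix0; rewrite /quad -{1}(bilinM _ _ (psiQ u)) aw !bilinE expr2 mulrA.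
have b0 : bilin Q v w != 0.
  apply/eqP => vw; have [c wc] : exists c, w = c *: v.
    by apply: (perp_isotropic_eq0 F qv v0) => //; rewrite bilinC.
  move/eqP: chi2; apply; have : chi u *: w = chi (- u) *: w.
    by rewrite -aw {1 2}wc -!scalemxAr chiP scalerA mulrC -scalerA.
  move=> /eqP; rewrite -subr_eq0 -scalerBl scaler_eq0 (negPf w0) orbF subr_eq0 => /eqP E.
  by rewrite expr2 -{1}E chiN.
have eigw b : psi b *m w = chi (- b) *: w.
  have [c E] : exists c, psi b *m w = c *: w.
    apply: (perp_isotropic_eq0 F qw w0); last by rewrite /quad bilinM.
    apply: fix0; rewrite -{1}(bilinM _ _ (psiQ u)) mulmxA psiC -mulmxA aw -scalemxAr.
    by rewrite !bilinE expr2 mulrA.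
  rewrite E; congr (_ *: _); have := bilinM v w (psiQ b); rewrite chiP E !bilinE mulrA => bE.
  have : c * chi b = 1 by apply: (mulIf b0); rewrite [c * _]mulrC bE mul1r.
  by move=> cb; rewrite -[LHS]mulr1 -(chiN b) mulrA cb mul1r.
pose y := v - (2 * bilin Q v w)^-1 *: w.
have qy : quad Q y = -1.
  rewrite /quad /y !bilinE -!/(quad Q _) qv qw (bilinC w v QT).
  by field.
pose f b : 'cV[R]_1 := const_mx (ln `|chi b|).
have [|C fC] := additive_bounded_infinite (f := f) n1.
  move=> b c; apply/colP => i; rewrite !mxE chiD normrM lnM // posrE normr_gt0 //; exact: chi0.
apply: fC; pose D := expR C * (`|time P i0 v| + `|(2 * bilin Q v w)^-1 * time P i0 w|).
apply: sub_finite_set (psi_displacement D qy) => b /= bC.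
have lnC : `|ln `|chi b| | <= C.
  by apply: le_trans bC; have := mx_norm_entry (f b) 0 0; rewrite mxE.
have chipos c : 0 < `|chi c| by rewrite normr_gt0.
have chib : `|chi b| <= expR C.
  by rewrite -[leLHS]lnK ?posrE // ler_expR (le_trans (ler_norm _)).
have chiNb : `|chi (- b)| <= expR C.
  have -> : `|chi (- b)| = `|chi b|^-1.
    apply: (mulfI (lt0r_neq0 (chipos b))); rewrite -normrM chiN normr1 divff //.
    exact: lt0r_neq0.
  rewrite -[leLHS]lnK ?posrE ?invr_gt0 // ler_expR lnV ?posrE //.
  by rewrite (le_trans (ler_norm _)) // normrN.
rewrite /y mulmxBr chiP -scalemxAr eigw /time coordD coordN !coordZ -!/(time P i0 _).
rewrite (le_trans (ler_normB _ _)) // /D mulrDr.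
apply: lerD; first by rewrite normrM ler_wpM2r.
by rewrite mulrCA normrM ler_wpM2r.
Qed.

End AbelianIsometries.

(** * Displacements by a group fixing an isotropic vector *)

Section Parabolic.
Variables (R : realType) (n : nat).
Let m := n.+2.
Variables (Q P : 'M[R]_m) (i0 : 'I_m).
Hypothesis F : lorentz_frame Q P i0.
Variable psi : 'cV[int]_n -> 'M[R]_m.
Hypotheses (psiD : forall u v, psi (u + v) = psi u *m psi v)
  (psiQ : forall u, (psi u)^T *m Q *m psi u = Q)
  (psi_proper : forall C, finite_set [set u | `|psi u| <= C]).
Variable v : 'cV[R]_m.
Hypotheses (v0 : v != 0) (qv : quad Q v = 0) (fixv : forall u, psi u *m v = v).

Let QT := frame_sym F.
Let tv : time P i0 v != 0 := isotropic_time F qv v0.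

Lemma bilin_fix u x : bilin Q (psi u *m x) v = bilin Q x v.
Proof. by rewrite -{1}(fixv u) bilinM. Qed.

Lemma bilin_disp u x : bilin Q (psi u *m x - x) v = 0.
Proof. by rewrite bilinBl bilin_fix subrr. Qed.

Lemma timelike_shift y : bilin Q y v != 0 -> exists s, quad Q (y + s *: v) = -1.
Proof.
move=> yv; exists ((-1 - quad Q y) / (2 * bilin Q y v)).
by rewrite /quad !bilinE (bilinC v y QT) -!/(quad Q _) qv; field.
Qed.

(** Otherwise psi u moves y along v, hence fixes y since it is an isometry. It
    then fixes y + s v, which is on the hyperboloid for some s, and all its
    powers are bounded. *)
Lemma parabolic_disp u y : u != 0 -> bilin Q y v != 0 ->
  0 < quad Q (psi u *m y - y).
Proof.
move=> u0 yv; have wv := bilin_disp u y.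
rewrite lt_neqAle (perp_isotropic_ge0 F qv v0 wv) andbT eq_sym; apply/eqP => qw.
have [c wc] := perp_isotropic_eq0 F qv v0 wv qw.
have psiy : psi u *m y = y + c *: v by rewrite -wc addrC subrK.
have c0 : c = 0.
  have := bilinM y y (psiQ u); rewrite psiy !bilinE (bilinC v y QT) -/(quad Q v) qv => E.
  apply: (mulIf yv); lra.
have fixk k : psi (u *+ k) *m y = y.
  elim: k => [|k IH]; first by rewrite mulr0n (psi0 F psiD psiQ) mul1mx.
  by rewrite mulrS psiD -mulmxA IH psiy c0 scale0r addr0.
have [s qs] := timelike_shift yv.
have [i ui] : exists i, u i 0 != 0.
  apply: contrapT => ni; case/eqP: u0; apply/colP => i; rewrite mxE.
  by apply: contrapT => /eqP ?; apply: ni; exists i.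
have inj : injective (fun k : nat => u *+ k).
  move=> a b /(congr1 (fun w : 'cV[int]_n => w i 0)); rewrite !mulmxnE.
  rewrite -[_ *+ a]mulr_natr -[_ *+ b]mulr_natr => /(mulfI ui) /eqP.
  by rewrite eqr_nat => /eqP.
have := finite_preimage (in2W inj) (psi_displacement F psiQ psi_proper `|time P i0 (y + s *: v)| qs).
apply: (@sub_infinite_set _ setT); last exact: infinite_nat.
by move=> k _ /=; rewrite mulmxDr fixk -scalemxAr fixv.
Qed.

(** The representative of z modulo v in the hyperplane of time 0, where the form
    is positive definite. *)
Definition shadow (z : 'cV[R]_m) := z - (time P i0 z / time P i0 v) *: v.

Lemma shadowD x y : shadow (x + y) = shadow x + shadow y.
Proof. by rewrite /shadow /time coordD mulrDl scalerDl opprD addrACA. Qed.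

Lemma shadowZ c x : shadow (c *: x) = c *: shadow x.
Proof. by rewrite /shadow /time coordZ scalerBr scalerA mulrA. Qed.

Lemma shadowv : shadow v = 0.
Proof. by rewrite /shadow divff // scale1r subrr. Qed.

Lemma shadow_time z : time P i0 (shadow z) = 0.
Proof. by rewrite /shadow /time coordD coordN coordZ -!/(time P i0 _) divfK // subrr. Qed.

(** As psi u y and y have the same square, the coordinate along v of the
    displacement is a quadratic function of the shadow. *)
Lemma shadow_proper y C : quad Q y = -1 -> bilin Q y v != 0 ->
  finite_set [set u | `|shadow (psi u *m y - y)| <= C].
Proof.
move=> qy yv.
pose K := m%:R * (m%:R * C * `|Q|) * C; pose L := m%:R * (m%:R * `|y| * `|Q|) * C.
pose D := (`|K| + `|L|) / `|bilin Q y v| * `|time P i0 v| + `|time P i0 y|.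
apply: sub_finite_set (psi_displacement F psiQ psi_proper D qy) => u /= zC.
set z := psi u *m y - y in zC; pose s := time P i0 z / time P i0 v.
have C0 : 0 <= C by exact: le_trans zC.
have bound x x' : `|bilin Q x x'| <= m%:R * (m%:R * `|x| * `|Q|) * `|x'|.
  apply: le_trans (mx_norm_entry _ _ _) _; apply: le_trans (mx_norm_mul _ _) _.
  rewrite ler_wpM2r // ler_wpM2l //; apply: le_trans (mx_norm_mul _ _) _.
  by rewrite mx_norm_tr.
have zE : z = shadow z + s *: v by rewrite /shadow subrK.
have zv : bilin Q (shadow z) v = 0.
  by rewrite /shadow bilinBl bilinZl -/(quad Q v) qv bilin_disp mulr0 subrr.
have qz : 2 * bilin Q y (shadow z) + 2 * s * bilin Q y v + quad Q (shadow z) = 0.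
  have psiy : psi u *m y = y + (shadow z + s *: v) by rewrite -zE addrC subrK.
  move: (shadow z) zv psiy {zC zE} => zz zv psiy.
  have := bilinM y y (psiQ u); rewrite psiy /quad !bilinE.
  rewrite (bilinC v y QT) (bilinC v zz QT) (bilinC zz y QT) zv.
  rewrite -/(quad Q v) qv; lra.
have sB : `|s| <= (`|K| + `|L|) / `|bilin Q y v|.
  rewrite ler_pdivlMr ?normr_gt0 // -normrM.
  have KB : `|quad Q (shadow z)| <= `|K|.
    apply: le_trans (ler_norm K); apply: le_trans (bound _ _) _.
    rewrite /K ler_pM ?mulr_ge0 // ler_wpM2l // ler_wpM2r // ler_wpM2l //.
  have LB : `|bilin Q y (shadow z)| <= `|L|.
    apply: le_trans (ler_norm L); apply: le_trans (bound _ _) _.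
    by rewrite /L ler_wpM2l ?mulr_ge0.
  have -> : s * bilin Q y v = - (bilin Q y (shadow z)) - quad Q (shadow z) / 2 by lra.
  rewrite (le_trans (ler_normB _ _)) // normrN addrC lerD // normrM.
  have -> : `|(2 : R)^-1| = 2^-1 by rewrite ger0_norm.
  have := normr_ge0 (quad Q (shadow z)); lra.
have -> : psi u *m y = y + z by rewrite addrC subrK.
have tz : time P i0 z = s * time P i0 v.
  rewrite {1}zE /time (coordD P (shadow z)) coordZ -!/(time P i0 _).
  by rewrite shadow_time add0r.
rewrite /time (coordD P y) -!/(time P i0 _) tz addrC.
rewrite (le_trans (ler_normD _ _)) // lerD // normrM ler_wpM2r //.
Qed.

(** If psi u - 1 is nilpotent on x, it maps x into the line of v: otherwise the
    last iterate of x outside this line would be isotropic, as psi u is an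
    isometry, and orthogonal to v. *)
Lemma nilpotent_perp u x k : bilin Q x v = 0 -> (psi u - 1%:M) ^+ k *m x = 0 ->
  exists c, psi u *m x = x + c *: v.
Proof.
move=> xv; set N := psi u - 1%:M.
have Nv : N *m v = 0 by rewrite mulmxBl fixv mul1mx subrr.
have perp j : bilin Q (N ^+ j *m x) v = 0.
  elim: j => [|j IH]; first by rewrite expr0 mul1mx.
  by rewrite exprS -mulmxE -mulmxA mulmxBl mul1mx bilin_disp.
suff line j c : N ^+ j.+1 *m x = c *: v -> exists c, psi u *m x = x + c *: v.
  move=> Nk; apply: (line k 0); by rewrite exprS -mulmxE -mulmxA Nk mulmx0 scale0r.
elim: j c => [|j IH] c.
  by rewrite expr1 mulmxBl mul1mx => E; exists c; rewrite -E addrC subrK.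
move=> Nj; pose z := N ^+ j.+1 *m x; pose w := N ^+ j *m x.
have zw : z = psi u *m w - w by rewrite /z /w exprS -mulmxE -mulmxA mulmxBl mul1mx.
have Nz : psi u *m z = z + c *: v.
  by rewrite -Nj exprS -mulmxE -mulmxA mulmxBl mul1mx -/z addrC subrK.
have [d zd] : exists d, z = d *: v.
  apply: (perp_isotropic_eq0 F qv v0 (perp _)).
  have : bilin Q (psi u *m w) (psi u *m z) = bilin Q w z by rewrite bilinM.
  rewrite Nz bilinDr bilinZr bilin_fix perp mulr0 addr0 => E.
  by rewrite /quad -/z {1}zw bilinBl E subrr.
exact: IH zd.
Qed.

End Parabolic.

(** * Unipotence of lattices of full rank *)

Section Unipotent.
Variables (R : realType) (n : nat).
Let m := n.+2.
Variables (Q P : 'M[R]_m) (i0 : 'I_m).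
Hypothesis F : lorentz_frame Q P i0.
Variable psi : 'cV[int]_n -> 'M[R]_m.
Hypotheses (psiD : forall u v, psi (u + v) = psi u *m psi v)
  (psiQ : forall u, (psi u)^T *m Q *m psi u = Q)
  (psi_proper : forall C, finite_set [set u | `|psi u| <= C]).
Variable v : 'cV[R]_m.
Hypotheses (v0 : v != 0) (qv : quad Q v = 0) (fixv : forall u, psi u *m v = v).

Let QT := frame_sym F.

Lemma exists_pairing : exists i, bilin Q (delta_mx i 0) v != 0.
Proof.
apply: contrapT => ni; case/eqP: v0.
suff : Q *m v = 0.
  by move=> /(congr1 (mulmx (invmx Q))); rewrite mulKmx ?mulmx0 // (frame_form_unit F).
apply/colP => i; rewrite [RHS]mxE; apply: contrapT => Qvi; apply: ni; exists i.
apply/eqP; rewrite (bilinC _ _ QT) bilin_delta => E; apply: Qvi.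
by rewrite -[Q *m v]trmxK trmx_mul QT mxE.
Qed.

(** Row spaces stand for spaces of column vectors, whence the transposes. The
    last condition distinguishes these subspaces from the orthogonal complement
    of v. *)
Definition invariant_transverse (E : 'M[R]_m) := [/\ (v^T <= E)%MS,
  forall u, (E *m (psi u)^T <= E)%MS &
  exists x : 'cV[R]_m, (x^T <= E)%MS /\ bilin Q x v != 0].

(** Fitting decomposition of psi u - 1 on E. The nilpotent part is invariant by
    commutation and contains v. The other part is in the image of psi u - 1,
    which is orthogonal to v, so the nilpotent part is not, and by minimality it
    is all of E. *)
Lemma minimal_nilpotent E u : invariant_transverse E ->
  (forall E', invariant_transverse E' -> (\rank E <= \rank E')%N) ->
  exists k, forall x : 'cV[R]_m, (x^T <= E)%MS -> (psi u - 1%:M) ^+ k *m x = 0.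
Proof.
move=> [vE stab [x0 [x0E x0v]]] Emin.
pose N := psi u - 1%:M; pose T := N^T.
have Nv : N *m v = 0 by rewrite mulmxBl fixv mul1mx subrr.
have TX k : T ^+ k = (N ^+ k)^T.
  by elim: k => [|k IH]; rewrite ?expr0 ?trmx1 // exprS IH -mulmxE -trmx_mul mulmxE -exprSr.
have ET k : (E *m T ^+ k <= E)%MS.
  elim: k => [|k IH]; first by rewrite expr0 mulmx1.
  rewrite exprSr -mulmxE mulmxA; apply: submx_trans (submxMr _ IH) _.
  rewrite /T linearB /= trmx1 mulmxBr mulmx1 addmx_sub //.
  by rewrite -scaleN1r scalemx_sub.
have [k kmin] : exists k, forall l, (\rank (E *m T ^+ k.+1) <= \rank (E *m T ^+ l.+1))%N.
  pose p r := `[< exists k, \rank (E *m T ^+ k.+1) = r >].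
  have ex : exists r, p r by exists (\rank (E *m T ^+ 1)); apply/asboolP; exists 0%N.
  case: (ex_minnP ex) => r /asboolP[k kr] rmin; exists k => l; rewrite kr.
  by apply: rmin; apply/asboolP; exists l.
have Ekk : (E *m T ^+ k.+1 <= E *m T ^+ (k.+1 + k.+1))%MS.
  have le : (E *m T ^+ (k.+1 + k.+1) <= E *m T ^+ k.+1)%MS.
    by rewrite exprD -mulmxE mulmxA; apply: submxMr; exact: ET.
  have := mxrank_leqif_sup le; case=> _ <-.
  by rewrite eqn_leq (mxrankS le) /= addSn; exact: kmin.
pose E' := (E :&: kermx (T ^+ k.+1))%MS.
have inE' (x : 'cV[R]_m) : (x^T <= E')%MS = (x^T <= E)%MS && (x^T *m T ^+ k.+1 == 0).
  by rewrite sub_capmx; congr (_ && _); apply/sub_kermxP/eqP.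
have vT : v^T *m T ^+ k.+1 = 0 by rewrite TX -trmx_mul exprSr -mulmxE -mulmxA Nv mulmx0 trmx0.
have good' : invariant_transverse E'.
  split; first by rewrite inE' vE vT eqxx.
    move=> b; rewrite sub_capmx; apply/andP; split.
      by apply: submx_trans (submxMr _ (capmxSl _ _)) (stab b).
    apply/sub_kermxP; rewrite -mulmxA.
    have -> : (psi b)^T *m T ^+ k.+1 = T ^+ k.+1 *m (psi b)^T.
      have c1 : GRing.comm (psi b) N.
        rewrite /GRing.comm /N -!mulmxE mulmxBr mulmxBl mulmx1 mul1mx.
        by rewrite (psiC psiD).
      by rewrite TX -!trmx_mul !mulmxE (commrX k.+1 c1).
    have /sub_kermxP E0 : (E' <= kermx (T ^+ k.+1))%MS by exact: capmxSr.
    by rewrite mulmxA E0 mul0mx.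
  have /submxP[D DE] : (x0^T *m T ^+ k.+1 <= E *m T ^+ (k.+1 + k.+1))%MS.
    exact: submx_trans (submxMr _ x0E) Ekk.
  pose z : 'cV[R]_m := (D *m E)^T.
  exists (x0 - N ^+ k.+1 *m z); split.
    rewrite inE'; apply/andP; split.
      rewrite linearB /= trmx_mul -TX trmxK addmx_sub // -scaleN1r scalemx_sub //.
      rewrite -mulmxA; apply: submx_trans (submxMl _ _) (ET _).
    rewrite linearB /= trmx_mul -TX trmxK mulmxBl DE exprD -mulmxE !mulmxA.
    by rewrite subrr.
  rewrite bilinBl exprS -mulmxE -mulmxA mulmxBl mul1mx.
  by rewrite (bilin_disp psiQ fixv) subr0.
exists k.+1 => x xE.
have EE' : (E <= E')%MS.
  have := mxrank_leqif_sup (capmxSl E (kermx (T ^+ k.+1))); case=> _ <-.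
  by rewrite eqn_leq (Emin _ good') andbT mxrankS // capmxSl.
have := submx_trans xE EE'; rewrite inE' => /andP[_ /eqP].
by rewrite TX -trmx_mul => /(congr1 trmx); rewrite trmxK trmx0.
Qed.

(** For y in E on the hyperboloid, the displacement psi u y - y modulo v is
    additive in u by nilpotence, and ranges over a space whose dimension is two
    less than that of E. If E is proper this is less than n, so infinitely many
    displacements are bounded, which contradicts properness. *)
Lemma minimal_full E : invariant_transverse E ->
  (forall E', invariant_transverse E' -> (\rank E <= \rank E')%N) -> \rank E = m.
Proof.
move=> goodE Emin; have [vE stab [x0 [x0E x0v]]] := goodE.
apply/eqP; rewrite eqn_leq rank_leq_col /= leqNgt; apply/negP => rE.
have [s qy] := timelike_shift F qv x0v; set y := x0 + s *: v in qy.
have tv := isotropic_time F qv v0.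
have yE : (y^T <= E)%MS.
  by rewrite linearD addmx_sub // linearZ /= scalemx_sub.
have yv : bilin Q y v != 0 by rewrite /y !bilinE -/(quad Q v) qv mulr0 addr0.
pose tm : 'cV[R]_m := (invmx P)^T *m delta_mx i0 0.
have tmE (x : 'cV[R]_m) : x^T *m tm = (time P i0 x)%:M.
  rewrite mulmxA -trmx_mul -colE; apply/matrixP => i j.
  by rewrite !mxE !ord1 eqxx mulr1n /time /coord mxE.
have vE' (x : 'cV[R]_m) : x^T *m (Q *m v) = (bilin Q x v)%:M.
  by rewrite mulmxA; apply/matrixP => i j; rewrite [RHS]mxE !ord1 eqxx mulr1n.
have scal0 (a : R) : (a%:M == 0 :> 'M[R]_1) = (a == 0).
  by apply/eqP/eqP => [/matrixP/(_ 0 0)|->]; rewrite ?scalemx0 ?mxE ?eqxx ?mulr1n // raddf0.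
pose E0 := (E :&: kermx (Q *m v))%MS; pose E1 := (E0 :&: kermx tm)%MS.
have inE0 (x : 'cV[R]_m) : (x^T <= E0)%MS = (x^T <= E)%MS && (bilin Q x v == 0).
  by rewrite sub_capmx -scal0 -vE'; congr (_ && _); apply/sub_kermxP/eqP.
have inE1 (x : 'cV[R]_m) : (x^T <= E1)%MS = (x^T <= E0)%MS && (time P i0 x == 0).
  by rewrite sub_capmx -scal0 -tmE; congr (_ && _); apply/sub_kermxP/eqP.
have r0 : (\rank E0 < \rank E)%N.
  apply: rank_ltmx; rewrite ltmxE capmxSl /=; apply/negP => EE0.
  by have := submx_trans yE EE0; rewrite inE0 (negPf yv) andbF.
have r1 : (\rank E1 < \rank E0)%N.
  apply: rank_ltmx; rewrite ltmxE capmxSl /=; apply/negP => EE0.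
  have : (v^T <= E0)%MS by rewrite inE0 vE -/(quad Q v) qv eqxx.
  by move=> /submx_trans /(_ EE0); rewrite inE1 (negPf tv) andbF.
have rn : (\rank E1 < n)%N by move: rE r0 r1; rewrite /m; lia.
have psiE u (x : 'cV[R]_m) : (x^T <= E)%MS -> ((psi u *m x)^T <= E)%MS.
  by move=> xE; rewrite trmx_mul; apply: submx_trans (submxMr _ xE) (stab u).
have dispE u : ((psi u *m y - y)^T <= E)%MS.
  by rewrite linearB /= addmx_sub ?psiE // -scaleN1r scalemx_sub.
have dispv u : bilin Q (psi u *m y - y) v = 0 by exact: (bilin_disp psiQ fixv).
pose sh u := shadow P i0 v (psi u *m y - y).
have shE1 u : ((sh u)^T <= E1)%MS.
  rewrite inE1 inE0 /sh (shadow_time F v0 qv) eqxx andbT /shadow.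
  rewrite bilinBl bilinZl dispv -/(quad Q v) qv mulr0 subrr eqxx andbT.
  by rewrite linearB linearZ /= addmx_sub ?dispE // -scaleN1r !scalemx_sub.
have shD u w : sh (u + w) = sh u + sh w.
  have [k kP] := minimal_nilpotent u goodE Emin.
  have [c cP] := nilpotent_perp F psiQ v0 qv fixv (dispv w) (kP _ (dispE w)).
  have E2 : psi (u + w) *m y - y = (psi u *m y - y) + (psi w *m y - y) + c *: v.
    rewrite -addrA -cP mulmxBr psiD -mulmxA.
    by rewrite [RHS]addrC addrA subrK.
  by rewrite /sh E2 !shadowD shadowZ (shadowv F v0 qv) scaler0 addr0.
pose B := row_base E1; pose f u := ((sh u)^T *m pinvmx B)^T.
have fB u : (sh u)^T = (f u)^T *m B by rewrite trmxK mulmxKpV // eq_row_base shE1.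
have [|C fC] := additive_bounded_infinite (f := f) rn.
  by move=> u w; rewrite /f shD linearD /= mulmxDl linearD.
apply: fC; pose D := (\rank E1)%:R * C * `|B|.
apply: sub_finite_set (shadow_proper F psiQ psi_proper v0 qv fixv D qy yv) => u /= uC.
rewrite -/(sh u) -mx_norm_tr fB; apply: le_trans (mx_norm_mul _ _) _.
by rewrite /D ler_wpM2r // ler_wpM2l // mx_norm_tr.
Qed.

Lemma psi_unipotent u x : bilin Q x v = 0 -> exists c, psi u *m x = x + c *: v.
Proof.
have [i iv] := exists_pairing.
have full : invariant_transverse 1%:M.
  by split=> [|w|]; rewrite ?submx1 //; exists (delta_mx i 0); rewrite submx1.
pose p r := `[< exists E, invariant_transverse E /\ \rank E = r >].
have ex : exists r, p r by exists (\rank (1%:M : 'M[R]_m)); apply/asboolP; exists 1%:M.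
case: (ex_minnP ex) => r /asboolP[E [goodE Er]] rmin.
have Emin E' : invariant_transverse E' -> (\rank E <= \rank E')%N.
  by move=> goodE'; rewrite Er; apply: rmin; apply/asboolP; exists E'.
have Efull := minimal_full goodE Emin.
have [k kP] := minimal_nilpotent u goodE Emin.
move=> xv; apply: (nilpotent_perp F psiQ v0 qv fixv xv (kP x _)).
by apply: submx_full; rewrite /row_full Efull.
Qed.

End Unipotent.

(** * Determinant of a form containing a hyperbolic plane *)

Lemma det_block22 (K : comNzRingType) (a b c d : 'M[K]_1) :
  \det (block_mx a b c d) = a 0 0 * d 0 0 - b 0 0 * c 0 0.
Proof.
rewrite (expand_det_row _ (lshift 1 0)) big_split_ord !big_ord1 block_mxEul block_mxEur.
have minor (A : 'M[K]_(1 + 1)) i j : row' i (col' j A) 0 0 = A (lift i 0) (lift j 0).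
  by rewrite mxE mxE.
rewrite /cofactor !det_mx11 !minor.
have -> : lift (lshift 1 (0 : 'I_1) : 'I_(1 + 1)) (0 : 'I_1) = rshift 1 (0 : 'I_1) :> 'I_(1 + 1) by apply/val_inj.
have -> : lift (rshift 1 (0 : 'I_1) : 'I_(1 + 1)) (0 : 'I_1) = lshift 1 (0 : 'I_1) :> 'I_(1 + 1) by apply/val_inj.
rewrite block_mxEdr block_mxEdl /=; ring.
Qed.

(** In the basis v, y, W the form is the sum of a hyperbolic plane, of
    determinant -1, and of the form on W. *)
Lemma hyperbolic_split_det (K : fieldType) n (q : 'M[K]_(1 + 1 + n))
    (v y : 'cV[K]_(1 + 1 + n)) (W : 'M[K]_(1 + 1 + n, n)) :
  q^T = q -> v^T *m q *m v = 0 -> v^T *m q *m y = 1%:M ->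
  v^T *m q *m W = 0 -> y^T *m q *m W = 0 ->
  \det q * \det (row_mx (row_mx v y) W) ^+ 2 = - \det (W^T *m q *m W).
Proof.
move=> qT vv vy vW yW; set B := row_mx (row_mx v y) W.
have yv : y^T *m q *m v = 1%:M.
  by apply: trmx_inj; rewrite !trmx_mul trmxK qT mulmxA vy trmx1.
have Wv : W^T *m q *m v = 0.
  by apply: trmx_inj; rewrite !trmx_mul trmxK qT mulmxA vW trmx0.
have Wy : W^T *m q *m y = 0.
  by apply: trmx_inj; rewrite !trmx_mul trmxK qT mulmxA yW trmx0.
have : B^T *m q *m B = block_mx (block_mx 0 1%:M 1%:M (y^T *m q *m y)) 0 0 (W^T *m q *m W).
  rewrite /B !tr_row_mx !mul_col_mx !mul_mx_row vv vy vW yv yW Wv Wy.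
  by rewrite row_mx0 -[X in col_mx X _]block_mxEv [X in col_mx X _]block_mxEh col_mx0 -block_mxEv.
move=> /(congr1 determinant); rewrite !det_mulmx det_tr det_ublock => E.
have D2 : \det (block_mx 0 1%:M 1%:M (y^T *m q *m y) : 'M[K]_(1 + 1)) = -1.
  by rewrite det_block22 !mxE eqxx mul0r mulr1 sub0r.
move: E; rewrite D2 mulN1r => <-; ring.
Qed.

(** * The rational form on a unipotent lattice *)

Lemma biadditive_matrix (R : realType) n (b : 'cV[int]_n -> 'cV[int]_n -> R) :
  (forall u u' w, b (u + u') w = b u w + b u' w) ->
  (forall u w w', b u (w + w') = b u w + b u w') ->
  forall u w, b u w = ((map_mx intr u)^T *m
    (\matrix_(i, j) b (delta_mx i 0) (delta_mx j 0)) *m map_mx intr w) 0 0.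
Proof.
move=> bDl bDr.
have lin (f : 'cV[int]_n -> R) : (forall u u', f (u + u') = f u + f u') ->
    forall u, f u = \sum_i (u i 0)%:~R * f (delta_mx i 0).
  move=> fD; have [|M fM] := @additive_matrix R n 1 (fun u => const_mx (f u)).
    by move=> u u'; apply/colP => i; rewrite !mxE fD.
  have fE u : f u = (M *m map_mx intr u) 0 0 by rewrite -fM mxE.
  have Me i : M 0 i = f (delta_mx i 0).
    rewrite fE mxE (bigD1 i) //= big1 => [|j ji]; last by rewrite !mxE (negPf ji) mulr0.
    by rewrite !mxE !eqxx mulr1 addr0.
  by move=> u; rewrite fE mxE; apply: eq_bigr => i _; rewrite -Me mxE mulrC.
move=> u w; rewrite (lin (b^~ w)) // mxE.
under eq_bigr => i _ do rewrite (lin (b _)) //.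
transitivity (\sum_i \sum_j (u i 0)%:~R * b (delta_mx i 0) (delta_mx j 0) * (w j 0)%:~R : R).
  apply: eq_bigr => i _; rewrite big_distrr /=; apply: eq_bigr => j _; ring.
rewrite exchange_big /=; apply: eq_bigr => j _; rewrite !mxE big_distrl /=.
by apply: eq_bigr => i _; rewrite !mxE.
Qed.

Lemma rat_common_denominator n (z : 'cV[rat]_n) :
  exists2 d : int, d != 0 & exists u : 'cV[int]_n, map_mx intr u = d%:~R *: z.
Proof.
exists (\prod_i denq (z i 0)); first by apply/prodf_neq0 => i _; rewrite denq_eq0.
exists (\col_i (numq (z i 0) * \prod_(j | j != i) denq (z j 0))).
apply/colP => i; rewrite !mxE [in RHS](bigD1 i) //= !intrM numqE.
by rewrite -[LHS]mulrA [LHS]mulrC.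
Qed.

Lemma bilin_ratr (R : realType) m (q : 'M[rat]_m) (x y : 'cV[rat]_m) :
  bilin (map_mx ratr q) (map_mx ratr x) (map_mx ratr y) = ratr ((x^T *m q *m y) 0 0) :> R.
Proof. by rewrite /bilin map_trmx -!map_mxM mxE. Qed.

Section RationalForm.
Variables (R : realType) (n : nat) (q : 'M[rat]_n.+2).
Let m := n.+2.
Let Q : 'M[R]_m := map_mx ratr q.
Variables (P : 'M[R]_m) (i0 : 'I_m).
Hypothesis F : lorentz_frame Q P i0.
Variable psi : 'cV[int]_n -> 'M[R]_m.
Hypotheses (psiD : forall u v, psi (u + v) = psi u *m psi v)
  (psiQ : forall u, (psi u)^T *m Q *m psi u = Q)
  (psi_proper : forall C, finite_set [set u | `|psi u| <= C])
  (psi_rat : forall u, exists a : 'M[rat]_m, psi u = map_mx ratr a).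
Hypothesis n_gt0 : (0 < n)%N.
Let QT := frame_sym F.
Let e0 : 'cV[int]_n := delta_mx (Ordinal n_gt0) 0.
Let e0_neq0 : e0 != 0.
Proof.
by apply/eqP => /colP/(_ (Ordinal n_gt0)); rewrite !mxE !eqxx.
Qed.

(** The line of v is the image under (psi u - 1)^2 of a vector not orthogonal to
    v, hence it is rational. *)
Lemma rational_isotropic v : v != 0 -> quad Q v = 0 -> (forall u, psi u *m v = v) ->
  exists w : 'cV[rat]_m, [/\ w != 0, quad Q (map_mx ratr w) = 0
    & forall u, psi u *m map_mx ratr w = map_mx ratr w].
Proof.
move=> v0 qv fixv; have [i iv] := exists_pairing F v0.
pose x : 'cV[R]_m := delta_mx i 0; pose y := psi e0 *m x - x.
have yv : bilin Q y v = 0 by exact: (bilin_disp psiQ fixv).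
have [c yc] := psi_unipotent F psiD psiQ psi_proper v0 qv fixv e0 yv.
have c0 : c != 0.
  have := parabolic_disp F psiD psiQ psi_proper v0 qv fixv e0_neq0 iv; rewrite -/x -/y.
  apply: contraTneq => c0; rewrite c0 scale0r addr0 in yc.
  have := bilinM y x (psiQ e0); rewrite yc => E.
  by rewrite /quad {2}/y bilinBr E subrr ltxx.
have [a aE] := psi_rat e0.
pose w : 'cV[rat]_m := (a - 1%:M) *m ((a - 1%:M) *m delta_mx i 0).
have wE : map_mx ratr w = c *: v.
  rewrite /w !map_mxM map_mxB map_mx1 -aE map_delta_mx !mulmxBl !mul1mx.
  by rewrite -/x -/y yc addrC addKr.
exists w; split.
- apply: contraNneq v0 => w0; move: wE; rewrite w0 map_mx0 => /esym/eqP.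
  by rewrite scaler_eq0 (negPf c0).
- by rewrite wE /quad !bilinE -/(quad Q v) qv !mulr0.
- by move=> u; rewrite wE -scalemxAr fixv.
Qed.

Variable v' : 'cV[rat]_m.
Let v : 'cV[R]_m := map_mx ratr v'.
Hypotheses (v0 : v != 0) (qv : quad Q v = 0) (fixv : forall u, psi u *m v = v).

(** G is the Gram matrix of the displacements w u = psi u y - y of a rational
    vector y with bilin y v = 1; these are additive in u modulo v. Together with
    v and y their projections orthogonal to y form a rational basis, whence the
    determinant. An isometry that normalizes the lattice scales v by some l, and
    G by l^2; this is 1 when the action on the lattice has finite order. *)
Theorem unipotent_form : exists G : 'M[rat]_n,
  [/\ G^T = G, \det G != 0, exists r, \det q * r ^+ 2 = - \det G
    & forall (A : 'M[int]_n) k (g : 'M[R]_m), (0 < k)%N -> A ^+ k = 1%:M ->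
        g^T *m Q *m g = Q -> (forall u, g *m psi u = psi (A *m u) *m g) ->
        (map_mx intr A)^T *m G *m map_mx intr A = G].
Proof.
have [a aE] := choice psi_rat.
have [i iv] := exists_pairing F v0.
pose pr : rat := ((delta_mx i 0 : 'cV[rat]_m)^T *m q *m v') 0 0.
have prE : ratr pr = bilin Q (delta_mx i 0) v by rewrite -bilin_ratr map_delta_mx.
have pr0 : pr != 0 by apply: contraNneq iv => p0; rewrite -prE p0 rmorph0.
pose y' : 'cV[rat]_m := pr^-1 *: delta_mx i 0.
pose y : 'cV[R]_m := map_mx ratr y'.
have yv : bilin Q y v = 1.
  by rewrite /y map_mxZ map_delta_mx bilinZl -prE fmorphV mulVf // fmorph_eq0.
have yv0 : bilin Q y v != 0 by rewrite yv oner_neq0.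
have [w wE] : exists w, forall u, w u = psi u *m y - y by exists (fun u => psi u *m y - y).
have wv u : bilin Q (w u) v = 0 by rewrite wE; exact: (bilin_disp psiQ fixv).
have vw u : bilin Q v (w u) = 0 by rewrite bilinC.
have vv : bilin Q v v = 0 := qv.
have unip := psi_unipotent F psiD psiQ psi_proper v0 qv fixv.
have wD u u' : exists c, w (u + u') = w u + w u' + c *: v.
  have [c cE] := unip u _ (wv u'); exists c; rewrite -addrA -cE !wE mulmxBr psiD -mulmxA.
  by rewrite [RHS]addrC addrA subrK.
pose b u u' := bilin Q (w u) (w u').
have bDl u u' x : b (u + u') x = b u x + b u' x.
  by rewrite /b; have [c ->] := wD u u'; rewrite !bilinE vw mulr0 addr0.
have bC u u' : b u u' = b u' u by exact: bilinC.
have bDr x u u' : b x (u + u') = b x u + b x u' by rewrite bC bDl !(bC x).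
have bpos u : u != 0 -> 0 < b u u.
  by move=> u0; rewrite /b wE; exact: (parabolic_disp F psiD psiQ psi_proper v0 qv fixv u0 yv0).
pose w' u : 'cV[rat]_m := a u *m y' - y'.
have w'E u : map_mx ratr (w' u) = w u by rewrite wE /w' map_mxB map_mxM -aE.
pose G := \matrix_(i, j) ((w' (delta_mx i 0))^T *m q *m w' (delta_mx j 0)) 0 0 : 'M[rat]_n.
have GR : map_mx ratr G = \matrix_(i, j) b (delta_mx i 0) (delta_mx j 0) :> 'M[R]_n.
  by apply/matrixP => j k; rewrite [LHS]mxE [G _ _]mxE [RHS]mxE -bilin_ratr !w'E.
have bG u u' : b u u' = ((map_mx intr u)^T *m map_mx ratr G *m map_mx intr u') 0 0.
  by rewrite GR; exact: biadditive_matrix.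
have ratr_intr k l (M : 'M[int]_(k, l)) : map_mx ratr (map_mx intr M) = map_mx intr M :> 'M[R]_(k, l).
  by apply/matrixP => r s; rewrite !mxE ratr_int.
exists G; split.
- apply: (@map_mx_inj _ _ (@ratr R)); apply/matrixP => j k.
  by rewrite -map_trmx GR !mxE bC.
- apply/negP => /det0P[z z0 zG].
  have [d d0 [u uE]] := rat_common_denominator z^T.
  have u0 : u != 0.
    apply: contraNneq z0 => u0; move: uE; rewrite u0 map_mx0 => /esym/eqP.
    by rewrite scaler_eq0 intr_eq0 (negPf d0) trmx_eq0.
  have := bpos u u0; rewrite bG -(ratr_intr _ _ u) uE map_trmx -map_mxM.
  by rewrite linearZ /= trmxK -scalemxAl zG scaler0 map_mx0 mul0mx mxE ltxx.
- pose cf u : rat := ((w' u)^T *m q *m y') 0 0.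
  have cfE u : ratr (cf u) = bilin Q (w u) y :> R by rewrite -w'E bilin_ratr.
  pose W : 'M[rat]_(m, n) := \matrix_(k, j) (w' (delta_mx j 0) - cf (delta_mx j 0) *: v') k 0.
  have colW j : col j W = w' (delta_mx j 0) - cf (delta_mx j 0) *: v'.
    by apply/colP => k; rewrite mxE mxE.
  have colWR j : map_mx ratr (col j W) = w (delta_mx j 0) - bilin Q (w (delta_mx j 0)) y *: v.
    by rewrite colW map_mxB map_mxZ w'E /= cfE.
  have entry k l (X : 'M[rat]_(m, k)) (Y : 'M[rat]_(m, l)) r s :
      ratr ((X^T *m q *m Y) r s) = bilin Q (map_mx ratr (col r X)) (map_mx ratr (col s Y)) :> R.
    rewrite bilin_ratr; congr ratr.
    rewrite tr_col -row_mul [LHS]mxE [RHS]mxE; apply: eq_bigr => h _.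
    by rewrite [in RHS]mxE [col _ _ _ _]mxE.
  have col1 (x : 'cV[rat]_m) : col 0 x = x by apply/colP => k; rewrite mxE.
  have ratr_inj : injective (@ratr R) by exact: fmorph_inj.
  have qT : q^T = q.
    by apply: (@map_mx_inj _ _ (@ratr R)); rewrite -map_trmx.
  exists (\det (row_mx (row_mx v' y') W : 'M[rat]_(1 + 1 + n))).
  rewrite (@hyperbolic_split_det _ n q v' y' W) //.
  + congr (- \det _); apply/matrixP => r s; apply: ratr_inj.
    rewrite entry !colWR !bilinE vv vw wv !mulr0 !oppr0 !addr0 -/(b _ _).
    transitivity ((map_mx ratr G : 'M[R]_n) r s); last by rewrite mxE.
    by rewrite GR mxE mulr0 subrr addr0.
  + by apply/matrixP => r s; rewrite !ord1; apply: ratr_inj; rewrite entry !col1 -/v vv mxE rmorph0.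
  + apply/matrixP => r s; rewrite !ord1; apply: ratr_inj.
    by rewrite entry !col1 -/v -/y (bilinC v y QT) yv mxE eqxx rmorph1.
  + apply/matrixP => r s; rewrite !ord1; apply: ratr_inj.
    by rewrite entry !col1 colWR -/v !bilinE vw vv mxE rmorph0 mulr0 oppr0 addr0.
  + apply/matrixP => r s; rewrite !ord1; apply: ratr_inj.
    rewrite entry !col1 colWR -/y !bilinE yv mulr1 (bilinC y (w _) QT) subrr.
    by rewrite mxE rmorph0.
- move=> A k g k0 Ak gQ gA.
  have gu := isometry_unit F gQ.
  have Aw (u : 'cV[int]_n) : A *m ((A ^+ k.-1) *m u) = u.
    by rewrite mulmxA -[A *m _]/(A * A ^+ k.-1) -exprS prednK // Ak mul1mx.
  (* g v is isotropic and fixed by all psi u, hence on the line of v *)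
  have [l gv] : exists l, g *m v = l *: v.
    have fixgv u : psi u *m (g *m v) = g *m v.
      by rewrite -(Aw u) mulmxA -gA -mulmxA fixv.
    have qgv : quad Q (g *m v) = 0 by rewrite /quad bilinM.
    apply: (perp_isotropic_eq0 F qv v0) => //; apply: contrapT => /eqP gvv.
    have := parabolic_disp F psiD psiQ psi_proper v0 qv fixv e0_neq0 gvv.
    by rewrite fixgv subrr /quad bilin0l ltxx.
  have l_gy : l * bilin Q (g *m y) v = 1.
    by rewrite -bilinZr -gv bilinM.
  have wA u : exists c, w (A *m u) = l *: (g *m w u) + c *: v.
    pose x := g *m y - l^-1 *: y.
    have l0 : l != 0.
      by apply/eqP => l0; move: l_gy; rewrite l0 mul0r => /esym/eqP; rewrite oner_eq0.
    have xv : bilin Q x v = 0.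
      rewrite /x bilinBl bilinZl yv mulr1; apply: (mulfI l0).
      by rewrite mulrBr l_gy divff // subrr mulr0.
    have [c cE] := unip (A *m u) x xv.
    exists (- l * c).
    have lx : l *: x = l *: (g *m y) - y.
      by rewrite /x scalerBr scalerA divff // scale1r.
    have psiy : psi (A *m u) *m y = l *: (g *m (psi u *m y)) - l *: (x + c *: v).
      by rewrite -[y in LHS](subKr (l *: (g *m y))) -lx mulmxBr -!scalemxAr cE !mulmxA gA.
    rewrite !wE psiy mulmxBr scalerBr scalerDr lx mulNr scaleNr scalerA.
    move: (l *: (g *m (psi u *m y))) (l *: (g *m y)) ((l * c) *: v) => p d e.
    by apply/colP => t; rewrite !mxE; ring.
  have bA u u' : b (A *m u) (A *m u') = l ^+ 2 * b u u'.
    have [c cE] := wA u; have [c' cE'] := wA u'.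
    have gwv x : bilin Q (g *m w x) v = 0.
      have := bilinM (w x) v gQ; rewrite gv bilinZr wv => /eqP; rewrite mulf_eq0 => /orP[/eqP l0|/eqP //].
      by move: l_gy; rewrite l0 mul0r => /esym/eqP; rewrite oner_eq0.
    rewrite /b cE cE' !(bilinDl, bilinDr, bilinZl, bilinZr) gwv (bilinC v (g *m w u') QT) gwv vv.
    by rewrite (bilinM _ _ gQ) !mulr0 !addr0 mulr0 addr0 expr2 mulrA.
  have bAk j u : b (A ^+ j *m u) (A ^+ j *m u) = (l ^+ 2) ^+ j * b u u.
    elim: j => [|j IH]; first by rewrite !expr0 !mul1mx mul1r.
    by rewrite (exprS A) -[A * _]/(A *m _) -mulmxA bA IH (exprS (l ^+ 2)) mulrA.
  have l2 : l ^+ 2 = 1.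
    have := bAk k e0; rewrite Ak mul1mx -{1}[b e0 e0]mul1r => /(mulIf (lt0r_neq0 (bpos _ e0_neq0))) /esym /eqP.
    by rewrite pexpr_eq1 ?sqr_ge0 // => /eqP.
  apply: (@map_mx_inj _ _ (@ratr R)); rewrite !map_mxM -map_trmx !ratr_intr.
  apply/matrixP => r s.
  have dl x : map_mx intr (delta_mx x 0 : 'cV[int]_n) = delta_mx x 0 :> 'cV[R]_n by rewrite map_delta_mx.
  have entry (M : 'M[R]_n) x z : ((delta_mx x 0 : 'cV[R]_n)^T *m M *m (delta_mx z 0 : 'cV[R]_n)) 0 0 = M x z.
    by rewrite -colE mxE trmx_delta -rowE mxE.
  rewrite -entry -[RHS]entry -!dl -bG.
  have := bA (delta_mx r 0) (delta_mx s 0); rewrite l2 mul1r => <-.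
  by rewrite bG !map_mxM trmx_mul !mulmxA.
Qed.

End RationalForm.

(** * The rational form on the lattice of a cusp *)

(** The psi u fix an isotropic vector up to sign, so the psi (u + u) fix it. The
    hypotheses pass to this subgroup, and the conclusion depends on the lattice
    only up to a multiple. *)
Theorem lattice_form (R : realType) n (q : 'M[rat]_n.+2) (psi : 'cV[int]_n -> 'M[R]_n.+2) :
  (1 < n)%N -> has_signature (map_mx ratr q : 'M[R]_n.+2) n.+1 1 ->
  (forall u v, psi (u + v) = psi u *m psi v) ->
  (forall u, (psi u)^T *m map_mx ratr q *m psi u = map_mx ratr q) ->
  (forall C, finite_set [set u | `|psi u| <= C]) ->
  (forall u, exists a : 'M[rat]_n.+2, psi u = map_mx ratr a) ->
  exists G : 'M[rat]_n,
  [/\ G^T = G, \det G != 0, exists r, \det q * r ^+ 2 = - \det G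
    & forall (A : 'M[int]_n) k (g : 'M[R]_n.+2), (0 < k)%N -> A ^+ k = 1%:M ->
        g^T *m map_mx ratr q *m g = map_mx ratr q ->
        (forall u, g *m psi u = psi (A *m u) *m g) ->
        (map_mx intr A)^T *m G *m map_mx intr A = G].
Proof.
move=> n1 /signature_frame[P [i0 F]] psiD psiQ psi_proper psi_rat.
have n0 : (0 < n)%N by exact: ltnW.
have [v [v0 qv eig]] := common_isotropic F psiD psiQ psi_proper n0.
have fixv := isotropic_eigenvalue F psiD psiQ psi_proper n1 v0 qv eig.
pose psi2 u := psi (u + u).
have psi2D u w : psi2 (u + w) = psi2 u *m psi2 w by rewrite /psi2 -psiD addrACA.
have psi2Q u : (psi2 u)^T *m map_mx ratr q *m psi2 u = map_mx ratr q by exact: psiQ.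
have psi2_rat u : exists a : 'M[rat]_n.+2, psi2 u = map_mx ratr a by exact: psi_rat.
have psi2_proper C : finite_set [set u | `|psi2 u| <= C].
  have inj : injective (fun u : 'cV[int]_n => u + u).
    move=> u w uw; apply/colP => i; have := congr1 (fun M : 'cV[int]_n => M i 0) uw.
    rewrite !mxE => h; apply: (@mulfI _ (2 : int)) => //; by rewrite !mulr_natl !mulr2n.
  exact: (finite_preimage (in2W inj) (psi_proper C)).
have [w [w0 qw fixw]] :=
  rational_isotropic F psi2D psi2Q psi2_proper psi2_rat n0 v0 qv fixv.
have w0' : map_mx ratr w != 0 :> 'cV[R]_n.+2.
  apply: contraNneq w0 => w0; apply/eqP/(@map_mx_inj _ _ (@ratr R)).
  by rewrite w0 map_mx0.
have [G [GT G0 Gq GA]] :=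
  unipotent_form F psi2D psi2Q psi2_proper psi2_rat n0 w0' qw fixw.
exists G; split => // A k g k0 Ak gQ gA; apply: (GA A k g) => // u.
by rewrite /psi2 gA mulmxDr.
Qed.

(** Two powers of g lie in the same coset. *)
Lemma finite_index_power (R : realType) m (G D : set 'M[R]_m) g :
  group_of_matrices G -> group_of_matrices D -> finite_index (G `&` D) G -> G g ->
  exists2 k, (0 < k)%N & D (g ^+ k).
Proof.
move=> [G1 Gu GM GV] [D1 Du DM DV] [_ fin] Gg.
have Gpow i : G (g ^+ i) by elim: i => [|i IH]; rewrite ?expr0 // exprS; exact: GM.
pose coset i := [set g ^+ i *m k | k in G `&` D].
have [i [j [ij cij]]] : exists i j, (i < j)%N /\ coset i = coset j.
  apply: contrapT => noij.
  have inj : injective coset.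
    move=> i j cij; apply: contrapT => /eqP; rewrite neq_ltn => /orP[ij|ij]; apply: noij.
      by exists i, j.
    by exists j, i.
  have := finite_preimage (in2W inj) fin.
  apply: (@sub_infinite_set _ setT); last exact: infinite_nat.
  by move=> i _ /=; exists (g ^+ i).
exists (j - i)%N; first by rewrite subn_gt0.
have : coset i (g ^+ j).
  by rewrite cij; exists 1%:M; rewrite ?mulmx1.
move=> [k [_ Dk]] gk; have gu := mx_pow_unit i (Gu _ Gg).
suff -> : g ^+ (j - i) = k by [].
have : g ^+ i *m g ^+ (j - i) = g ^+ i *m k by rewrite gk -{2}(subnKC (ltnW ij)) exprD.
by move=> /(congr1 (mulmx (invmx (g ^+ i)))); rewrite !mulKmx.
Qed.

(** The flat group embeds in the group of N through the cusp and the isometry. A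
    multiple of the lattice of translations falls into the rational group D
    commensurable to it, and conjugation by g is carried along. *)
Theorem quasi_arithmetic_cusp_form (R : realType) n (B : flat_manifold R n)
    (M N : hyperbolic_manifold R n.+1) (q : 'M[rat]_n.+2) (tau : 'cV[int]_n -> 'M[R]_(n + 1)) :
  (1 < n)%N -> cusp_cross_section B M -> isometric M N -> quasi_arithmetic_for q N ->
  (forall u, flat_group B (tau u)) -> (forall u v, tau (u + v) = tau u *m tau v) ->
  injective tau ->
  exists G : 'M[rat]_n,
  [/\ G^T = G, \det G != 0, exists r, \det q * r ^+ 2 = - \det G
    & forall (A : 'M[int]_n) k g, (0 < k)%N -> A ^+ k = 1%:M -> flat_group B g ->
        (forall u, g *m tau u = tau (A *m u) *m g) ->
        (map_mx intr A)^T *m G *m map_mx intr A = G].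
Proof.
move=> n1 /cusp_hom[f [fM fD finj]] /isometric_hom[f' [f'M f'D f'inj]] [qN _ [D [Dgr DO [fin _]]]].
move=> tauB tauD tauinj.
pose phi g := f' (f g).
have phiN g : flat_group B g -> hyp_group N (phi g) by move=> /fM /f'M.
have phiD g h : flat_group B g -> flat_group B h -> phi (g *m h) = phi g *m phi h.
  by move=> Bg Bh; rewrite /phi fD // f'D //; exact: fM.
have phiinj g h : flat_group B g -> flat_group B h -> phi g = phi h -> g = h.
  by move=> Bg Bh /f'inj e; apply: finj => //; apply: e; exact: fM.
have [BM B1] : (forall g h, flat_group B g -> flat_group B h -> flat_group B (g *m h)) /\ flat_group B 1%:M.
  by case: (B) => G /= _ [].
clearbody phi; clear f f' fM fD finj f'M f'D f'inj M.
have sheetN := manifold_good N.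
move: sheetN phiN phiD phiinj qN DO fin; case: N => Q H G sQ sH GO Ggr Gd Gt /= sheetN phiN phiD phiinj qN DO fin.
have [G1 Gu GM GV] := Ggr; have [D1 Du DM DV] := Dgr.
have [P [i0 F]] := signature_frame sQ.
have phiQ g : flat_group B g -> (phi g)^T *m Q *m phi g = Q by move=> /phiN /GO[].
(* L is a subgroup containing a multiple of each basis vector, hence of every
   vector by a common factor *)
pose L u := D (phi (tau u)).
have phi_tauD u v : phi (tau (u + v)) = phi (tau u) *m phi (tau v) by rewrite tauD phiD.
have phi_tau0 : phi (tau 0) = 1%:M.
  have u0 := isometry_unit F (phiQ _ (tauB 0)).
  by rewrite -[LHS](mulKmx u0) -phi_tauD addr0 mulVmx.
have phi_tauN u : phi (tau (- u)) = invmx (phi (tau u)).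
  have uu := isometry_unit F (phiQ _ (tauB u)).
  by rewrite -[LHS](mulKmx uu) -phi_tauD subrr phi_tau0 mulmx1.
have LD u v : L u -> L v -> L (u + v) by rewrite /L phi_tauD; exact: DM.
have L0 : L 0 by rewrite /L phi_tau0.
have LN u : L u -> L (- u) by rewrite /L phi_tauN; exact: DV.
have LZ u (z : int) : L u -> L (z *: u).
  move=> Lu; rewrite -(intz z) scaler_int.
  have Ln k : L (u *+ k) by elim: k => [|k IH]; rewrite ?mulr0n // mulrS; exact: LD.
  by case: z => k; rewrite ?NegzE ?mulrNz -?pmulrn; [|apply: LN].
have powphi u k : phi (tau u) ^+ k = phi (tau (u *+ k)).
  by elim: k => [|k IH]; rewrite ?expr0 ?mulr0n ?phi_tau0 // exprS mulrS phi_tauD IH.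
have [K K0 KL] : exists2 K : 'I_n -> nat, (forall i, 0 < K i)%N & forall i, L (delta_mx i 0 *+ K i).
  have ex i : exists k, (0 < k)%N /\ L (delta_mx i 0 *+ k).
    have [k k0 kD] := finite_index_power Ggr Dgr fin (phiN _ (tauB (delta_mx i 0))).
    by exists k; split => //; rewrite /L -powphi.
  by have [K KP] := choice ex; exists K => i; case: (KP i).
pose k0 := (\prod_i K i)%N.
have k0_gt0 : (0 < k0)%N by apply: prodn_gt0.
have Lk u : L (u *+ k0).
  have -> : u *+ k0 = \sum_i ((u i 0 * (\prod_(j | j != i) K j)%N%:R) *: (delta_mx i 0 *+ K i)).
    apply/colP => i; rewrite summxE (bigD1 i) //= [X in _ + X]big1 => [|j ji].
      rewrite addr0 !mxE !mulmxnE !mxE !eqxx /k0 (bigD1 i) //=.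
      rewrite -[LHS]mulr_natr natrM -[1 *+ K i]/((K i)%:R).
      by rewrite mulrA mulrAC.
    by rewrite mxE mulmxnE mxE eq_sym (negPf ji) mul0rn mulr0.
  by elim/big_rec: _ => // i x _ Lx; apply: LD => //; exact: LZ.
pose psi u := phi (tau (u *+ k0)).
have psi_inj : injective psi.
  move=> u v /phiinj => /(_ (tauB _) (tauB _)) /tauinj uv.
  apply/colP => i; have := congr1 (fun w : 'cV[int]_n => w i 0) uv.
  rewrite !mulmxnE -[_ *+ k0]mulr_natr -[RHS]mulr_natr => /mulIf; apply.
  by rewrite pnatr_eq0 -lt0n.
have psiQ u : (psi u)^T *m Q *m psi u = Q by exact: phiQ.
rewrite qN in sQ psiQ phiQ.
have [|||G' [G'T G'0 G'q G'A]] := lattice_form (psi := psi) n1 sQ _ psiQ.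
- by move=> u v; rewrite /psi mulrnDl phi_tauD.
- move=> C; have finG := isometry_group_finite F GO Ggr Gd C.
  apply: sub_finite_set (finite_preimage (in2W psi_inj) finG) => u uC; split => //.
  exact: phiN.
- by move=> u; have [_ [a _ aE]] := DO _ (Lk u); exists a.
exists G'; split => // A k g kk Ak Bg gA; apply: (G'A A k (phi g)) => //; first exact: phiQ.
have AM u : A *m (u *+ k0) = (A *m u) *+ k0 by exact: (raddfMn (mulmx A)).
by move=> u; rewrite /psi -phiD // gA phiD // AM.
Qed.

(** * Skew-symmetric determinants *)

Lemma det2 (K : comNzRingType) (A : 'M[K]_2) : \det A = A 0 0 * A 1 1 - A 0 1 * A 1 0.
Proof.
rewrite (expand_det_row _ 0) !big_ord_recl big_ord0 /cofactor !det_mx11 !mxE /= addr0.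
have -> : lift 0 (0 : 'I_1) = 1 :> 'I_2 by apply/val_inj.
have -> : lift 1 (0 : 'I_1) = 0 :> 'I_2 by apply/val_inj.
by rewrite expr0 expr1; ring.
Qed.

Lemma det_schur (K : fieldType) m n (a : 'M[K]_m) (b : 'M[K]_(m, n)) (c : 'M[K]_(n, m))
    (d : 'M[K]_n) : a \in unitmx ->
  \det (block_mx a b c d) = \det a * \det (d - c *m invmx a *m b).
Proof.
move=> au; have -> : block_mx a b c d =
    block_mx 1%:M 0 (c *m invmx a) 1%:M *m block_mx a b 0 (d - c *m invmx a *m b).
  rewrite mulmx_block !mul1mx !mul0mx !addr0 mulmxKV //.
  by rewrite [c *m _ *m b + _]addrC subrK.
by rewrite det_mulmx det_lblock det_ublock !det1 !mul1r.
Qed.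

(** The square root is the Pfaffian, computed by splitting off a hyperbolic
    plane. *)
Lemma det_skew_square (K : fieldType) n (M : 'M[K]_n) :
  2%:R != 0 :> K -> M^T = - M -> exists r, \det M = r ^+ 2.
Proof.
move=> char2; have diag0 k (A : 'M[K]_k) i : A^T = - A -> A i i = 0.
  move=> /matrixP/(_ i i); rewrite !mxE => /eqP; rewrite -addr_eq0 -mulr2n -mulr_natl.
  by rewrite mulf_eq0 (negPf char2) => /eqP.
have [k] := ubnP n; elim: k n M => // k IH [|n] M nk MT.
  by exists 1; rewrite det_mx00 expr1n.
have [row0|/eqP/rV0Pn[j Mj]] := pselect (row 0 M = 0).
  exists 0; rewrite expr0n /= (expand_det_row _ 0) big1 // => j _.
  by move/rowP: row0 => /(_ j); rewrite !mxE => ->; rewrite mul0r.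
rewrite mxE in Mj.
have j0 : j != 0 by apply: contraNneq Mj => ->; rewrite diag0.
case: n => [|n] in M nk MT j Mj j0 *; first by rewrite (ord1 j) in j0.
pose s := tperm (1 : 'I_n.+2) j.
pose M' : 'M[K]_(2 + n) := perm_mx s *m M *m (perm_mx s)^T.
have M'T : M'^T = - M' by rewrite /M' !trmx_mul trmxK MT mulmxA mulmxN mulNmx.
have detM : \det M = \det M'.
  by rewrite /M' !det_mulmx det_tr mulrAC det_perm -signr_addb addbb mul1r.
have M'01 : M' 0 1 = M 0 j.
  rewrite /M' tr_perm_mx -row_permE -col_permE !mxE.
  have -> : s 0 = 0 by rewrite tpermD // eq_sym.
  by rewrite tpermL.
have M'E := submxK M'; set a := ulsubmx M' in M'E; set b := ursubmx M' in M'E.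
set c := dlsubmx M' in M'E; set d := drsubmx M' in M'E.
have := M'T; rewrite -M'E tr_block_mx opp_block_mx => /eq_block_mx[aT bT cT dT].
have a01 : a 0 1 = M 0 j.
  by rewrite -M'01 /a /ulsubmx [LHS]mxE [LHS]mxE; congr (fun_of_matrix M' _ _); apply/val_inj.
have deta : \det a = M 0 j ^+ 2.
  rewrite det2 !diag0 // mul0r sub0r; have := congr1 (fun A : 'M[K]_2 => A 0 1) aT.
  by rewrite [in X in X -> _]mxE [X in _ = X -> _]mxE => ->; rewrite a01 mulrN opprK expr2.
have au : a \in unitmx by rewrite unitmxE deta unitfE expf_neq0.
have [||r rE] := IH n (d - c *m invmx a *m b) _ _; first by lia.
  have aiT : (invmx a)^T = - invmx a.
    have : (invmx a)^T *m a^T = 1%:M by rewrite -trmx_mul mulmxV // trmx1.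
    rewrite aT mulmxN => /(congr1 (mulmx^~ (invmx a))) /=.
    by rewrite mulNmx mulmxK // mul1mx => /eqP; rewrite eqr_oppLR => /eqP.
  rewrite linearB /= !trmx_mul aiT dT bT cT.
  by rewrite !(mulNmx, mulmxN) !opprK opprD opprK mulmxA.
by exists (M 0 j * r); rewrite detM -M'E det_schur // deta rE exprMn.
Qed.

Lemma det_1_add_mul (K : comNzRingType) n (u : 'cV[K]_n) (v : 'rV[K]_n) :
  \det (1%:M + u *m v) = 1 + (v *m u) 0 0.
Proof.
have E1 : block_mx 1%:M (- u) v 1%:M =
    block_mx 1%:M 0 v 1%:M *m block_mx 1%:M (- u) 0 (1%:M + v *m u).
  rewrite mulmx_block !mul1mx !mulmx1 !mul0mx !addr0 mulmxN.
  by rewrite addrC addrK.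
have E2 : block_mx 1%:M (- u) v 1%:M =
    block_mx 1%:M (- u) 0 1%:M *m block_mx (1%:M + u *m v) 0 v 1%:M.
  rewrite mulmx_block !mul1mx !mulmx1 !mul0mx !add0r mulNmx.
  by rewrite addrK.
have := congr1 determinant E1; rewrite {1}E2 !det_mulmx !det_lblock !det_ublock !det1 !mul1r mulr1.
by move=> ->; rewrite det_mx11 !mxE eqxx.
Qed.

(** * Cyclic rotations of a root lattice *)

Section CyclicBlock.
Variable k : nat.
Hypothesis k_gt0 : (0 < k)%N.
Let Z := 'I_k.+1.

(** The lattice A_k of vectors of sum zero in Z^(k+1), in the basis given by the
    last k coordinates, carries an action of Z/(k+1) by cyclic rotations. Over Q
    it is the cyclotomic field when k+1 is prime. *)
Definition rotation (j : Z) : 'M[int]_k.+1 := \matrix_(a, b) (a == b + j :> Z)%:R.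
Definition zero_sum_incl : 'M[int]_(k.+1, k) :=
  \matrix_(a, i) (if a == ord0 then -1 else (a == lift ord0 i)%:R).
Definition zero_sum_proj : 'M[int]_(k, k.+1) := \matrix_(i, a) (a == lift ord0 i)%:R.
Definition cyclic_block (j : Z) : 'M[int]_k := zero_sum_proj *m rotation j *m zero_sum_incl.
Definition cyclic_gram : 'M[int]_k := zero_sum_incl^T *m zero_sum_incl.
Let E := zero_sum_incl.
Let D := zero_sum_proj.
Let sum1 : 'rV[int]_k.+1 := const_mx 1.

Lemma rotation0 : rotation 0 = 1%:M.
Proof. by apply/matrixP => a b; rewrite !mxE addr0. Qed.

Lemma rotationM i j : rotation i *m rotation j = rotation (i + j).
Proof.
apply/matrixP => a b; rewrite !mxE (bigD1 (b + j : Z)) //= big1 => [|c cb].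
  by rewrite !mxE eqxx mulr1 addr0 -addrA (addrC j).
by rewrite !mxE (negPf cb) mulr0.
Qed.

Lemma rotationT j : (rotation j)^T = rotation (- j).
Proof.
apply/matrixP => a b; rewrite !mxE; congr (_%:R); congr nat_of_bool.
by apply/eqP/eqP => ->; rewrite ?addrK ?addrNK.
Qed.

Lemma sum1_rotation j : sum1 *m rotation j = sum1.
Proof.
apply/rowP => b; rewrite !mxE (bigD1 (b + j : Z)) //= big1 => [|a ab].
  by rewrite !mxE eqxx mulr1 addr0.
by rewrite !mxE (negPf ab) mulr0.
Qed.

Lemma sum1_incl : sum1 *m E = 0.
Proof.
apply/rowP => i; rewrite !mxE big_ord_recl !mxE eqxx mul1r (bigD1 i) //= big1 => [|j ji].
  by rewrite !mxE /= eqxx mulr1 addr0 addNr.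
by rewrite !mxE /= (inj_eq (lift_inj (h := ord0))) (negPf ji) mulr0.
Qed.

Lemma proj_incl : D *m E = 1%:M.
Proof.
apply/matrixP => i j; rewrite !mxE (bigD1 (lift ord0 i)) //= big1 => [|a ai].
  by rewrite !mxE eqxx /= mul1r addr0 (inj_eq (lift_inj (h := ord0))).
by rewrite !mxE (negPf ai) mul0r.
Qed.

Lemma incl_proj m (Y : 'M[int]_(k.+1, m)) : sum1 *m Y = 0 -> E *m (D *m Y) = Y.
Proof.
move=> sY; have DY i b : (D *m Y) i b = Y (lift ord0 i) b.
  rewrite !mxE (bigD1 (lift ord0 i)) //= big1 => [|a ai].
    by rewrite !mxE eqxx mul1r addr0.
  by rewrite !mxE (negPf ai) mul0r.
apply/matrixP => a b; rewrite mxE.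
under eq_bigr => i _ do rewrite DY.
have [->|] := eqVneq a ord0.
  have /matrixP/(_ 0 b) := sY; rewrite !mxE big_ord_recl !mxE mul1r => /eqP.
  rewrite addr_eq0 => /eqP ->; rewrite -sumrN; apply: eq_bigr => i _.
  by rewrite !mxE eqxx mulN1r mul1r.
case: (unliftP ord0 a) => [i ->|-> /eqP //] _.
rewrite (bigD1 i) //= big1 => [|j ji]; first by rewrite !mxE /= eqxx mul1r addr0.
by rewrite !mxE /= (inj_eq (lift_inj (h := ord0))) eq_sym (negPf ji) mul0r.
Qed.

Lemma incl_block j : E *m cyclic_block j = rotation j *m E.
Proof.
rewrite /cyclic_block -mulmxA incl_proj // mulmxA sum1_rotation; exact: sum1_incl.
Qed.

Lemma cyclic_block0 : cyclic_block 0 = 1%:M.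
Proof. by rewrite /cyclic_block rotation0 mulmx1 proj_incl. Qed.

Lemma cyclic_blockM i j : cyclic_block i *m cyclic_block j = cyclic_block (i + j).
Proof.
rewrite {1}/cyclic_block -!mulmxA incl_block (mulmxA (rotation i)) rotationM.
by rewrite /cyclic_block mulmxA.
Qed.

Lemma cyclic_gramP j : (cyclic_block j)^T *m cyclic_gram *m cyclic_block j = cyclic_gram.
Proof.
have gramE (X : 'M[int]_k) : X^T *m cyclic_gram *m X = (E *m X)^T *m (E *m X).
  by rewrite /cyclic_gram trmx_mul !mulmxA.
rewrite gramE incl_block trmx_mul rotationT -!mulmxA (mulmxA (rotation (- j))).
by rewrite rotationM addNr rotation0 mul1mx.
Qed.

Lemma cyclic_block_sum : \sum_j cyclic_block j = 0.
Proof.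
rewrite -mulmx_suml -mulmx_sumr.
have -> : \sum_j rotation j = (const_mx 1 : 'cV[int]_k.+1) *m sum1.
  apply/matrixP => a b; rewrite summxE !mxE big_ord1 !mxE mulr1.
  rewrite (bigD1 (a - b : Z)) //= big1 => [|j jab].
    by rewrite !mxE [b + _]addrC subrK eqxx addr0.
  rewrite !mxE; case: eqP => // ab; by case/eqP: jab; rewrite ab addrAC subrr add0r.
by rewrite -!mulmxA sum1_incl !mulmx0.
Qed.

Lemma cyclic_gramE : cyclic_gram = 1%:M + const_mx 1.
Proof.
apply/matrixP => i j; rewrite !mxE big_ord_recl !mxE /= mulrNN mulr1 addrC; congr (_ + _).
rewrite (bigD1 i) //= big1 => [|a ai].
  by rewrite !mxE /= eqxx mul1r addr0 (inj_eq (lift_inj (h := ord0))).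
by rewrite !mxE /= (inj_eq (lift_inj (h := ord0))) (negPf ai) mul0r.
Qed.

Lemma cyclic_gram_det : \det cyclic_gram = k.+1%:R.
Proof.
have -> : cyclic_gram = 1%:M + (const_mx 1 : 'cV[int]_k) *m (const_mx 1 : 'rV[int]_k).
  rewrite cyclic_gramE; congr (_ + _); apply/matrixP => i j.
  by rewrite !mxE big_ord1 !mxE mulr1.
rewrite det_1_add_mul !mxE (eq_bigr (fun=> 1)) => [|i _]; last by rewrite !mxE mulr1.
by rewrite sumr_const card_ord -[1 *+ k]/(k%:R) -natr1 addrC.
Qed.

(** The class of sum_a a x_a modulo k+1 does not change under rotation, as the
    x_a have sum zero. Hence the residues of translation parts add up under
    composition of affine maps. *)
Definition residue (x : 'cV[int]_k) : Z := \sum_a ((a : Z) *~ (E *m x) a 0).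

Lemma residueD x y : residue (x + y) = residue x + residue y.
Proof.
by rewrite /residue mulmxDr -big_split /=; apply: eq_bigr => a _; rewrite !mxE mulrzDr.
Qed.

Lemma residueZ x z : residue (z *: x) = residue x *~ z.
Proof.
rewrite /residue -scalemxAr mulrz_suml; apply: eq_bigr => a _.
by rewrite mxE mulrC mulrzA.
Qed.

Lemma residue_block j x : residue (cyclic_block j *m x) = residue x.
Proof.
rewrite /residue mulmxA incl_block -mulmxA; set Y := E *m x.
have sY : \sum_a Y a 0 = 0.
  transitivity ((sum1 *m Y) 0 0); last by rewrite mulmxA sum1_incl mul0mx mxE.
  by rewrite [RHS]mxE; apply: eq_bigr => a _; rewrite [sum1 _ _]mxE mul1r.
have RY a : (rotation j *m Y) a 0 = Y (a - j : Z) 0.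
  rewrite mxE (bigD1 (a - j : Z)) //= big1 => [|b bj].
    by rewrite mxE subrK eqxx mul1r addr0.
  rewrite mxE; case: eqP => [ab|]; last by rewrite mul0r.
  by case/eqP: bj; rewrite ab addrK.
under eq_bigr => a _ do rewrite RY.
rewrite (reindex_inj (addIr (j : Z))) /=.
under eq_bigr => a _ do rewrite addrK mulrzDl.
by rewrite big_split /= -mulrz_sumr sY mulr0z addr0.
Qed.

Lemma residue_surj z : exists x, residue x = (inZp 1 : Z) *~ z.
Proof.
pose i0 := Ordinal k_gt0.
exists (z *: delta_mx i0 0); rewrite residueZ; congr (_ *~ _).
have Ee a : (E *m delta_mx i0 0) a (0 : 'I_1) = if a == ord0 then -1 else (a == lift ord0 i0)%:R.
  by rewrite -colE !mxE.
rewrite /residue (bigD1 (lift ord0 i0)) //= (bigD1 ord0) //= big1 => [|a /andP[a1 a0]].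
  rewrite !Ee !eqxx /= mulr1z.
  have -> : (ord0 : Z) *~ -1 = 0 by rewrite -[ord0 : Z]/(0 : Z) mul0rz.
  by rewrite !addr0; apply/val_inj => /=; rewrite modn_small //; lia.
by rewrite Ee (negPf a0) (negPf a1) mulr0z.
Qed.

Lemma residue_multiple x : residue (k.+1%:R *: x) = 0.
Proof.
rewrite residueZ natz -pmulrn; apply/val_inj; rewrite Zp_mulrn /=.
by rewrite modnMl.
Qed.

End CyclicBlock.

(** * Affine actions on sums of root lattices *)

(** The component (k, (l, l')) stands for the lattice A_k, on which h in Z^2
    acts by the rotation by the class of l.h modulo k+1, followed by a
    translation of residue l'.h. *)
Definition component : Type := nat * ((int * int) * (int * int)).
Definition weight (l h : int * int) : int := l.1 * h.1 + l.2 * h.2.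
Definition residue_class k (z : int) : 'I_k.+1 := (inZp 1 : 'I_k.+1) *~ z.
Definition rot (c : component) h := residue_class c.1 (weight c.2.1 h).
Definition shift (c : component) h := residue_class c.1 (weight c.2.2 h).

Fixpoint dim (s : seq component) : nat := if s is c :: s' then (c.1 + dim s')%N else 0%N.

Fixpoint holonomy (s : seq component) h : 'M[int]_(dim s) :=
  if s is c :: s' then block_mx (cyclic_block (rot c h)) 0 0 (holonomy s' h) else 1%:M.

Fixpoint translations (s : seq component) h : set 'cV[int]_(dim s) :=
  if s is c :: s' then
    [set t : 'cV[int]_(c.1 + dim s') | residue (usubmx t) = shift c h /\ translations h (dsubmx t)]
  else setT.

Fixpoint gram (s : seq component) : 'M[int]_(dim s) :=
  if s is c :: s' then block_mx (cyclic_gram c.1) 0 0 (gram s') else 1%:M.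

Lemma weightD l h h' : weight l (h + h') = weight l h + weight l h'.
Proof. rewrite /weight /=; ring. Qed.

Lemma weightMn l h n : weight l (h *+ n) = weight l h * n%:R.
Proof.
elim: n => [|n IH]; first by rewrite mulr0n mulr0 /weight !mulr0 addr0.
by rewrite mulrS weightD IH -natr1; ring.
Qed.

Lemma residue_classD k z z' : residue_class k (z + z') = residue_class k z + residue_class k z'.
Proof. exact: mulrzDr. Qed.

Lemma residue_class_eq0 k z : (residue_class k z == 0) = (k.+1%:Z %| z)%Z.
Proof.
have pos n : (inZp 1 : 'I_k.+1) *+ n = inZp n.
  by apply/val_inj; rewrite Zp_mulrn /= modnMml mul1n.
rewrite dvdzE /=; case: z => n; rewrite /residue_class ?NegzE ?mulrNz -pmulrn pos ?oppr_eq0;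
  by rewrite -val_eqE.
Qed.

Lemma rotD c h h' : rot c (h + h') = rot c h + rot c h'.
Proof. by rewrite /rot weightD residue_classD. Qed.

Lemma rot0 c : rot c 0 = 0.
Proof. by rewrite /rot /weight !mulr0 addr0. Qed.

Lemma shiftD c h h' : shift c (h + h') = shift c h + shift c h'.
Proof. by rewrite /shift weightD residue_classD. Qed.

Lemma shift0 c : shift c 0 = 0.
Proof. by rewrite /shift /weight !mulr0 addr0. Qed.

Lemma shiftN c h : shift c (- h) = - shift c h.
Proof. by apply/eqP; rewrite -addr_eq0 -shiftD addNr shift0. Qed.

Lemma holonomy_trivial s h : (forall c, c \in s -> rot c h = 0) -> holonomy s h = 1%:M.
Proof.
elim: s => [//|c s IH] rot_h /=.
rewrite IH => [|c' c's]; last by rewrite rot_h // inE c's orbT.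
by rewrite rot_h ?mem_head // cyclic_block0 -scalar_mx_block.
Qed.

Lemma holonomyD s h h' : holonomy s (h + h') = holonomy s h *m holonomy s h'.
Proof.
elim: s => [|c s IH] /=; first by rewrite mulmx1.
by rewrite mulmx_block !mulmx0 !mul0mx !addr0 add0r cyclic_blockM rotD IH.
Qed.

Lemma holonomy0 s : holonomy s 0 = 1%:M.
Proof. by apply: holonomy_trivial => c _; exact: rot0. Qed.

Lemma holonomyX s h n : holonomy s h ^+ n = holonomy s (h *+ n).
Proof.
elim: n => [|n IH]; first by rewrite expr0 mulr0n holonomy0.
by rewrite exprS IH mulrS holonomyD.
Qed.

Lemma holonomy_gram s h : (holonomy s h)^T *m gram s *m holonomy s h = gram s.
Proof.
elim: s => [|c s IH] /=; first by rewrite trmx1 !mulmx1.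
rewrite tr_block_mx !trmx0 !(mulmx_block, mulmx0, mul0mx, addr0, add0r).
by rewrite cyclic_gramP IH.
Qed.

Lemma gram_det s : \det (gram s) = \prod_(c <- s) c.1.+1%:R.
Proof.
elim: s => [|c s IH] /=; first by rewrite det1 big_nil.
by rewrite det_ublock cyclic_gram_det IH big_cons.
Qed.

Lemma block_diag_act (K : pzRingType) m1 m2 (A : 'M[K]_m1) (B : 'M[K]_m2) (t : 'cV[K]_(m1 + m2)) :
  block_mx A 0 0 B *m t = col_mx (A *m usubmx t) (B *m dsubmx t).
Proof. by rewrite -{1}(vsubmxK t) mul_block_col !mul0mx addr0 add0r. Qed.

Lemma translationsD s h h' t t' : translations h t -> translations h' t' ->
  @translations s (h + h') (t + holonomy s h *m t').
Proof.
elim: s t t' => [//|c s IH] t t' /= [rt tt] [rt' tt'].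
rewrite block_diag_act !linearD /= col_mxKu col_mxKd.
split; last exact: IH.
by rewrite residueD residue_block rt rt' shiftD.
Qed.

Lemma translationsV s h t : translations h t ->
  @translations s (- h) (- (holonomy s (- h) *m t)).
Proof.
elim: s t => [//|c s IH] t /= [rt tt].
rewrite block_diag_act opp_col_mx col_mxKu col_mxKd.
split; last exact: IH.
rewrite -scaleN1r residueZ residue_block rt.
by rewrite shiftN mulrNz.
Qed.

Lemma translations_nonempty s h : (forall c, c \in s -> (0 < c.1)%N) ->
  exists t, @translations s h t.
Proof.
elim: s => [|c s IH] pos; first by exists 0.
have [t tt] := IH (fun c' c's => pos c' (mem_behead (s := c :: s) c's)).
have [x xE] := residue_surj (pos c (mem_head _ _)) (weight c.2.2 h).
by exists (col_mx x t) => /=; rewrite col_mxKu col_mxKd.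
Qed.

Lemma translations_multiple s N u : (forall c, c \in s -> (c.1.+1 %| N)%N) ->
  @translations s 0 (N%:R *: u).
Proof.
elim: s u => [//|c s IH] u dvdN /=; split; last first.
  by rewrite linearZ /=; apply: IH => c' c's; rewrite dvdN // inE c's orbT.
have /dvdnP[m ->] := dvdN c (mem_head _ _).
by rewrite linearZ /= natrM mulrC -scalerA residue_multiple shift0.
Qed.

(** The translation part of the n-th power of x |-> A x + t. *)
Fixpoint orbit_sum (K : pzRingType) m (A : 'M[K]_m) (t : 'cV[K]_m) n : 'cV[K]_m :=
  if n is n'.+1 then t + A *m orbit_sum A t n' else 0.

Lemma orbit_sum1 (K : pzRingType) m (t : 'cV[K]_m) n : orbit_sum 1%:M t n = t *+ n.
Proof. by elim: n => [|n IH] //=; rewrite IH mul1mx mulrS. Qed.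

Lemma mx_mulrn_eq0 m (t : 'cV[int]_m) n : (0 < n)%N -> t *+ n = 0 -> t = 0.
Proof.
move=> n0 tn; apply/colP => i; have := congr1 (fun w : 'cV[int]_m => w i 0) tn.
rewrite mulmxnE !mxE => /eqP; rewrite mulrn_eq0 => /orP[/eqP n00|/eqP //].
by rewrite n00 in n0.
Qed.

Lemma orbit_sum_block m1 m2 (A : 'M[int]_m1) (B : 'M[int]_m2) (t : 'cV[int]_(m1 + m2)) n :
  orbit_sum (block_mx A 0 0 B) t n =
  col_mx (orbit_sum A (usubmx t) n) (orbit_sum B (dsubmx t) n).
Proof.
elim: n => [|n IH] /=; first by rewrite col_mx0.
by rewrite IH block_diag_act col_mxKu col_mxKd -{1}(vsubmxK t) add_col_mx.
Qed.

(** On a component that h does not rotate the affine map is a translation, which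
    is trivial if it has finite order. *)
Lemma orbit_sum_torsion s h t n : (0 < n)%N -> translations h t ->
  orbit_sum (holonomy s h) t n = 0 ->
  forall c, c \in s -> rot c h = 0 -> shift c h = 0.
Proof.
move=> n0; elim: s t => [//|c s IH] t /= [rt tt].
rewrite orbit_sum_block -[0 in X in X -> _]col_mx0 => /eq_col_mx[E1 E2] c' + rc'.
rewrite inE => /orP[/eqP cc'|c's]; last exact: (IH _ tt E2).
rewrite cc' in rc' *; move: E1; rewrite rc' cyclic_block0 orbit_sum1 => /(mx_mulrn_eq0 n0) t0.
by rewrite -rt t0 -(scale0r 0) residueZ mulr0z.
Qed.

(** * Invariant forms on sums of root lattices *)

Lemma residue_class_nat k n : residue_class k n%:Z = inZp n.
Proof. by apply/val_inj; rewrite /residue_class -pmulrn Zp_mulrn /= modnMml mul1n. Qed.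

Section Bezout.
Variable k : nat.
Let p := k.+2.
Let C (z : int) := cyclic_block (residue_class k.+1 z) : 'M[int]_k.+1.
Let c := C 1.

Lemma cyclic_blockX n : cyclic_block (inZp n : 'I_p) = c ^+ n.
Proof.
rewrite -residue_class_nat; elim: n => [|n IH].
  by rewrite residue_class_nat (_ : inZp 0 = 0 :> 'I_p) ?cyclic_block0 ?expr0 //; apply/val_inj; rewrite /= mod0n.
by rewrite exprS -IH /c /C -mulmxE cyclic_blockM -residue_classD.
Qed.

Lemma cyclic_block_poly (z : int) n : (p%:Z %| z - n%:Z)%Z -> C z = horner_mx c 'X^n.
Proof.
move=> pz; rewrite rmorphXn /= horner_mx_X -cyclic_blockX -residue_class_nat /C.
congr cyclic_block; rewrite -[z](subrK n%:Z) residue_classD.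
have /eqP -> : residue_class k.+1 (z - n%:Z) == 0 by rewrite residue_class_eq0.
by rewrite add0r.
Qed.

Lemma cyclotomic_root : horner_mx c (\sum_(i < p) 'X^i) = 0.
Proof.
rewrite -[RHS](cyclic_block_sum k.+1) rmorph_sum /=; apply: eq_bigr => i _.
by rewrite rmorphXn /= horner_mx_X -cyclic_blockX; congr cyclic_block; rewrite valZpK.
Qed.

(** The block c is a root of 1 + X + ... + X^(p-1), so the relation makes F(c)
    G(c) the scalar matrix N. *)
Lemma bezout_det (F G H : {poly int}) (N : int) : N != 0 ->
  F * G = N%:P + H * \sum_(i < p) 'X^i -> \det (horner_mx c F) != 0.
Proof.
move=> N0 FG; apply: contraNneq N0 => dF.
have := congr1 (fun f => \det (horner_mx c f)) FG.
rewrite rmorphM /= -mulmxE det_mulmx dF mul0r rmorphD rmorphM /= cyclotomic_root mulr0 addr0.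
by rewrite horner_mx_C det_scalar => /esym/eqP; rewrite expf_eq0 => /andP[].
Qed.

End Bezout.

(** The component at c of the element (1,0) - (-1,0) + 3 (0,1) - 3 (0,-1) of the
    integral group ring of Z^2, which the involution h |-> -h changes into its
    opposite. With the coefficient 3 it vanishes under no character of the
    components below; with 1 it would vanish at (1,-1). *)
Definition skew_block (c : component) : 'M[int]_c.1 :=
  let C h := cyclic_block (rot c h) in
  C (1, 0) - C (-1, 0) + 3 *: (C (0, 1) - C (0, -1)).

(** The rotation characters are the points of the projective line over F_3, so
    that each h is in the kernel of one of them modulo 3; the translation
    characters are chosen independent of them. *)
Definition components3 : seq component :=
  [:: (2%N, ((1, 0), (0, 1))); (2%N, ((0, 1), (1, 0)));
      (2%N, ((1, 1), (1, 0))); (2%N, ((1, -1), (1, 0)))].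

(** Likewise over F_5. *)
Definition components5 : seq component :=
  [:: (4%N, ((1, 0), (0, 1))); (4%N, ((0, 1), (1, 0))); (4%N, ((1, 1), (1, 0)));
      (4%N, ((2, 1), (1, 0))); (4%N, ((3, 1), (1, 0))); (4%N, ((4, 1), (1, 0)))].

Lemma skew_block_poly k l m (a a' b b' : nat) :
  (k.+2%:Z %| l.1 - a%:Z)%Z -> (k.+2%:Z %| - l.1 - a'%:Z)%Z ->
  (k.+2%:Z %| l.2 - b%:Z)%Z -> (k.+2%:Z %| - l.2 - b'%:Z)%Z ->
  skew_block (k.+1, (l, m)) =
  horner_mx (cyclic_block (residue_class k.+1 1)) ('X^a - 'X^a' + 3%:P * ('X^b - 'X^b')).
Proof.
move=> la la' lb lb'; rewrite rmorphD rmorphB rmorphM rmorphB /= horner_mx_C.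
rewrite -(cyclic_block_poly la) -(cyclic_block_poly la') -(cyclic_block_poly lb) -(cyclic_block_poly lb').
rewrite /skew_block /rot /weight /=; rewrite !mulr1 !mulr0 !addr0 !add0r !mulrN1 -mulmxE mul_scalar_mx.
by [].
Qed.

Lemma skew_block3 c : c \in components3 -> \det (skew_block c) != 0.
Proof.
rewrite !inE => /or4P[] /eqP ->.
- rewrite (@skew_block_poly 1 _ _ 1 2 0 0) //.
  apply: (@bezout_det 1 _ (- 1 - 2%:P * 'X) ((-3)%:P + 2%:P * 'X) 3) => //.
  by rewrite !big_ord_recl big_ord0 /=; ring.
- rewrite (@skew_block_poly 1 _ _ 0 0 1 2) //.
  apply: (@bezout_det 1 _ (- 1 - 2%:P * 'X) ((-9)%:P + 6%:P * 'X) 9) => //.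
  by rewrite !big_ord_recl big_ord0 /=; ring.
- rewrite (@skew_block_poly 1 _ _ 1 2 1 2) //.
  apply: (@bezout_det 1 _ (- 1 - 2%:P * 'X) ((-12)%:P + 8%:P * 'X) 12) => //.
  by rewrite !big_ord_recl big_ord0 /=; ring.
- rewrite (@skew_block_poly 1 _ _ 1 2 2 1) //.
  apply: (@bezout_det 1 _ (- 1 - 2%:P * 'X) (6%:P - 4%:P * 'X) (-6)) => //.
  by rewrite !big_ord_recl big_ord0 /=; ring.
Qed.

Lemma skew_block5 c : c \in components5 -> \det (skew_block c) != 0.
Proof.
(* The relations come from the Euclidean algorithm over the rationals, after
   clearing denominators. *)
pose G : {poly int} := - 2%:P - 4%:P * 'X - 'X^2 - 3%:P * 'X^3.
rewrite !inE => /or3P[/eqP ->|/eqP ->|/or4P[] /eqP ->].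
- rewrite (@skew_block_poly 3 _ _ 1 4 0 0) //.
  apply: (@bezout_det 3 _ G (- 5%:P + 3%:P * 'X - 2%:P * 'X^2 + 3%:P * 'X^3) 5) => //.
  by rewrite /G !big_ord_recl big_ord0 /=; ring.
- rewrite (@skew_block_poly 3 _ _ 0 0 1 4) //.
  apply: (@bezout_det 3 _ G (- 15%:P + 9%:P * 'X - 6%:P * 'X^2 + 9%:P * 'X^3) 15) => //.
  by rewrite /G !big_ord_recl big_ord0 /=; ring.
- rewrite (@skew_block_poly 3 _ _ 1 4 1 4) //.
  apply: (@bezout_det 3 _ G (- 20%:P + 12%:P * 'X - 8%:P * 'X^2 + 12%:P * 'X^3) 20) => //.
  by rewrite /G !big_ord_recl big_ord0 /=; ring.
- rewrite (@skew_block_poly 3 _ _ 2 3 1 4) //.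
  apply: (@bezout_det 3 _ (- 5%:P - 10%:P * 'X - 10%:P * 'X^3)
    (- 25%:P + 10%:P * 'X - 20%:P * 'X^2 + 30%:P * 'X^3) 25) => //.
  by rewrite !big_ord_recl big_ord0 /=; ring.
- rewrite (@skew_block_poly 3 _ _ 3 2 1 4) //.
  apply: (@bezout_det 3 _ (- 7%:P - 14%:P * 'X - 6%:P * 'X^2 - 8%:P * 'X^3)
    (- 55%:P + 34%:P * 'X - 14%:P * 'X^2 + 24%:P * 'X^3) 55) => //.
  by rewrite !big_ord_recl big_ord0 /=; ring.
- rewrite (@skew_block_poly 3 _ _ 4 1 1 4) //.
  apply: (@bezout_det 3 _ G (- 10%:P + 6%:P * 'X - 4%:P * 'X^2 + 6%:P * 'X^3) 10) => //.
  by rewrite /G !big_ord_recl big_ord0 /=; ring.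
Qed.

Definition skew_element s : 'M[int]_(dim s) :=
  holonomy s (1, 0) - holonomy s (-1, 0) + 3 *: (holonomy s (0, 1) - holonomy s (0, -1)).

Lemma skew_element_det s : (forall c, c \in s -> \det (skew_block c) != 0) ->
  \det (skew_element s) != 0.
Proof.
elim: s => [|c s IH] nz; first by rewrite det_mx00 oner_eq0.
have -> : skew_element (c :: s) = block_mx (skew_block c) 0 0 (skew_element s).
  rewrite /skew_element /= !opp_block_mx !add_block_mx scale_block_mx add_block_mx.
  by rewrite !(oppr0, addr0, scaler0).
rewrite det_ublock mulf_neq0 // ?nz ?mem_head // IH // => c' c's.
by rewrite nz // inE c's orbT.
Qed.

(** The skew element x of the group ring is anti-self-adjoint for every
    invariant form K, so K x is skew-symmetric and det K det x is a square.
    Hence any two invariant forms, among them the Gram matrix, have the same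
    determinant up to squares. *)
Lemma invariant_form_det s (G : 'M[rat]_(dim s)) :
  (forall c, c \in s -> \det (skew_block c) != 0) -> G^T = G ->
  (forall h, (map_mx intr (holonomy s h))^T *m G *m map_mx intr (holonomy s h) = G) ->
  exists r, \det G * \prod_(c <- s) c.1.+1%:R = r ^+ 2.
Proof.
move=> /skew_element_det x0.
have skew (K : 'M[rat]_(dim s)) : K^T = K ->
    (forall h, (map_mx intr (holonomy s h))^T *m K *m map_mx intr (holonomy s h) = K) ->
    exists r, \det K * \det (map_mx intr (skew_element s)) = r ^+ 2.
  move=> KT Kinv; rewrite -det_mulmx; apply: det_skew_square => //.
  pose A h : 'M[rat]_(dim s) := map_mx intr (holonomy s h).
  have AT h : (A h)^T *m K = K *m A (- h).
    rewrite -[K in RHS](Kinv h) -!mulmxA -map_mxM -holonomyD subrr holonomy0.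
    by rewrite map_mx1 mulmx1.
  have xE : map_mx intr (skew_element s) = A (1, 0) - A (- (1, 0)) + 3 *: (A (0, 1) - A (- (0, 1))).
    rewrite /skew_element map_mxD map_mxB map_mxZ map_mxB /A.
    by congr (_ - map_mx _ (holonomy _ (_, _)) + _ *: (_ - map_mx _ (holonomy _ (_, _)))); rewrite oppr0.
  rewrite trmx_mul KT xE.
  move: (AT (1, 0)) (AT (- (1, 0))) (AT (0, 1)) (AT (- (0, 1))); rewrite !opprK.
  move: (A (1, 0)) (A (- (1, 0))) (A (0, 1)) (A (- (0, 1))) => a a' b b' aT a'T bT b'T.
  have -> : (a - a' + 3 *: (b - b'))^T = a^T - a'^T + 3 *: (b^T - b'^T).
    by apply/matrixP => i j; rewrite !mxE.
  rewrite mulmxDl mulmxBl -scalemxAl mulmxBl aT a'T bT b'T.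
  rewrite mulmxDr mulmxBr -scalemxAr mulmxBr.
  by apply/matrixP => i j; rewrite !mxE; ring.
move=> GT Ginv.
have [r rE] := skew G GT Ginv.
have [r' r'E] : exists r, \prod_(c <- s) c.1.+1%:R * \det (map_mx intr (skew_element s) : 'M[rat]_(dim s)) = r ^+ 2.
  have gramT : (gram s)^T = gram s.
    elim: (s) => [|c s' IH] /=; first by rewrite trmx1.
    by rewrite tr_block_mx !trmx0 IH /cyclic_gram trmx_mul trmxK.
  have [|h|r' r'E] := skew (map_mx intr (gram s)).
  - by rewrite map_trmx gramT.
  - by rewrite map_trmx -!map_mxM holonomy_gram.
  exists r'; rewrite -r'E [\det (map_mx intr (gram s))]det_map_mx gram_det rmorph_prod; congr (_ * _).
  by apply: eq_bigr => c _; rewrite rmorph_nat.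
have d0 : \det (map_mx intr (skew_element s) : 'M[rat]_(dim s)) != 0.
  by rewrite det_map_mx intr_eq0.
exists (r * r' / \det (map_mx intr (skew_element s) : 'M[rat]_(dim s))).
by rewrite exprMn exprMn -rE -r'E; field.
Qed.

(** * Flat manifolds over sums of root lattices *)

Section RealRoot.
Variable R : realType.

(** 1 + a J is the positive square root of 1 + J, where J has all entries 1. *)
Definition cyclic_root k : 'M[R]_k :=
  1%:M + const_mx ((Num.sqrt k.+1%:R - 1) / k%:R).

Lemma cyclic_rootP k : (0 < k)%N ->
  (cyclic_root k)^T *m cyclic_root k = map_mx intr (cyclic_gram k).
Proof.
move=> k0; rewrite cyclic_gramE /cyclic_root; set a := _ / _.
have aE : a + a + k%:R * (a * a) = 1.
  have s2 : Num.sqrt (k.+1%:R : R) ^+ 2 = k%:R + 1 by rewrite sqr_sqrtr // natr1.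
  have kn0 : k%:R != 0 :> R by rewrite pnatr_eq0 -lt0n.
  have ka : k%:R * a = Num.sqrt k.+1%:R - 1 by rewrite /a mulrC divfK.
  apply: (mulfI kn0); rewrite mulr1.
  have -> : k%:R * (a + a + k%:R * (a * a)) = (k%:R * a) * (k%:R * a + 2) by ring.
  rewrite ka; move: s2; move: (Num.sqrt _) => r s2.
  have -> : (r - 1) * (r - 1 + 2) = r ^+ 2 - 1 by ring.
  by rewrite s2 addrK.
have -> : (1%:M + const_mx a : 'M[R]_k)^T = 1%:M + const_mx a.
  by apply/matrixP => i j; rewrite !mxE eq_sym.
rewrite mulmxDl mul1mx mulmxDr mulmx1.
have -> : (const_mx a : 'M[R]_k) *m (const_mx a : 'M[R]_k) = const_mx (k%:R * (a * a)).
  apply/matrixP => i j; rewrite !mxE (eq_bigr (fun=> a * a)) => [|l _]; last by rewrite !mxE.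
  by rewrite sumr_const card_ord -[LHS]mulr_natl.
apply/matrixP => i j; rewrite !mxE rmorphD /= rmorph_nat rmorph1.
by rewrite -addrA; congr (_ + _); rewrite addrA aE.
Qed.

Fixpoint real_root (s : seq component) : 'M[R]_(dim s) :=
  if s is c :: s' then block_mx (cyclic_root c.1) 0 0 (real_root s') else 1%:M.

Lemma real_rootP s : (forall c, c \in s -> (0 < c.1)%N) ->
  (real_root s)^T *m real_root s = map_mx intr (gram s).
Proof.
elim: s => [|c s IH] pos /=; first by rewrite trmx1 mulmx1 map_mx1.
rewrite tr_block_mx !trmx0 !(mulmx_block, mulmx0, mul0mx, addr0, add0r).
rewrite cyclic_rootP ?pos ?mem_head // IH => [|c' c's]; last by rewrite pos // inE c's orbT.
by rewrite map_block_mx !map_mx0.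
Qed.

Variable s : seq component.
Variable N : nat.
Hypothesis s_pos : forall c, c \in s -> (0 < c.1)%N.
Hypothesis N_gt0 : (0 < N)%N.
Hypothesis s_dvd : forall c, c \in s -> (c.1.+1 %| N)%N.
(* An h acting nontrivially translates some component that it does not rotate,
   and so has infinite order. *)
Hypothesis s_sep : forall h, (forall c, c \in s -> rot c h = 0 -> shift c h = 0) ->
  forall c, c \in s -> rot c h = 0.

Let S := real_root s.

Lemma real_root_unit : S \in unitmx.
Proof.
have := congr1 determinant (real_rootP s_pos); rewrite det_mulmx det_tr det_map_mx gram_det => E.
rewrite unitmxE unitfE; apply/eqP => S0; move: E; rewrite -/S S0 mul0r => /esym/eqP.
rewrite intr_eq0; apply/negP; rewrite prodf_seq_neq0.
by apply/allP => c _ /=; rewrite pnatr_eq0.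
Qed.

Let conj (A : 'M[int]_(dim s)) : 'M[R]_(dim s) := S *m map_mx intr A *m invmx S.
Let tr (t : 'cV[int]_(dim s)) : 'cV[R]_(dim s) := S *m map_mx intr t.

Let conjM A B : conj A *m conj B = conj (A *m B).
Proof. by rewrite /conj map_mxM !mulmxA mulmxKV // real_root_unit. Qed.

Let conj1 : conj 1%:M = 1%:M.
Proof. by rewrite /conj map_mx1 mulmx1 mulmxV // real_root_unit. Qed.

Let conj_tr A t : conj A *m tr t = tr (A *m t).
Proof. by rewrite /conj /tr mulmxA mulmxKV ?real_root_unit // -mulmxA -map_mxM. Qed.

(** The affine map x |-> A x + t in the coordinates of a real root S of the Gram
    matrix, in which the holonomy is orthogonal. *)
Definition affine_map (A : 'M[int]_(dim s)) (t : 'cV[int]_(dim s)) : 'M[R]_(dim s + 1) :=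
  block_mx (conj A) (tr t) 0 1%:M.

Lemma affine_mapM A t B u : affine_map A t *m affine_map B u = affine_map (A *m B) (t + A *m u).
Proof.
rewrite /affine_map mulmx_block !mulmx0 !mul0mx !mulmx1 !addr0 add0r conjM conj_tr.
by rewrite /tr map_mxD mulmxDr addrC.
Qed.

Lemma affine_map1 : affine_map 1%:M 0 = 1%:M.
Proof. by rewrite /affine_map conj1 /tr map_mx0 mulmx0 -scalar_mx_block. Qed.

Lemma affine_mapX A t n : affine_map A t ^+ n = affine_map (A ^+ n) (orbit_sum A t n).
Proof.
elim: n => [|n IH]; first by rewrite !expr0 affine_map1.
by rewrite !exprS IH -!mulmxE affine_mapM.
Qed.

Let int_close m n (A B : 'M[int]_(m, n)) :
  `|map_mx intr A - map_mx intr B : 'M[R]_(m, n)| < 1 -> A = B.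
Proof.
move=> AB; apply/matrixP => i j; apply/eqP; rewrite -subr_eq0 -(intr_eq0 R) -normr_le0.
have := le_lt_trans (mx_norm_entry _ i j) AB; rewrite !mxE -intrB -intr_norm.
by rewrite -[1]/(1%:~R) ltr_int => ?; rewrite lerz0; lia.
Qed.

(** Distinct integral matrices are at distance at least 1, and changing
    coordinates by S distorts distances by a bounded factor. *)
Lemma affine_map_separated : exists2 d, 0 < d &
  forall A t B u, `|affine_map A t - affine_map B u| < d -> A = B /\ t = u.
Proof.
pose n : R := (dim s)%:R.
pose c := n * (n * `|invmx S| ) * `|S| + n * `|invmx S| + 1.
have c0 : 0 < c by rewrite /c ltr_pwDr // addr_ge0 // !mulr_ge0.
exists c^-1; first by rewrite invr_gt0.
move=> A t B u; rewrite /affine_map opp_block_mx add_block_mx => d.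
have Su := real_root_unit.
have ul : `|conj A - conj B| < c^-1.
  apply: le_lt_trans d; apply: mx_norm_sub => i j.
  by exists (lshift 1 i), (lshift 1 j); rewrite block_mxEul.
have ur : `|tr t - tr u| < c^-1.
  apply: le_lt_trans d; apply: mx_norm_sub => i j.
  by exists (lshift 1 i), (rshift (dim s) j); rewrite block_mxEur.
split; apply: int_close.
  have -> : map_mx intr A - map_mx intr B = invmx S *m (conj A - conj B) *m S.
    by rewrite mulmxBr mulmxBl /conj !mulmxA mulVmx // !mul1mx !mulmxKV.
  apply: (@le_lt_trans _ _ (c * `|conj A - conj B|)); last by rewrite mulrC -ltr_pdivlMr // mul1r.
  apply: le_trans (mx_norm_mul _ _) _.
  apply: (@le_trans _ _ (n * (n * `|invmx S| * `|conj A - conj B|) * `|S|)).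
    by rewrite ler_wpM2r // ler_wpM2l // mx_norm_mul.
  have -> : n * (n * `|invmx S| * `|conj A - conj B|) * `|S| =
    n * (n * `|invmx S|) * `|S| * `|conj A - conj B| by ring.
  by rewrite ler_wpM2r // /c -addrA lerDl addr_ge0 // mulr_ge0.
have -> : map_mx intr t - map_mx intr u = invmx S *m (tr t - tr u).
  by rewrite mulmxBr /tr !mulKmx.
apply: (@le_lt_trans _ _ (c * `|tr t - tr u|)); last by rewrite mulrC -ltr_pdivlMr // mul1r.
apply: le_trans (mx_norm_mul _ _) _; rewrite ler_wpM2r // /c addrAC lerDr.
by rewrite addr_ge0 // !mulr_ge0.
Qed.

Definition component_group : set 'M[R]_(dim s + 1) :=
  [set g | exists h t, translations h t /\ g = affine_map (holonomy s h) t].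

Lemma component_group_affine h t : translations h t ->
  component_group (affine_map (holonomy s h) t).
Proof. by move=> ht; exists h, t. Qed.

Lemma component_isometry : component_group `<=` @euclidean_isometry R (dim s).
Proof.
move=> _ [h [t [_ ->]]]; exists (conj (holonomy s h)), (tr t); split => //.
have Su := real_root_unit; have SS := real_rootP s_pos.
have SA : S *m map_mx intr (holonomy s h) = conj (holonomy s h) *m S by rewrite /conj mulmxKV.
move: (conj (holonomy s h)) SA => M SA.
have : S^T *m (M^T *m M) *m S = S^T *m 1%:M *m S.
  transitivity ((M *m S)^T *m (M *m S)).
    by rewrite trmx_mul !mulmxA.
  rewrite -SA trmx_mul mulmx1 -mulmxA (mulmxA S^T) SS mulmxA.
  by rewrite map_trmx -!map_mxM holonomy_gram.
have STu : S^T \in unitmx by rewrite unitmx_tr.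
by move=> /(congr1 (mulmx^~ (invmx S))) /=; rewrite !mulmxK // => /(congr1 (mulmx (invmx S^T))); rewrite !mulKmx.
Qed.

Lemma component_group_group : group_of_matrices component_group.
Proof.
have inv h t : translations h t ->
    affine_map (holonomy s (- h)) (- (holonomy s (- h) *m t)) *m affine_map (holonomy s h) t = 1%:M.
  by move=> ht; rewrite affine_mapM -holonomyD addNr holonomy0 addNr affine_map1.
split.
- exists 0, 0; rewrite holonomy0 affine_map1; split => //.
  by have := translations_multiple 0 s_dvd; rewrite scaler0.
- by move=> _ [h [t [ht ->]]]; have /mulmx1_unit[] := inv h t ht.
- move=> _ _ [h [t [ht ->]]] [h' [t' [ht' ->]]]; rewrite affine_mapM -holonomyD.
  by exists (h + h'), (t + holonomy s h *m t'); split => //; exact: translationsD.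
- move=> _ [h [t [ht ->]]]; exists (- h), (- (holonomy s (- h) *m t)); split.
    exact: translationsV.
  have E := inv h t ht; have [_ gu] := mulmx1_unit E.
  by move/(congr1 (mulmx^~ (invmx (affine_map (holonomy s h) t)))): E; rewrite /= mulmxK // mul1mx.
Qed.

Lemma component_group_discrete : discrete component_group.
Proof.
move=> g Gg; split; first by rewrite inE.
have [d d0 dP] := affine_map_separated.
exists (ball g d); first exact: nbhsx_ballx.
apply/seteqP; split=> [g' [gg' Gg']|_ ->]; last by split => //; exact: ballxx.
move: Gg Gg' gg' => [h [t [_ ->]]] [h' [t' [_ ->]]]; rewrite mx_norm_ball /ball_ /= => /dP[-> ->].
by [].
Qed.

Lemma component_group_torsion_free : torsion_free component_group.
Proof.
move=> _ n [h [t [ht ->]]] n0; rewrite affine_mapX -affine_map1.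
have [d d0 dP] := affine_map_separated => E.
have [_ t0] : holonomy s h ^+ n = 1%:M /\ orbit_sum (holonomy s h) t n = 0.
  by apply: dP; rewrite E subrr normr0.
have A1 : holonomy s h = 1%:M by apply: holonomy_trivial; apply: s_sep; exact: (orbit_sum_torsion n0 ht t0).
by move: t0; rewrite A1 orbit_sum1 => /(mx_mulrn_eq0 n0) ->.
Qed.

Lemma component_group_cocompact : exists K : set 'cV[R]_(dim s), compact K /\
  forall x, exists2 g, component_group g & K (euclidean_act g x).
Proof.
exists [set x | `|x| <= (dim s)%:R * `|S| * N%:R]; split; first exact: mx_ball_compact.
move=> x; have [y ->] : exists y, x = S *m y.
  by exists (invmx S *m x); rewrite mulKVmx ?real_root_unit.
pose u : 'cV[int]_(dim s) := \col_i (- Num.floor (y i 0 / N%:R)).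
exists (affine_map (holonomy s 0) (N%:R *: u)).
  by apply: component_group_affine; exact: translations_multiple.
rewrite /affine_map holonomy0 conj1 /euclidean_act block_mxKul block_mxKur mul1mx /=.
rewrite -mulmxDr; apply: le_trans (mx_norm_mul _ _) _; rewrite ler_wpM2l ?mulr_ge0 //.
apply: mx_norm_le => // i j; rewrite !mxE !ord1 natz rmorphM rmorphN /= -pmulrn.
have N0 : 0 < N%:R :> R by rewrite ltr0n.
have /andP[f1 f2] := floor_itv (y i 0 / N%:R).
have -> : y i 0 + N%:R * - (Num.floor (y i 0 / N%:R))%:~R =
   N%:R * (y i 0 / N%:R - (Num.floor (y i 0 / N%:R))%:~R).
  by rewrite mulrBr mulrCA divff ?lt0r_neq0 // mulr1 mulrN.
rewrite normrM ger0_norm // -[leRHS]mulr1 ler_wpM2l // ger0_norm ?subr_ge0 //.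
by rewrite lerBlDl ltW // -[X in _ < _ + X]/(1%:~R) -intrD.
Qed.

Definition component_manifold : flat_manifold R (dim s) :=
  FlatManifold component_isometry component_group_group component_group_discrete
    component_group_torsion_free component_group_cocompact.

Definition lattice_translation (u : 'cV[int]_(dim s)) := affine_map 1%:M (N%:R *: u).

Lemma lattice_translation_group u : flat_group component_manifold (lattice_translation u).
Proof.
rewrite /= /lattice_translation -(holonomy0 s).
by apply: component_group_affine; exact: translations_multiple.
Qed.

Lemma lattice_translationD u v :
  lattice_translation (u + v) = lattice_translation u *m lattice_translation v.
Proof. by rewrite /lattice_translation affine_mapM !mul1mx scalerDr. Qed.

Lemma lattice_translation_inj : injective lattice_translation.
Proof.
move=> u v; rewrite /lattice_translation => E.
have [d d0 dP] := affine_map_separated.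
have [_] : 1%:M = 1%:M :> 'M[int]_(dim s) /\ N%:R *: u = N%:R *: v.
  by apply: dP; rewrite E subrr normr0.
move=> uv; apply/colP => i; have := congr1 (fun w : 'cV[int]_(dim s) => w i 0) uv.
rewrite !mxE => /mulfI; apply; by rewrite pnatr_eq0 -lt0n.
Qed.

Lemma lattice_translation_conj h t u :
  affine_map (holonomy s h) t *m lattice_translation u =
  lattice_translation (holonomy s h *m u) *m affine_map (holonomy s h) t.
Proof.
rewrite /lattice_translation !affine_mapM mulmx1 mul1mx.
by rewrite -scalemxAr mul1mx addrC.
Qed.

Lemma holonomy_order h : holonomy s h ^+ N = 1%:M.
Proof.
rewrite holonomyX; apply: holonomy_trivial => c cs; rewrite /rot weightMn.
apply/eqP; rewrite residue_class_eq0 natz; apply: dvdz_mull.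
by rewrite dvdzE /=; exact: s_dvd.
Qed.

End RealRoot.

(** * Incompatible flat manifolds *)

(** The rational form from the cusp has determinant - det q up to squares; as it
    is invariant under holonomy, its determinant is also that of the Gram matrix
    up to squares. *)
Lemma component_obstruction (R : realType) (s : seq component) N n :
  n = dim s -> (1 < n)%N -> (0 < N)%N ->
  (forall c, c \in s -> (0 < c.1)%N) -> (forall c, c \in s -> (c.1.+1 %| N)%N) ->
  (forall h, (forall c, c \in s -> rot c h = 0 -> shift c h = 0) ->
    forall c, c \in s -> rot c h = 0) ->
  (forall c, c \in s -> \det (skew_block c) != 0) ->
  exists B : flat_manifold R n, forall (M M' : hyperbolic_manifold R n.+1) (q : 'M[rat]_n.+2),
    cusp_cross_section B M -> isometric M M' -> quasi_arithmetic_for q M' ->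
    exists2 x : rat, x != 0 & - \det q * \prod_(c <- s) c.1.+1%:R = x ^+ 2.
Proof.
move=> -> n1 N0 pos dvdN sep skew.
exists (component_manifold R pos N0 dvdN sep) => M M' q cusp iso qa.
have [G [GT G0 [r Gr] Ginv]] := quasi_arithmetic_cusp_form n1 cusp iso qa
  (lattice_translation_group R pos N0 dvdN sep) (@lattice_translationD R s N pos)
  (@lattice_translation_inj R s N pos N0).
have [h|y Gy] := invariant_form_det skew GT.
  have [t ht] := translations_nonempty h pos.
  apply: (Ginv _ N (affine_map R (holonomy s h) t) N0); first exact: holonomy_order.
    exact: component_group_affine.
  by move=> u; exact: lattice_translation_conj.
have P0 : \prod_(c <- s) c.1.+1%:R != 0 :> rat.
  by rewrite prodf_seq_neq0; apply/allP => c _ /=; rewrite pnatr_eq0.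
have r0 : r != 0.
  by apply: contraNneq G0 => r0; move: Gr; rewrite r0 expr0n mulr0 => /esym/eqP; rewrite oppr_eq0.
exists (y / r).
  rewrite mulf_neq0 ?invr_eq0 //; apply: contraNneq (mulf_neq0 G0 P0) => y0.
  by rewrite Gy y0 expr0n.
by rewrite expr_div_n -Gy -[\det G]opprK -Gr; field.
Qed.

Lemma rat_square_neq5 (w : rat) : w ^+ 2 != 5.
Proof.
apply/eqP => w5.
have : (numq w) ^+ 2 = 5 * (denq w) ^+ 2.
  have d0 : (denq w)%:~R != 0 :> rat by rewrite intr_eq0 denq_eq0.
  have wd : w * (denq w)%:~R = (numq w)%:~R by rewrite -numqE.
  apply: (@intr_inj rat); rewrite !expr2 !rmorphM /= -wd.
  have -> : (5 : int)%:~R = w * w :> rat by rewrite -expr2 w5.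
  by ring.
move=> /(congr1 absz); rewrite abszM !abszX => /(congr1 (logn 5)).
have n0 : (0 < `|numq w|)%N.
  by rewrite absz_gt0 numq_eq0; apply/eqP => w0; move: w5; rewrite w0.
have d0 : (0 < `|denq w|)%N by rewrite absz_gt0 denq_eq0.
rewrite lognM ?expn_gt0 ?d0 // !lognX (_ : logn 5 `|5| = 1%N) //; lia.
Qed.

Lemma dim_cat s s' : dim (s ++ s') = (dim s + dim s')%N.
Proof. by elim: s => //= c s ->; rewrite addnA. Qed.

Lemma rot_eq0 c h : rot c h = 0 <-> (c.1.+1%:Z %| weight c.2.1 h)%Z.
Proof. by rewrite -residue_class_eq0; split=> [?|/eqP //]; apply/eqP. Qed.

Lemma shift_eq0 c h : shift c h = 0 <-> (c.1.+1%:Z %| weight c.2.2 h)%Z.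
Proof. by rewrite -residue_class_eq0; split=> [?|/eqP //]; apply/eqP. Qed.

(** Some rotation character vanishes at h modulo 3. By hypothesis the
    independent translation character vanishes too, so h is 0 modulo 3. *)
Lemma components3_separated h :
  (forall c, c \in components3 -> rot c h = 0 -> shift c h = 0) ->
  forall c, c \in components3 -> rot c h = 0.
Proof.
move=> sep; have sep' c : c \in components3 -> (c.1.+1%:Z %| weight c.2.1 h)%Z ->
    (c.1.+1%:Z %| weight c.2.2 h)%Z by move=> cs /rot_eq0 /(sep c cs) /shift_eq0.
have := sep' (2%N, ((1, 0), (0, 1))) isT; have := sep' (2%N, ((0, 1), (1, 0))) isT.
have := sep' (2%N, ((1, 1), (1, 0))) isT; have := sep' (2%N, ((1, -1), (1, 0))) isT.
move=> {sep sep'} s1 s2 s3 s4 c; rewrite !inE rot_eq0 => /or4P[] /eqP ->;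
  move: s1 s2 s3 s4; rewrite /weight /=; lia.
Qed.

(** As for components3, modulo 5. *)
Lemma components5_separated h :
  (forall c, c \in components5 -> rot c h = 0 -> shift c h = 0) ->
  forall c, c \in components5 -> rot c h = 0.
Proof.
move=> sep; have sep' c : c \in components5 -> (c.1.+1%:Z %| weight c.2.1 h)%Z ->
    (c.1.+1%:Z %| weight c.2.2 h)%Z by move=> cs /rot_eq0 /(sep c cs) /shift_eq0.
have := sep' (4%N, ((1, 0), (0, 1))) isT; have := sep' (4%N, ((0, 1), (1, 0))) isT.
have := sep' (4%N, ((1, 1), (1, 0))) isT; have := sep' (4%N, ((2, 1), (1, 0))) isT.
have := sep' (4%N, ((3, 1), (1, 0))) isT; have := sep' (4%N, ((4, 1), (1, 0))) isT.
move=> {sep sep'} s1 s2 s3 s4 s5 s6 c.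
rewrite !inE rot_eq0 => /or3P[/eqP ->|/eqP ->|/or4P[] /eqP ->];
  move: s1 s2 s3 s4 s5 s6; rewrite /weight /=; lia.
Qed.

(** Repeating a component of rank 2 raises the dimension and adds no condition
    on the characters. *)
Definition padded b (s : seq component) :=
  nseq b (head (0%N, (0, 0)) components3) ++ components3 ++ s.

Lemma mem_padded b s c : (c \in padded b s) = (c \in components3) || (c \in s).
Proof.
rewrite /padded !mem_cat mem_nseq; case: (c \in components3) / boolP => [_|]; first by rewrite orbT.
by rewrite inE negb_or => /andP[/negPf -> _]; rewrite andbF.
Qed.

(** All rotations have order 3 or 5, so the translations by multiples of 15
    belong to the group. *)
Lemma padded_obstruction (R : realType) b s n :
  n = dim (padded b s) -> s =i components5 \/ s = [::] ->
  exists B : flat_manifold R n, forall (M M' : hyperbolic_manifold R n.+1) (q : 'M[rat]_n.+2),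
    cusp_cross_section B M -> isometric M M' -> quasi_arithmetic_for q M' ->
    exists2 x : rat, x != 0 & - \det q * \prod_(c <- padded b s) c.1.+1%:R = x ^+ 2.
Proof.
move=> nE s5.
have mem5 c : c \in padded b s -> c \in components3 \/ c \in components5.
  by rewrite mem_padded => /orP[|cs]; [left | case: s5 cs => -> // cs; right].
have small c : c \in padded b s -> c.1 = 2%N \/ c.1 = 4%N.
  have all3 : all (fun c : component => c.1 == 2%N) components3 by [].
  have all5 : all (fun c : component => c.1 == 4%N) components5 by [].
  by move=> /mem5[/(allP all3)|/(allP all5)] /eqP; [left | right].
apply: (@component_obstruction R (padded b s) 15 n nE) => //.
- by rewrite nE /padded !dim_cat /=; lia.
- by move=> c /small[] ->.
- by move=> c /small[] ->.
- move=> h sep c; rewrite mem_padded => /orP[].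
    apply: components3_separated => c' c's; apply: sep; by rewrite mem_padded c's.
  case: s5 => [s5|-> //]; rewrite s5; apply: components5_separated => c' c's.
  by apply: sep; rewrite mem_padded s5 c's orbT.
- by move=> c /mem5[/skew_block3|/skew_block5].
Qed.

Theorem corollary1p7 (R : realType) (n : nat) (n_even : ~~ odd n)
    (n_ge36 : (36 <= n)%N) :
  exists B1 B2 : flat_manifold R n,
    forall M : hyperbolic_manifold R n.+1,
      cusp_cross_section B1 M -> cusp_cross_section B2 M ->
      ~ quasi_arithmetic M.
Proof.
have dimE b s : dim (padded b s) = (b * 2 + 8 + dim s)%N.
  rewrite /padded !dim_cat; have -> : dim components3 = 8%N by [].
  have -> : dim (nseq b (head (0%N, (0, 0)) components3)) = (b * 2)%N.
    by elim: b => //= b ->; rewrite mulSn.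
  by rewrite addnA.
(* Seven components of rank 4, an odd number; they have the same total rank as
   the 14 components of rank 2 that replace them in the other manifold. *)
pose s5 : seq component := head (0%N, (0, 0)) components5 :: components5.
pose b := ((n - 36)./2)%N.
have nb : n = (b * 2 + 36)%N.
  by rewrite /b; have := odd_double_half (n - 36); rewrite oddB // (negPf n_even) /= -muln2; lia.
have n1 : n = dim (padded (b + 14) [::]) by rewrite dimE nb /=; lia.
have n2 : n = dim (padded b s5) by rewrite dimE nb /=; lia.
have [B1 B1P] := @padded_obstruction R _ _ _ n1 (or_intror erefl).
have s5E : s5 =i components5 by move=> c; rewrite inE; case: eqP => // ->; rewrite mem_head.
have [B2 B2P] := @padded_obstruction R _ _ _ n2 (or_introl s5E).
exists B1, B2 => M cusp1 cusp2 [q [M' [qa iso]]].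
have [x1 x10 x1E] := B1P M M' q cusp1 iso qa.
have [x2 x20 x2E] := B2P M M' q cusp2 iso qa.
have prodE b' s : \prod_(c <- padded b' s) c.1.+1%:R = 3 ^+ b' * 81 * \prod_(c <- s) c.1.+1%:R :> rat.
  rewrite /padded !big_cat /= mulrA; congr (_ * _ * _); last first.
    by rewrite !big_cons big_nil /=; ring.
  elim: b' => [|b' IH]; first by rewrite big_nil.
  by rewrite /= big_cons IH exprS.
have s5_prod : \prod_(c <- s5) c.1.+1%:R = 5 ^+ 7 :> rat.
  by rewrite /s5 !big_cons big_nil /=; ring.
move: x1E x2E; rewrite !prodE s5_prod big_nil mulr1 exprD => x1E x2E.
have q0 : \det q != 0.
  by apply: contraNneq x10 => q0; move: x1E; rewrite q0 oppr0 mul0r => /esym/eqP; rewrite sqrf_eq0 => ->.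
have three : 3 ^+ b != 0 :> rat by rewrite expf_neq0.
move: (\det q) (3 ^+ b) q0 three x1E x2E => d t d0 t0 x1E x2E.
(* (x1 x2)^2 = 5 e^2, as t ^+ 2 * 3 ^+ 22 * 5 ^+ 7 is 5 times a square *)
pose e := d * t * (3 ^+ 11 * 5 ^+ 3).
have e0 : e != 0.
  by rewrite /e; apply: mulf_neq0; [apply: mulf_neq0 | apply: mulf_neq0; apply: expf_neq0].
have /negP[] := rat_square_neq5 (x1 * x2 / e).
apply/eqP; rewrite expr_div_n exprMn -x1E -x2E.
apply: (canLR (mulfK _)); first by rewrite expf_neq0.
rewrite /e; ring.
Qed.
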